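(* For any countable chains $C_1$ and $C_2$ without least elements, if $A_1$ and $A_2$ are the limit trees of $B$-sets over $T_{C_1}$ and $T_{C_2}$ respectively (with $C_1$, $C_2$ as colour sets), and the permutation groups $G_1=\mathrm{Aut}(A_1)$ and $G_2=\mathrm{Aut}(A_2)$ are isomorphic in their actions on the corresponding sets $M_1$ and $M_2$, then $T_{C_1}\cong T_{C_2}$ and $C_1\cong C_2$.
   Context: Permutation groups $(G_1,M_1)$, $(G_2,M_2)$ are isomorphic if there is a bijection $M_1\to M_2$ inducing an isomorphism of $G_1$ onto $G_2$ by conjugation. $B$-sets. A $B$-relation on a non-empty set $X$ is a ternary relation $B(x;y,z)$ such that: (B1) $B(x;y,z)\to B(x;z,y)$; (B2) $B(x;y,z)\wedge B(y;x,z)\leftrightarrow x=y$; (B3) $B(x;y,z)\to B(x;y,w)\vee B(x;w,z)$. It is of positive type if for any $x,y,z$ for which $B$ does not hold in any order there is $u$ with $B(u;x,y)$, $B(u;x,z)$, $B(u;y,z)$. The branches at $a\in X$ are the classes of the equivalence relation $\neg B(a;y,z)$ on $X\setminus\{a\}$; $a$ is a ramification point if there are at least 3 branches at $a$. Trees. A semilinear order is a partial order $(T,\le)$ such that each $\{y:y\le x\}$ is linearly ordered and any two elements have a common lower bound. The cones at $t\in T$ are the classes of $\{x:x>t\}$ under: $x\sim y$ iff there is $z>t$ with $z\le x,y$; their number is the ramification order of $t$; $t$ ramifies if this is greater than 1. Let $C$ be a countable chain with no least element. A $C$-colouring of $T$ is $F:T\to C$ with $s<t\Rightarrow F(s)<F(t)$;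 a $C$-chain is a chain in $T$ on which all members of $C$ arise as colours. $T_C$ is the countable $C$-coloured semilinearly ordered meet semilattice, unique up to isomorphism, in which every non-maximal point has ramification order $\aleph_0$ and every point lies in a $C$-chain. Trees of $B$-sets. A tree of $B$-sets $A$ consists of a (possibly coloured) semilinear order $T=T^A$ which is a lower semilattice; for each $t\in T$ a $B$-set $(B(t),B_t)$ of positive type; and functions $f_t$ ($t\in T$), $g_{st}$ ($s\le t$) such that: $f_t$ is a surjection from $\{s\in T:t<s\}$ to the set of ramification points of $B(t)$ with $f_t(s_1)=f_t(s_2)$ iff $s_1,s_2$ lie in the same cone at $t$; $g_{ss}$ is the identity on $B(s)$; if $s<t$, $g_{st}$ is a surjection from $B(s)\setminus\bigcup_{s\le u<t}g_{su}^{-1}(f_u(t))$ to $B(t)$, and $g_{st}(x)=g_{st}(y)$ iff for some $u$ with $s\le u<t$, $g_{su}(x)$ and $g_{su}(y)$ lie in the same branch of $B_u$ at $f_u(t)$; and $g_{su}=g_{tu}\circ g_{st}$ for $s\le t\le u$. A finite tree of $B$-sets over $T_C$ is one whose underlying tree is a finite meet-closed subtree of $T_C$ with inherited order and colours, with a root and with all its non-leaf vertices ramifying (in the finite tree), and all of whose $B(t)$ are finite. For $B$-sets of positive type, a strong embedding is an isomorphism onto the restriction of the target relation to a subset. A strong embedding of a tree of $B$-sets $A$ into $A'$ consists of a tree embedding $\tau:T^{A}\to T^{A'}$ preserving colours, $<$ and meets and strong $B$-set embeddings $\varphi_t:B(t)\to B(\tau(t))$ with $\varphi_tf_t=f_{\tau(t)}\tau$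 and $g_{\tau(s)\tau(t)}\varphi_s=\varphi_tg_{st}$ for $s\le t$; $A$ is a strong substructure of $A'$ if the inclusions form a strong embedding; isomorphisms are bijective strong embeddings. The limit over $T_C$. $A$ is the countable $C$-coloured tree of $B$-sets, unique up to isomorphism, which is the union of a chain $A^0\le A^1\le\cdots$ of finite trees of $B$-sets over $T_C$ (each a strong substructure of the next), such that: every finite tree of $B$-sets which is a strong substructure of $A$ is one over $T_C$; every finite tree of $B$-sets over $T_C$ embeds strongly into $A$; if $B$ is a strong substructure of $E$, both finite over $T_C$, any strong embedding of $B$ into $A$ extends to one of $E$; every isomorphism between finite strong substructures of $A$ extends to an automorphism of $A$. Its underlying tree $T$ is isomorphic to $T_C$. Let $r_i$ be the root of $A^i$ and $M^i=B(r_i)$ the domain of its $B$-set at $r_i$. $M^i$ is embedded in $M^{i+1}$ by sending $a$ to some member of $g_{r_{i+1}r_i}^{-1}(a)$ (computed in $A^{i+1}$), and $M$ is the union (direct limit) of the $M^i$. For $a\in M$ and $t\in T$: in $A^i$ (with $a\in M^i$, $t\in T^{A^i}$, $a\in\mathrm{dom}(g_{r_it})$) let $[a]_t=g_{r_it}^{-1}g_{r_it}(a)$; these sets increase with $i$, and in $A$, $[a]_t$ denotes their union. For fixed $t$ the sets $[a]_t$ are pairwise disjoint or equal subsets of $M$, and they are identified with the members of $B(t)$. $G=\mathrm{Aut}(A)$ is the group of all automorphisms of $A$; it acts on $M$ as follows: writing $T_a=\{s\in T:[a]_s\text{ exists}\}$ (so that $\{a\}=\bigcap_{s\in T_a}[a]_s$),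 $\theta(a)=b$ iff for some $t_1\in T_a$, $t_2\in T_b$, $\theta$ takes $\{t\in T_a:t\le t_1\}$ to $\{t\in T_b:t\le t_2\}$ and $\theta([a]_t)=[b]_t$ for each $t\in T_a$ with $t\le t_1$.
   Formalization: An automorphism of A need not map M into M under the stated rule, so G is taken to be the group of permutations of M induced by those automorphisms of A that do permute M; the rule's condition θ([a]_t)=[b]_t is read as θ([a]_t)=[b]_{θ(t)}. *)

(* Defs.v *)
From Stdlib Require Import Relations List FinFun Ensembles.

Set Implicit Arguments.
Unset Strict Implicit.
Unset Printing Implicit Defensive.

Definition countable (X : Type) : Prop :=
  exists f : X -> nat, Injective f.

(** * Chains *)

Record Chain : Type := {
  colour :> Type;
  cle : relation colour;
  cle_order : order colour cle;
  cle_total : forall c d : colour, cle c d \/ cle d c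
}.
Arguments cle {c} _ _ : rename.

Definition clt {C : Chain} (c d : C) : Prop := cle c d /\ c <> d.

Definition no_least (C : Chain) : Prop :=
  ~ exists c : C, forall d : C, cle c d.

Definition chain_isomorphic (C1 C2 : Chain) : Prop :=
  exists sigma : C1 -> C2,
    Bijective sigma /\ forall c d, cle (sigma c) (sigma d) <-> cle c d.

(** * Coloured trees *)

Section SemilinearOrders.
Context (T : Type) (le : relation T).

Definition semilinear : Prop :=
  order T le /\
  (forall x y z, le y x -> le z x -> le y z \/ le z y) /\
  (forall x y, exists z, le z x /\ le z y).

Definition is_meet (x y m : T) : Prop :=
  le m x /\ le m y /\ forall z, le z x -> le z y -> le z m.

End SemilinearOrders.

Record ColouredTree (C : Chain) : Type := {
  node :> Type;
  tle : relation node;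
  tle_semilinear : semilinear tle;
  tle_meet : forall x y, exists m, is_meet tle x y m;
  col : node -> C;
  col_lt : forall s t, tle s t -> s <> t -> clt (col s) (col t)
}.
Arguments tle {C c} _ _ : rename.
Arguments col {C c} _ : rename.

Section Trees.
Context {C : Chain} {T : ColouredTree C}.
Implicit Types s t x y : T.

Definition tlt s t : Prop := tle s t /\ s <> t.

(* [same_cone t] is meant only for nodes strictly above [t]. *)
Definition same_cone t x y : Prop :=
  exists z, tlt t z /\ tle z x /\ tle z y.

Definition maximal t : Prop := ~ exists s, tlt t s.

Definition ramifies t : Prop :=
  exists x y, tlt t x /\ tlt t y /\ ~ same_cone t x y.

(* [c] enumerates the cones at [t] without repetition. *)
Definition ramification_order_aleph0 t : Prop :=
  exists c : nat -> T,
    (forall i, tlt t (c i)) /\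
    (forall i j, same_cone t (c i) (c j) -> i = j) /\
    (forall x, tlt t x -> exists i, same_cone t (c i) x).

Definition is_C_chain (S : T -> Prop) : Prop :=
  (forall x y, S x -> S y -> tle x y \/ tle y x) /\
  (forall c : C, exists x, S x /\ col x = c).

Definition is_root t : Prop := forall s, tle t s.

End Trees.

(* The characterization of the coloured tree T_C. *)
Definition is_T_C (C : Chain) (T : ColouredTree C) : Prop :=
  inhabited T /\
  countable T /\
  (forall t : T, ~ maximal t -> ramification_order_aleph0 t) /\
  (forall t : T, exists S : T -> Prop, S t /\ is_C_chain S).

Record is_tree_embedding (C : Chain) (T T' : ColouredTree C) (tau : T -> T')
  : Prop := {
  te_col : forall t, col (tau t) = col t;
  te_le : forall s t, tle (tau s) (tau t) <-> tle s t;
  te_meet : forall x y m,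
    is_meet tle x y m -> is_meet tle (tau x) (tau y) (tau m)
}.

(* The colour sets may differ: colours are carried along an isomorphism of the
   colour chains. *)
Definition coloured_tree_isomorphic (C1 C2 : Chain)
    (T1 : ColouredTree C1) (T2 : ColouredTree C2) : Prop :=
  exists (sigma : C1 -> C2) (tau : T1 -> T2),
    Bijective sigma /\ (forall c d, cle (sigma c) (sigma d) <-> cle c d) /\
    Bijective tau /\ (forall s t, tle (tau s) (tau t) <-> tle s t) /\
    (forall t, col (tau t) = sigma (col t)).

(** * B-sets of positive type *)

Record BSet : Type := {
  point :> Type;
  btw : point -> point -> point -> Prop;
  point_inhabited : inhabited point;
  btw_B1 : forall x y z, btw x y z -> btw x z y;
  btw_B2 : forall x y z, (btw x y z /\ btw y x z) <-> x = y;
  btw_B3 : forall x y z w, btw x y z -> btw x y w \/ btw x w z;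
  (* By B1, these three are all the orders of x, y, z. *)
  btw_positive : forall x y z,
    ~ btw x y z -> ~ btw y x z -> ~ btw z x y ->
    exists u, btw u x y /\ btw u x z /\ btw u y z
}.
Arguments btw {b} _ _ _ : rename.

Definition same_branch {X : BSet} (a y z : X) : Prop :=
  y <> a /\ z <> a /\ ~ btw a y z.

Definition ramification_point {X : BSet} (a : X) : Prop :=
  exists y1 y2 y3 : X,
    y1 <> a /\ y2 <> a /\ y3 <> a /\
    ~ same_branch a y1 y2 /\ ~ same_branch a y1 y3 /\ ~ same_branch a y2 y3.

Record is_B_embedding (X Y : BSet) (phi : X -> Y) : Prop := {
  be_inj : Injective phi;
  be_btw : forall x y z, btw (phi x) (phi y) (phi z) <-> btw x y z
}.

(** * Trees of B-sets *)

(* The value [tb_f t s] is relevant only for [t < s], and [tb_g s t] only for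
   [s <= t]; [tb_g s t x = None] says that [x] is outside the domain of the
   partial function g_st.  No condition constrains or uses the other values. *)
Unset Implicit Arguments.
Record TreeOfBSets (C : Chain) : Type := {
  tree :> ColouredTree C;
  bset : tree -> BSet;
  tb_f : forall t : tree, tree -> bset t;
  tb_g : forall s t : tree, bset s -> option (bset t);

  tb_f_ram : forall t s, tlt t s -> ramification_point (tb_f t s);
  tb_f_surj : forall t (a : bset t), ramification_point a ->
    exists s, tlt t s /\ tb_f t s = a;
  tb_f_cone : forall t s1 s2, tlt t s1 -> tlt t s2 ->
    (tb_f t s1 = tb_f t s2 <-> same_cone t s1 s2);

  tb_g_refl : forall s (x : bset s), tb_g s s x = Some x;
  tb_g_dom : forall s t (x : bset s), tlt s t ->
    (tb_g s t x = None <->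
     exists u, tle s u /\ tlt u t /\ tb_g s u x = Some (tb_f u t));
  tb_g_surj : forall s t (y : bset t), tlt s t ->
    exists x : bset s, tb_g s t x = Some y;
  tb_g_eq : forall s t (x y : bset s) (x' y' : bset t), tlt s t ->
    tb_g s t x = Some x' -> tb_g s t y = Some y' ->
    (x' = y' <->
     exists u (a b : bset u), tle s u /\ tlt u t /\
       tb_g s u x = Some a /\ tb_g s u y = Some b /\
       same_branch (tb_f u t) a b);
  tb_g_comp : forall s t u (x : bset s), tle s t -> tle t u ->
    tb_g s u x = match tb_g s t x with Some y => tb_g t u y | None => None end
}.
Set Implicit Arguments.
Arguments bset {C t} _ : rename.
Arguments tree {C} _ : rename.
Arguments tb_f {C t} _ _ : rename.
Arguments tb_g {C t} _ _ _ : rename.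

Record StrongEmb (C : Chain) (A A' : TreeOfBSets C) : Type := {
  se_node :> A -> A';
  se_pt : forall t : A, bset t -> bset (se_node t);
  se_node_emb : is_tree_embedding se_node;
  se_pt_emb : forall t, is_B_embedding (@se_pt t);
  se_f : forall t s : A, tlt t s ->
    se_pt (tb_f t s) = tb_f (se_node t) (se_node s);
  se_g : forall (s t : A) (x : bset s), tle s t ->
    tb_g (se_node s) (se_node t) (se_pt x)
    = option_map (@se_pt t) (tb_g s t x)
}.
Arguments se_pt {C A A'} _ {t} _ : rename.

Definition is_iso (C : Chain) (A A' : TreeOfBSets C) (e : StrongEmb A A')
  : Prop :=
  Bijective e /\ forall t : A, Bijective (fun x : bset t => se_pt e x).

(* All pairs (t, x) with x in B(t).  Embeddings are compared through their
   action on these pairs, which avoids casts between the types B(t); since no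
   B(t) is empty this determines the action on nodes as well. *)
Definition pt {C : Chain} (A : TreeOfBSets C) : Type := {t : A & bset t}.

Definition mkpt {C : Chain} {A : TreeOfBSets C} (t : A) (x : bset t) : pt A :=
  existT (fun u : A => point (bset u)) t x.

Definition on_pt {C : Chain} {A A' : TreeOfBSets C} (e : StrongEmb A A')
    (p : pt A) : pt A' := mkpt (se_pt e (projT2 p)).

(** * Finite trees of B-sets and the limit over T_C *)

Definition finite_tree_of_B_sets (C : Chain) (E : TreeOfBSets C) : Prop :=
  Finite E /\
  (exists r : E, is_root r) /\
  (forall t : E, ~ maximal t -> ramifies t) /\
  (forall t : E, Finite (bset t)).

(* Subtrees of T_C are taken up to isomorphism. *)
Definition over (C : Chain) (TC : ColouredTree C) (E : TreeOfBSets C) : Prop :=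
  exists tau : E -> TC, is_tree_embedding tau.

Definition finite_over (C : Chain) (TC : ColouredTree C) (E : TreeOfBSets C)
  : Prop := finite_tree_of_B_sets E /\ over TC E.

(* A presentation of [A] as the union of a chain of finite trees of B-sets
   over [TC]. *)
Record UnionOfChain (C : Chain) (TC : ColouredTree C) (A : TreeOfBSets C)
  : Type := {
  stage : nat -> TreeOfBSets C;
  stage_finite : forall i, finite_over TC (stage i);
  step : forall i, StrongEmb (stage i) (stage (S i));
  incl : forall i, StrongEmb (stage i) A;
  incl_step : forall i (p : pt (stage i)),
    on_pt (incl (S i)) (on_pt (step i) p) = on_pt (incl i) p;
  incl_cover : forall p : pt A, exists i (q : pt (stage i)),
    on_pt (incl i) q = p
}.
Arguments stage {C TC A} _ _ : rename.
Arguments step {C TC A} _ _ : rename.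
Arguments incl {C TC A} _ _ : rename.

(* A finite strong substructure of [A] is a finite tree of B-sets together with
   a strong embedding into [A]. *)
Record is_limit (C : Chain) (TC : ColouredTree C) (A : TreeOfBSets C)
  : Prop := {
  lim_countable : countable A /\ forall t : A, countable (bset t);
  lim_union : inhabited (UnionOfChain TC A);
  lim_age : forall E : TreeOfBSets C,
    finite_tree_of_B_sets E -> inhabited (StrongEmb E A) -> over TC E;
  lim_universal : forall E : TreeOfBSets C,
    finite_over TC E -> inhabited (StrongEmb E A);
  lim_extension : forall (D E : TreeOfBSets C)
    (i : StrongEmb D E) (psi : StrongEmb D A),
    finite_over TC D -> finite_over TC E ->
    exists chi : StrongEmb E A,
      forall p : pt D, on_pt chi (on_pt i p) = on_pt psi p;
  lim_homogeneous : forall (D E : TreeOfBSets C)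
    (i : StrongEmb D A) (j : StrongEmb E A) (h : StrongEmb D E),
    finite_tree_of_B_sets D -> finite_tree_of_B_sets E -> is_iso h ->
    exists theta : StrongEmb A A,
      is_iso theta /\
      forall p : pt D, on_pt theta (on_pt i p) = on_pt j (on_pt h p)
}.

(** * The set M and the action of Aut(A) on it *)

(* [M] is the direct limit of the sets M^i = B(r_i) along a choice [next] of
   preimages, given (up to bijection) by its canonical maps [into]. *)
Record LimitSet (C : Chain) (TC : ColouredTree C) (A : TreeOfBSets C)
    (U : UnionOfChain TC A) : Type := {
  root : forall i, stage U i;
  root_is_root : forall i, is_root (root i);
  next : forall i, bset (root i) -> bset (root (S i));
  next_preimage : forall i (a : bset (root i)),
    tb_g (root (S i)) (step U i (root i)) (next a)
    = Some (se_pt (step U i) a);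
  limset :> Type;
  into : forall i, bset (root i) -> limset;
  into_inj : forall i, Injective (@into i);
  into_next : forall i (a : bset (root i)), into (next a) = into a;
  into_cover : forall a : limset, exists i (a' : bset (root i)), into a' = a
}.
Arguments root {C TC A U} _ _ : rename.
Arguments into {C TC A U} _ {i} _ : rename.

Section Action.
Context {C : Chain} {TC : ColouredTree C} {A : TreeOfBSets C}.
Context {U : UnionOfChain TC A} (M : LimitSet U).

(* The set T_a. *)
Definition class_exists (a : M) (t : A) : Prop :=
  exists i (a' : bset (root M i)) (t' : stage U i),
    into M a' = a /\ incl U i t' = t /\ tb_g (root M i) t' a' <> None.

(* The subset [a]_t of M. *)
Definition class (a : M) (t : A) : Ensemble M := fun b =>
  exists i (a' b' : bset (root M i)) (t' : stage U i),
    into M a' = a /\ into M b' = b /\ incl U i t' = t /\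
    tb_g (root M i) t' a' <> None /\
    tb_g (root M i) t' b' = tb_g (root M i) t' a'.

(* The subset of M identified with the member [x] of B(t). *)
Definition block (t : A) (x : bset t) : Ensemble M := fun b =>
  exists i (b' : bset (root M i)) (t' : stage U i) (y : bset t'),
    into M b' = b /\ tb_g (root M i) t' b' = Some y /\
    on_pt (incl U i) (mkpt y) = mkpt x.

(* theta(a) = b.  As theta takes B(t) to B(theta(t)), the image of [a]_t is to
   be the class of b at theta(t). *)
Definition acts (theta : StrongEmb A A) (a b : M) : Prop :=
  exists t1 t2 : A,
    class_exists a t1 /\ class_exists b t2 /\
    (forall s : A,
       (exists t, class_exists a t /\ tle t t1 /\ theta t = s) <->
       (class_exists b s /\ tle s t2)) /\
    (forall (t : A) (x : bset t), class_exists a t -> tle t t1 ->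
       Same_set M (class a t) (block x) ->
       Same_set M (class b (theta t)) (block (se_pt theta x))).

(* The permutation group (G, M): all permutations of M induced by automorphisms
   of A.  Whether [acts theta] is a total function on M for a given theta is
   not presupposed. *)
Definition Aut_perm (pi : M -> M) : Prop :=
  Bijective pi /\
  exists theta : StrongEmb A A, is_iso theta /\ forall a, acts theta a (pi a).

End Action.

(* Conjugation by [h] maps G1 onto G2. *)
Definition perm_groups_isomorphic (M1 M2 : Type)
    (G1 : (M1 -> M1) -> Prop) (G2 : (M2 -> M2) -> Prop) : Prop :=
  exists h : M1 -> M2,
    Bijective h /\
    (forall p1, G1 p1 -> exists p2, G2 p2 /\ forall a, p2 (h a) = h (p1 a)) /\
    (forall p2, G2 p2 -> exists p1, G1 p1 /\ forall a, p2 (h a) = h (p1 a)).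

(* Main.v *)
(** The pair (A, M) is homogeneous, whatever preimages were chosen to build M:
    over a finite substructure with root r, any two sections of B(q) -> B(r),
    q < r, are conjugate, because the points of a section lie in distinct
    branches at one ramification point.  Back and forth along the stages then
    produces automorphisms of A acting on M.

    For distinct a, b, c in M there is exactly one node t at which [a]_t, [b]_t,
    [c]_t are distinct and one of them lies between the others.  By homogeneity
    the orbits of G on triples are given by the middle point and the colour of
    this node.  The middle point is the one that G can fix while interchanging
    the other two, so the permutation group determines the middle points and
    equality of colours.  For colours c <> d one has c < d iff some p, a, b, e
    have p in the middle of each of {p, a, b}, {p, a, e}, {p, b, e} with colour
    c, and a in the middle of {a, b, e} with colour d: take p to be the
    ramification point whose cone contains the node of {a, b, e}.  Hence
    C_1 and C_2 are isomorphic, and T_C is determined by C by back and forth on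
    finite sets of nodes with matching colours of meets. *)

From Stdlib Require Import Relations List FinFun Classical ClassicalEpsilon Eqdep Lia PeanoNat.
Require Import Defs.

Set Implicit Arguments.
Unset Strict Implicit.
Unset Printing Implicit Defensive.

(** * Trees, B-sets and strong embeddings *)

(** Two obstacles shape the formal proof. The types [bset t] depend on the node, so embeddings are
    handled as maps on the pairs in [pt A], where composites and unions of embeddings need no casts.
    And the age of [A] is given by abstract finite trees, so every existence claim needs an explicit
    tree of B-sets; single nodes with a linear B-set, and joins of two trees above a new root,
    suffice. [lim_homogeneous] alone says nothing about [M], which records a choice of preimages:
    extending a finite isomorphism downwards in [A] may disagree with that choice. Since the colours
    have no least element, there is always a node strictly below the root of a finite substructure,
    and the disagreement is corrected there by conjugating sections. About [M] only the properties
    in [coherent] are used; they do not mention the stages, so nothing depends on the presentation.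
    The node attached to a triple is unique because at every node below it the three points form a
    star, and above it their classes are no longer all present and distinct. *)

Section TreeOrder.
Context {C : Chain} {T : ColouredTree C}.
Implicit Types s t u x y : T.

Lemma tle_refl t : tle t t.
Proof. exact (ord_refl _ _ (proj1 (@tle_semilinear C T)) t). Qed.

Lemma tle_trans s t u : tle s t -> tle t u -> tle s u.
Proof. exact (ord_trans _ _ (proj1 (@tle_semilinear C T)) s t u). Qed.

Lemma tle_antisym s t : tle s t -> tle t s -> s = t.
Proof. exact (ord_antisym _ _ (proj1 (@tle_semilinear C T)) s t). Qed.

Lemma tle_below_total x y t : tle x t -> tle y t -> tle x y \/ tle y x.
Proof. exact (proj1 (proj2 (@tle_semilinear C T)) t x y). Qed.

Lemma tle_lower_bound s t : exists u, tle u s /\ tle u t.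
Proof. exact (proj2 (proj2 (@tle_semilinear C T)) s t). Qed.

Lemma tlt_le s t : tlt s t -> tle s t.
Proof. intros [H _]; exact H. Qed.

Lemma tlt_le_trans s t u : tlt s t -> tle t u -> tlt s u.
Proof.
  intros [H N] K; split; [eapply tle_trans; eauto|].
  intros ->; apply N, tle_antisym; assumption.
Qed.

Lemma tle_lt_trans s t u : tle s t -> tlt t u -> tlt s u.
Proof.
  intros K [H N]; split; [eapply tle_trans; eauto|].
  intros ->; apply N, tle_antisym; assumption.
Qed.

Lemma tle_lt_or_eq s t : tle s t -> s = t \/ tlt s t.
Proof. intros H; destruct (classic (s = t)); [left|right; split]; auto. Qed.

Lemma tlt_irrefl t : ~ tlt t t.
Proof. intros [_ N]; auto. Qed.

Lemma tlt_not_le s t : tlt s t -> ~ tle t s.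
Proof. intros H K; exact (tlt_irrefl (tlt_le_trans H K)). Qed.

Lemma same_cone_up t x y : tlt t x -> tle x y -> same_cone t x y.
Proof. intros H K; exists x; auto using tle_refl. Qed.

Lemma same_cone_sym t x y : same_cone t x y -> same_cone t y x.
Proof. intros (z & a & b & c); exists z; auto. Qed.

Lemma same_cone_trans t x y z : same_cone t x y -> same_cone t y z -> same_cone t x z.
Proof.
  intros (u & a & b & c) (u' & a' & b' & c').
  destruct (tle_below_total c b') as [L|L].
  - exists u; split; [|split]; eauto using tle_trans.
  - exists u'; split; [|split]; eauto using tle_trans.
Qed.

Lemma is_meet_unique x y m m' :
  is_meet tle x y m -> is_meet tle x y m' -> m = m'.
Proof.
  intros (a & b & c) (a' & b' & c'); apply tle_antisym; auto.
Qed.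

Lemma is_meet_le x y : tle x y -> is_meet tle x y x.
Proof. intros H; repeat split; auto using tle_refl. Qed.

Lemma is_meet_sym x y m : is_meet tle x y m -> is_meet tle y x m.
Proof. intros (a & b & c); repeat split; auto. Qed.

Lemma not_same_cone_meet t x y :
  tlt t x -> tlt t y -> ~ same_cone t x y -> is_meet tle x y t.
Proof.
  intros Hx Hy N; split; [|split]; auto using tlt_le.
  intros z zx zy.
  destruct (tle_below_total zx (tlt_le Hx)) as [H|H]; auto.
  destruct (tle_lt_or_eq H) as [->|H']; auto using tle_refl.
  destruct N; exists z; auto.
Qed.

Lemma col_le s t : tle s t -> cle (col s) (col t).
Proof.
  intros H; destruct (tle_lt_or_eq H) as [->|K].
  - apply (ord_refl _ _ (@cle_order C)).
  - destruct K as [K N]; exact (proj1 (col_lt K N)).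
Qed.

Lemma col_below_inj s s' t : tle s t -> tle s' t -> col s = col s' -> s = s'.
Proof.
  intros H H' E; apply NNPP; intros N.
  destruct (tle_below_total H H') as [K|K];
    [destruct (col_lt K N) | destruct (col_lt K (not_eq_sym N))]; auto.
Qed.

Lemma col_below_le s s' t : tle s t -> tle s' t -> cle (col s) (col s') -> tle s s'.
Proof.
  intros H H' E; destruct (tle_below_total H H') as [K|K]; auto.
  rewrite (col_below_inj H H'); auto using tle_refl.
  apply (ord_antisym _ _ (@cle_order C)); auto using col_le.
Qed.
End TreeOrder.

Section ChainOrder.
Context {C : Chain}.
Implicit Types c d e : C.

Lemma cle_refl c : cle c c.
Proof. apply (ord_refl _ _ (@cle_order C)). Qed.
Lemma cle_trans c d e : cle c d -> cle d e -> cle c e.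
Proof. apply (ord_trans _ _ (@cle_order C)). Qed.
Lemma cle_antisym c d : cle c d -> cle d c -> c = d.
Proof. apply (ord_antisym _ _ (@cle_order C)). Qed.
Lemma not_cle c d : ~ cle c d -> clt d c.
Proof.
  intros N; destruct (cle_total c d) as [|H]; [tauto|split; auto].
  intros ->; auto.
Qed.
Lemma clt_not_cle c d : clt c d -> ~ cle d c.
Proof. intros [H N] K; apply N, cle_antisym; assumption. Qed.
End ChainOrder.

(** * Betweenness and stars in one B-set *)

Section BetweennessFacts.
Context {X : BSet}.
Implicit Types a w x y z : X.

Lemma btw_refl x y : btw x x y.
Proof. exact (proj1 (proj2 (btw_B2 x x y) eq_refl)). Qed.

Lemma btw_refl_r x y : btw x y x.
Proof. apply btw_B1, btw_refl. Qed.

Lemma btw_antisym x y z : btw x y z -> btw y x z -> x = y.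
Proof. intros H K; exact (proj1 (btw_B2 x y z) (conj H K)). Qed.

Lemma btw_same x y : btw x y y -> x = y.
Proof. intros H; apply (btw_antisym H), btw_refl_r. Qed.

(** Of three points pairwise separated at [e], at least two are separated there from [e']. Seen from
    [e'], both of these lie on the side of [e], so [e'] does not separate them; this is the inner
    claim [H]. *)
Lemma separated_center_unique e e' x y z : e <> e' ->
  btw e x y -> btw e x z -> btw e y z -> btw e' x y -> btw e' x z -> btw e' y z ->
  False.
Proof.
  assert (H : forall a b, e <> e' -> btw e a e' -> btw e b e' -> ~ btw e' a b).
  { intros a b N Ha Hb K; apply N.
    destruct (btw_B3 e K) as [L|L].
    - apply (btw_antisym (z := a)); apply btw_B1; auto.
    - apply (btw_antisym (z := b)); [apply btw_B1|]; auto. }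
  intros N h1 h2 h3 k1 k2 k3.
  destruct (btw_B3 e' h1) as [L|L]; destruct (btw_B3 e' h2) as [L'|L'];
    destruct (btw_B3 e' h3) as [L''|L''];
    try apply btw_B1 in L; try apply btw_B1 in L'; try apply btw_B1 in L'';
    eauto using btw_B1.
  all: first [ apply (H x y N); auto using btw_B1; fail
             | apply (H x z N); auto using btw_B1; fail
             | apply (H y z N); auto using btw_B1; fail ].
Qed.

Lemma btw_not_star e x y z :
  btw x y z -> btw e x y -> btw e x z -> x = e.
Proof.
  intros H h1 h2; destruct (btw_B3 e H) as [L|L].
  - apply (btw_antisym (z := y)); auto using btw_B1.
  - apply (btw_antisym (z := z)); auto using btw_B1.
Qed.
End BetweennessFacts.

(** * Points of a tree of B-sets and the partial maps between nodes *)

Section Points.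
Context {C : Chain} {A : TreeOfBSets C}.
Implicit Types p q r : pt A.
Implicit Types s t u : A.

Definition nd p : A := projT1 p.
Definition gmap p q : Prop :=
  tle (nd p) (nd q) /\ tb_g (nd p) (nd q) (projT2 p) = Some (projT2 q).
Definition between p q r : Prop := exists t (x y z : bset t),
  p = mkpt x /\ q = mkpt y /\ r = mkpt z /\ btw x y z.
Definition cone_pt s t : pt A := mkpt (tb_f s t).

Lemma mkpt_inj t (x y : bset t) : mkpt x = mkpt y -> x = y.
Proof. apply (inj_pair2 A (fun u : A => point (bset u))). Qed.

Lemma pt_eta p : p = mkpt (projT2 p).
Proof. destruct p; reflexivity. Qed.

Lemma pt_at_node p t : nd p = t -> exists x : bset t, p = mkpt x.
Proof. intros <-; exists (projT2 p); apply pt_eta. Qed.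

Lemma between_mkpt t (x y z : bset t) :
  between (mkpt x) (mkpt y) (mkpt z) <-> btw x y z.
Proof.
  split; [|intros H; exists t, x, y, z; auto].
  intros (t' & x' & y' & z' & E & E' & E'' & H).
  assert (t = t') as -> by exact (f_equal nd E).
  apply mkpt_inj in E, E', E''; subst; auto.
Qed.

Lemma between_nd p q r : between p q r -> nd p = nd q /\ nd p = nd r.
Proof. intros (t & x & y & z & -> & -> & -> & _); auto. Qed.

Lemma gmap_refl p : gmap p p.
Proof. split; [apply tle_refl | apply tb_g_refl]. Qed.

Lemma gmap_trans p q r : gmap p q -> gmap q r -> gmap p r.
Proof.
  intros [H E] [K E']; split; [eapply tle_trans; eauto|].
  rewrite (tb_g_comp _ A (nd p) (nd q) (nd r) (projT2 p) H K), E; auto.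
Qed.

Lemma gmap_fun p q q' : gmap p q -> gmap p q' -> nd q = nd q' -> q = q'.
Proof.
  destruct q as [t x], q' as [t' x']; simpl; intros [_ H] [_ H'] E; simpl in *.
  subst t'; rewrite H in H'; injection H' as H'; subst; auto.
Qed.

Lemma gmap_mid p r s : gmap p r -> tle (nd p) s -> tle s (nd r) ->
  exists q, nd q = s /\ gmap p q /\ gmap q r.
Proof.
  intros [H E] K L; rewrite (tb_g_comp _ A (nd p) s (nd r) (projT2 p) K L) in E.
  destruct (tb_g (nd p) s (projT2 p)) as [y|] eqn:Ey; [|discriminate].
  exists (mkpt y); repeat split; auto.
Qed.

Lemma gmap_cancel p q r : gmap p q -> gmap p r -> tle (nd q) (nd r) -> gmap q r.
Proof.
  intros [H E] [_ E'] K; split; auto.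
  rewrite (tb_g_comp _ A (nd p) (nd q) (nd r) (projT2 p) H K), E in E'; auto.
Qed.

Lemma gmap_surj s q : tle s (nd q) -> exists p, nd p = s /\ gmap p q.
Proof.
  intros H; destruct (tle_lt_or_eq H) as [E|K].
  - exists q; auto using gmap_refl.
  - destruct (tb_g_surj _ A _ _ (projT2 q) K) as [x E]; exists (mkpt x).
    repeat split; auto.
Qed.

Lemma tb_g_cone_pt s t : tlt s t -> tb_g s t (tb_f s t) = None.
Proof.
  intros H; apply tb_g_dom; auto.
  exists s; repeat split; auto using tle_refl, tb_g_refl; apply H.
Qed.

Lemma tb_f_up s t u : tlt s t -> tle t u -> tb_f s t = tb_f s u.
Proof.
  intros H K; apply tb_f_cone; eauto using tlt_le_trans, same_cone_up.
Qed.

(** Two points in one branch at [tb_f s t] are already identified by the witness [u = s] in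
    [tb_g_eq]. *)
Lemma g_distinct_btw s t (x y : bset s) (x' y' : bset t) : tlt s t ->
  tb_g s t x = Some x' -> tb_g s t y = Some y' -> x' <> y' ->
  btw (tb_f s t) x y.
Proof.
  intros H E E' N; apply NNPP; intros K; apply N.
  apply (tb_g_eq _ A _ _ _ _ _ _ H E E'); exists s, x, y.
  repeat split; auto using tle_refl, tb_g_refl; try apply H;
  intros ->; rewrite tb_g_cone_pt in *; try discriminate; auto.
Qed.

Lemma g_same_branch s t (x y : bset s) (x' y' : bset t) : tlt s t ->
  tb_g s t x = Some x' -> tb_g s t y = Some y' ->
  ~ btw (tb_f s t) x y -> x' = y'.
Proof.
  intros H E E' N; apply NNPP; intros K; eauto using g_distinct_btw.
Qed.
(** A whole branch at [tb_f s t] moves together. If [y] were deleted at some [u] strictly between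
    [s] and [t], then [x], sharing its branch at [tb_f s u = tb_f s t], would have the same image at
    [u] and be deleted too. *)
Lemma g_follow s t (x y : bset s) (x' : bset t) : tlt s t ->
  tb_g s t x = Some x' -> y <> tb_f s t -> ~ btw (tb_f s t) x y ->
  tb_g s t y = Some x'.
Proof.
  intros L H N S.
  destruct (tb_g s t y) as [z|] eqn:E.
  - f_equal; symmetry; exact (g_same_branch L H E S).
  - exfalso; apply (tb_g_dom _ _ _ _ _ L) in E as (u & a & b & E).
    destruct (tle_lt_or_eq a) as [->|a'].
    + rewrite tb_g_refl in E; injection E as E; auto.
    + rewrite (tb_g_comp _ _ _ u _ _ a (tlt_le b)) in H.
      destruct (tb_g s u x) as [w|] eqn:Ew; [|discriminate].
      assert (tb_f u t = w) as <-.
      { symmetry; apply (g_same_branch a' Ew E).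
        rewrite (tb_f_up a' (tlt_le b)); exact S. }
      rewrite tb_g_cone_pt in H by auto; discriminate.
Qed.
End Points.

(** * Strong embeddings as maps of points *)

Section Embeddings.
Context {C : Chain} {A A' : TreeOfBSets C}.

(* Every relation is reflected as well as preserved, so that a morphism can be
   recognised after composing it with an embedding. *)
Record pt_morphism (h : pt A -> pt A') : Prop := {
  pm_inj : Injective h;
  pm_col : forall p, col (nd (h p)) = col (nd p);
  pm_le : forall p q, tle (nd (h p)) (nd (h q)) <-> tle (nd p) (nd q);
  pm_meet : forall p q r, is_meet tle (nd p) (nd q) (nd r) <->
    (is_meet tle (nd (h p)) (nd (h q)) (nd (h r)));
  pm_between : forall p q r, between (h p) (h q) (h r) <-> between p q r;
  pm_cone : forall p q r, tlt (nd p) (nd q) ->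
    (h r = cone_pt (nd (h p)) (nd (h q)) <-> r = cone_pt (nd p) (nd q));
  pm_gmap : forall p q, gmap (h p) (h q) <-> gmap p q;
  pm_dom : forall p q, tle (nd p) (nd q) ->
    (tb_g (nd (h p)) (nd (h q)) (projT2 (h p)) = None <->
     tb_g (nd p) (nd q) (projT2 p) = None)
}.

Lemma pm_nd h p q : pt_morphism h -> nd (h p) = nd (h q) <-> nd p = nd q.
Proof.
  intros H; split; intros E; apply tle_antisym; apply (pm_le H);
    rewrite E; apply tle_refl.
Qed.

Lemma pm_tlt h p q : pt_morphism h -> tlt (nd (h p)) (nd (h q)) <-> tlt (nd p) (nd q).
Proof.
  intros H; unfold tlt; rewrite (pm_le H), (pm_nd p q H); tauto.
Qed.

Section OfEmbedding.
Variable e : StrongEmb A A'.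

Lemma se_node_inj s t : e s = e t -> s = t.
Proof.
  intros E; apply tle_antisym; apply (te_le (se_node_emb e));
    rewrite E; apply tle_refl.
Qed.

Lemma se_tlt s t : tlt (e s) (e t) <-> tlt s t.
Proof.
  unfold tlt; rewrite (te_le (se_node_emb e)).
  split; intros [H N]; split; auto; [intros ->; auto|].
  intros E; apply N, se_node_inj, E.
Qed.

Lemma on_pt_inj : Injective (on_pt e).
Proof.
  intros [s x] [t y] E.
  assert (s = t) as -> by exact (se_node_inj (f_equal nd E)).
  unfold on_pt in E; simpl in E; apply mkpt_inj in E.
  apply (be_inj (se_pt_emb e t)) in E; subst; auto.
Qed.

Lemma on_pt_morphism : pt_morphism (on_pt e).
Proof.
  split.
  - exact on_pt_inj.
  - intros p; apply (te_col (se_node_emb e)).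
  - intros p q; apply (te_le (se_node_emb e)).
  - intros p q r; split; [apply (te_meet (se_node_emb e))|].
    intros (a & b & c); simpl in *.
    split; [|split]; try (apply (te_le (se_node_emb e)); assumption).
    intros z zp zq; apply (te_le (se_node_emb e)), c;
      apply (te_le (se_node_emb e)); auto.
  - intros p q r; split.
    + intros H; destruct (between_nd H) as [E E'].
      apply se_node_inj in E, E'.
      destruct p as [t x], q as [t' y], r as [t'' z]; simpl in *; subst t' t''.
      apply between_mkpt in H; apply between_mkpt.
      apply (be_btw (se_pt_emb e t)); auto.
    + intros (t & x & y & z & -> & -> & -> & H).
      apply between_mkpt, (be_btw (se_pt_emb e t)); auto.
  - intros p q r H.
    assert (E : on_pt e (cone_pt (nd p) (nd q)) =
                cone_pt (nd (on_pt e p)) (nd (on_pt e q))).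
    { unfold cone_pt, on_pt; simpl; rewrite (se_f e H); auto. }
    rewrite <- E; split; [apply on_pt_inj | intros ->; auto].
  - intros [s x] [t y]; unfold gmap; simpl; rewrite (te_le (se_node_emb e)).
    split; intros [H E]; split; auto; rewrite se_g in * by auto.
    + destruct (tb_g s t x) as [z|]; [|discriminate].
      simpl in E; injection E as E; apply (be_inj (se_pt_emb e _)) in E.
      subst; auto.
    + rewrite E; auto.
  - intros [s x] [t y] H; simpl in *; rewrite se_g by auto.
    destruct (tb_g s t x); simpl; split; intros; auto; discriminate.
Qed.
End OfEmbedding.

(** The node map is read off from one chosen point of each nonempty [bset t]; by [pm_nd] the choice
    does not affect it, and all other points over [t] land over the same node. *)
Lemma embedding_of_morphism (h : pt A -> pt A') : pt_morphism h ->
  exists e : StrongEmb A A', forall p, on_pt e p = h p.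
Proof.
  intros H.
  assert (pick : forall t : A, bset t).
  { intros t; apply epsilon; [apply (point_inhabited (bset t))|exact (fun _ => True)]. }
  set (nu := fun t : A => nd (h (mkpt (pick t)))).
  assert (K : forall t (x : bset t), {y : bset (nu t) | h (mkpt x) = mkpt y}).
  { intros t x; apply constructive_indefinite_description.
    apply pt_at_node; apply (pm_nd _ _ H); reflexivity. }
  set (phi := fun t x => proj1_sig (K t x)).
  assert (P : forall t x, h (mkpt x) = mkpt (phi t x)).
  { intros t x; exact (proj2_sig (K t x)). }
  assert (N : forall p, nu (nd p) = nd (h p)).
  { intros p; apply (pm_nd _ _ H); reflexivity. }
  assert (te : is_tree_embedding nu).
  { split.
    - intros t; apply (pm_col H).
    - intros s t; apply (pm_le H).
    - intros x y m; apply (pm_meet H (mkpt (pick x)) (mkpt (pick y)) (mkpt (pick m))). }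
  assert (be : forall t, is_B_embedding (phi t)).
  { intros t; split.
    - intros x y E; apply mkpt_inj, (pm_inj H); rewrite !P, E; auto.
    - intros x y z; rewrite <- !between_mkpt, <- !P; apply (pm_between H). }
  assert (sf : forall t s : A, tlt t s -> phi t (tb_f t s) = tb_f (nu t) (nu s)).
  { intros t s L; apply mkpt_inj; rewrite <- P.
    apply (pm_cone H (p := mkpt (pick t)) (q := mkpt (pick s))); auto. }
  assert (sg : forall (s t : A) (x : bset s), tle s t ->
    tb_g (nu s) (nu t) (phi s x) = option_map (phi t) (tb_g s t x)).
  { intros s t x L; destruct (tb_g s t x) as [y|] eqn:Ey; simpl.
    - assert (Q : gmap (h (mkpt x)) (h (mkpt y))).
      { apply (pm_gmap H); split; auto. }
      rewrite !P in Q; exact (proj2 Q).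
    - assert (Q := pm_dom H (p := mkpt x) (q := mkpt (pick t)) L).
      change (nd (h (mkpt (pick t)))) with (nu t) in Q.
      rewrite P in Q; apply Q; exact Ey. }
  exists (Build_StrongEmb te be sf sg).
  intros [t x]; unfold on_pt; simpl; symmetry; apply P.
Qed.

End Embeddings.

Section EmbeddingOperations.
Context {C : Chain}.

Lemma pt_morphism_comp (A B D : TreeOfBSets C) (f : pt A -> pt B) (g : pt B -> pt D) :
  pt_morphism f -> pt_morphism g -> pt_morphism (fun p => g (f p)).
Proof.
  intros F G; split.
  - intros x y E; apply (pm_inj F), (pm_inj G), E.
  - intros p; rewrite (pm_col G); apply (pm_col F).
  - intros p q; rewrite (pm_le G); apply (pm_le F).
  - intros p q r; rewrite (pm_meet F p q r); apply (pm_meet G).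
  - intros p q r; rewrite (pm_between G); apply (pm_between F).
  - intros p q r H; rewrite <- (pm_cone F r H); apply (pm_cone G), (pm_tlt _ _ F), H.
  - intros p q; rewrite (pm_gmap G); apply (pm_gmap F).
  - intros p q H; rewrite <- (pm_dom F H); apply (pm_dom G), (pm_le F), H.
Qed.

Lemma embedding_comp (A B D : TreeOfBSets C) (f : StrongEmb A B) (g : StrongEmb B D) :
  exists k : StrongEmb A D, forall p, on_pt k p = on_pt g (on_pt f p).
Proof.
  apply (embedding_of_morphism
    (pt_morphism_comp (on_pt_morphism f) (on_pt_morphism g))).
Qed.

Lemma pt_morphism_factor (A B D : TreeOfBSets C) (h : pt A -> pt B) (g : pt B -> pt D) :
  pt_morphism g -> pt_morphism (fun p => g (h p)) -> pt_morphism h.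
Proof.
  intros G F; split.
  - intros x y E; apply (pm_inj F); rewrite E; auto.
  - intros p; rewrite <- (pm_col G); apply (pm_col F).
  - intros p q; rewrite <- (pm_le G); apply (pm_le F).
  - intros p q r; rewrite (pm_meet F p q r), (pm_meet G); tauto.
  - intros p q r; rewrite <- (pm_between G); apply (pm_between F).
  - intros p q r H; rewrite <- (pm_cone F r H); symmetry; apply (pm_cone G).
    rewrite <- (pm_tlt (h p) (h q) G); apply (pm_tlt p q F), H.
  - intros p q; rewrite <- (pm_gmap G); apply (pm_gmap F).
  - intros p q H; rewrite <- (pm_dom F H); symmetry; apply (pm_dom G).
    rewrite <- (pm_le G); apply (pm_le F), H.
Qed.

Lemma embedding_factor (A B D : TreeOfBSets C) (f : StrongEmb A D) (g : StrongEmb B D) :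
  (forall p, exists q, on_pt g q = on_pt f p) ->
  exists k : StrongEmb A B, forall p, on_pt g (on_pt k p) = on_pt f p.
Proof.
  intros H.
  set (h := fun p => proj1_sig (constructive_indefinite_description _ (H p))).
  assert (P : forall p, on_pt g (h p) = on_pt f p).
  { intros p; exact (proj2_sig (constructive_indefinite_description _ (H p))). }
  destruct (@embedding_of_morphism C A B h) as [k K].
  - apply (pt_morphism_factor (on_pt_morphism g)).
    destruct (on_pt_morphism f); split; intros; rewrite ?P; auto.
    intros x y E; rewrite !P in E; auto.
  - exists k; intros p; rewrite K; apply P.
Qed.

Lemma is_iso_on_pt (A B : TreeOfBSets C) (e : StrongEmb A B) :
  (forall q, exists p, on_pt e p = q) <-> is_iso e.
Proof.
  split.
  - intros H; split.
    + assert (S : forall t, {s | e s = t}).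
      { intros t; apply constructive_indefinite_description.
        destruct (point_inhabited (bset t)) as [y].
        destruct (H (mkpt y)) as [p E]; exists (nd p); exact (f_equal nd E). }
      exists (fun t => proj1_sig (S t)); split.
      * intros s; apply (se_node_inj (e := e)); exact (proj2_sig (S (e s))).
      * intros t; exact (proj2_sig (S t)).
    + intros t.
      assert (S : forall y : bset (e t), {x : bset t | se_pt e x = y}).
      { intros y; apply constructive_indefinite_description.
        destruct (H (mkpt y)) as [[s x] E].
        assert (s = t) as -> by exact (se_node_inj (f_equal nd E)).
        exists x; exact (mkpt_inj E). }
      exists (fun y => proj1_sig (S y)); split.
      * intros x; apply (be_inj (se_pt_emb e t)); exact (proj2_sig (S (se_pt e x))).
      * intros y; exact (proj2_sig (S y)).
  - intros [[f [_ Hf]] K] [t y].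
    assert (S : exists s, e s = t) by eauto; destruct S as [s <-].
    destruct (K s) as [g [_ Hg]].
    exists (mkpt (g y)); unfold on_pt; simpl; rewrite Hg; auto.
Qed.

Lemma identity_embedding (A : TreeOfBSets C) :
  exists e : StrongEmb A A, is_iso e /\ forall p, on_pt e p = p.
Proof.
  destruct (@embedding_of_morphism C A A (fun p => p)) as [e E].
  - split; intros; try tauto. intros x y E; exact E.
  - exists e; split; auto; apply is_iso_on_pt; intros q; exists q; auto.
Qed.
End EmbeddingOperations.

(** * Single nodes and joins *)

Section LinearBSet.
Variables (X : Type) (f : X -> nat) (f_inj : Injective f) (x0 : X).

(** One of any three points of a line lies between the others, so positive type holds vacuously. No
    point of a line ramifies, so such a B-set can stand at a node with nothing above it. *)
Definition linear_bset : BSet.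
Proof.
  refine {| point := X;
            btw := fun x y z => f y <= f x <= f z \/ f z <= f x <= f y |}.
  - exact (inhabits x0).
  - intros; lia.
  - intros x y z; split; [intros; apply f_inj; lia | intros ->; lia].
  - intros; lia.
  - intros; lia.
Defined.

Lemma linear_bset_no_ramification (a : linear_bset) : ~ ramification_point a.
Proof.
  intros (y1 & y2 & y3 & n1 & n2 & n3 & h12 & h13 & h23).
  assert (N : forall y, y <> a -> f y < f a \/ f a < f y).
  { intros y n; destruct (Nat.lt_trichotomy (f y) (f a)) as [|[E|]]; auto.
    destruct n; apply f_inj, E. }
  assert (S : forall y z, y <> a -> z <> a ->
    (f y < f a /\ f z < f a) \/ (f a < f y /\ f a < f z) -> same_branch a y z).
  { intros y z ny nz H; repeat split; auto; simpl; lia. }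
  destruct (N _ n1), (N _ n2), (N _ n3); eauto 6.
Qed.
End LinearBSet.

Section SingleNode.
Context {C : Chain} (c : C) (X : BSet) (x0 : X).
Hypothesis X_linear : forall a : X, ~ ramification_point a.

Definition single_node_tree : ColouredTree C.
Proof.
  refine {| node := unit; tle := fun _ _ => True; col := fun _ => c |}.
  - split; [split|split]; hnf; auto.
    + intros [] []; auto.
    + intros _ _; exists tt; auto.
  - intros x y; exists tt; repeat split; auto.
  - intros [] [] _ N; destruct N; auto.
Defined.

Lemma single_node_tlt (s t : single_node_tree) : ~ tlt s t.
Proof. intros [_ N]; destruct s, t; auto. Qed.

(** [x0] is a default value of [tb_f], which has no relevant arguments; its surjectivity onto the
    ramification points is vacuous by [X_linear]. *)
Definition single_node : TreeOfBSets C.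
Proof.
  refine {| tree := single_node_tree; bset := fun _ => X;
            tb_f := fun _ _ => x0; tb_g := fun _ _ x => Some x |}.
  all: try (intros; exfalso; eapply single_node_tlt; eauto; fail).
  - intros t a H; destruct (X_linear H).
  - reflexivity.
  - reflexivity.
Defined.

Lemma single_node_finite : Finite X -> finite_tree_of_B_sets single_node.
Proof.
  intros H; split; [|split; [|split]].
  - exists (tt :: nil); intros []; left; auto.
  - exists tt; intros s; exact I.
  - intros t N; exfalso; apply N; intros [s K]; exact (single_node_tlt K).
  - intros t; exact H.
Qed.

Lemma single_node_over (TC : ColouredTree C) :
  (exists t : TC, col t = c) -> over TC single_node.
Proof.
  intros [t Ht]; exists (fun _ => t); split; auto.
  - intros s s'; simpl; split; auto using tle_refl.
  - intros x y m _; apply is_meet_le, tle_refl.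
Qed.

Definition single_node_embedding (A : TreeOfBSets C) (t : A)
  (Ht : col t = c) (phi : X -> bset t) (Hphi : is_B_embedding phi) :
  StrongEmb single_node A.
Proof.
  refine {| se_node := fun _ : single_node => t; se_pt := fun _ => phi |}.
  - split; auto.
    + intros s s'; simpl; split; auto using tle_refl.
    + intros x y m _; apply is_meet_le, tle_refl.
  - auto.
  - intros s s' H; destruct (single_node_tlt H).
  - intros s s' x H; simpl; apply tb_g_refl.
Defined.
End SingleNode.

(** * The join of two trees of B-sets above a new root *)

Section Join.
Context {C : Chain} {D0 D1 : TreeOfBSets C} {r0 : D0} {r1 : D1}.
Hypothesis r0_root : is_root r0.
Hypothesis r1_root : is_root r1.
Variables (c : C) (x0 : bset r0) (x1 : bset r1).
Hypothesis c_lt0 : clt c (col r0).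
Hypothesis c_lt1 : clt c (col r1).
Hypothesis three0 : exists u v w : bset r0, u <> v /\ u <> w /\ v <> w.
Hypothesis three1 : exists u v w : bset r1, u <> v /\ u <> w /\ v <> w.

Inductive join_node := jroot | jl (s : D0) | jr (s : D1).

Definition join_le (p q : join_node) : Prop :=
  match p, q with
  | jroot, _ => True
  | jl s, jl t => tle s t
  | jr s, jr t => tle s t
  | _, _ => False
  end.

Definition join_col (p : join_node) : C :=
  match p with jroot => c | jl s => col s | jr s => col s end.

Lemma clt_cle_trans (d e f : C) : clt d e -> cle e f -> clt d f.
Proof.
  intros [H N] K; split; [eapply cle_trans; eauto|].
  intros ->; apply N, cle_antisym; auto.
Qed.

Definition join_tree : ColouredTree C.
Proof.
  refine {| node := join_node; tle := join_le; col := join_col |}.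
  - split; [split|split].
    + intros [|s|s]; simpl; auto using tle_refl.
    + intros [|s|s] [|t|t] [|u|u]; simpl; try tauto; apply tle_trans.
    + intros [|s|s] [|t|t]; simpl; try tauto; intros; f_equal;
        apply tle_antisym; auto.
    + intros [|x|x] [|y|y] [|z|z]; simpl; auto; try tauto; apply tle_below_total.
    + intros [|x|x] [|y|y]; exists jroot; simpl; auto.
  - intros [|x|x] [|y|y]; try (exists jroot; split; [|split];
      [simpl; auto; fail | simpl; auto; fail |
       intros [|z|z]; simpl; tauto]; fail).
    + destruct (tle_meet x y) as (m & a & b & d); exists (jl m); repeat split; auto.
      intros [|z|z]; simpl; auto; tauto.
    + destruct (tle_meet x y) as (m & a & b & d); exists (jr m); repeat split; auto.
      intros [|z|z]; simpl; auto; tauto.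
  - intros [|x|x] [|y|y]; simpl; try tauto; intros H N.
    + apply (clt_cle_trans c_lt0), col_le, r0_root.
    + apply (clt_cle_trans c_lt1), col_le, r1_root.
    + apply col_lt; auto; intros ->; auto.
    + apply col_lt; auto; intros ->; auto.
Defined.

(* [inr x1] and [inl x0] are the two centres [e0], [e1] of a double star: the
   branches at [e0] are labelled by B(r0), that of [e1] by [x0], and
   symmetrically; [branch0] sends a point to the label of its branch. *)
Definition branch0 (p : bset r0 + bset r1) : option (bset r0) :=
  match p with
  | inl x => Some x
  | inr y => if excluded_middle_informative (y = x1) then None else Some x0
  end.
Definition branch1 (p : bset r0 + bset r1) : option (bset r1) :=
  match p with
  | inr y => Some y
  | inl x => if excluded_middle_informative (x = x0) then None else Some x1
  end.

Definition join_btw (p q r : bset r0 + bset r1) : Prop :=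
  p = q \/ p = r \/ (p = inr x1 /\ branch0 q <> branch0 r)
  \/ (p = inl x0 /\ branch1 q <> branch1 r).

Ltac branches :=
  unfold branch0, branch1 in *;
  repeat match goal with
  | |- context [excluded_middle_informative ?P] =>
      destruct (excluded_middle_informative P)
  | H : context [excluded_middle_informative ?P] |- _ =>
      destruct (excluded_middle_informative P)
  end.

Definition join_bset : BSet.
Proof.
  refine {| point := (bset r0 + bset r1)%type; btw := join_btw |}.
  - exact (inhabits (inl x0)).
  - unfold join_btw; intros x y z [H|[H|[[H K]|[H K]]]]; subst; auto 7.
  - unfold join_btw; intros x y z; split; [|intros ->; auto].
    intros [H K]; apply NNPP; intros N.
    destruct H as [H|[H|[[H H']|[H H']]]], K as [K|[K|[[K K']|[K K']]]];
      subst; try congruence; destruct z as [z|z]; branches; congruence.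
  - unfold join_btw; intros x y z w [H|[H|[[H K]|[H K]]]]; subst; auto.
    + destruct (classic (branch0 y = branch0 w)) as [E|E].
      * right; do 2 right; left; rewrite <- E; auto.
      * left; do 2 right; left; auto.
    + destruct (classic (branch1 y = branch1 w)) as [E|E].
      * right; do 3 right; rewrite <- E; auto.
      * left; do 3 right; auto.
  - intros x y z Hx Hy Hz.
    assert (Nxy : x <> y) by (intros ->; apply Hx; left; auto).
    assert (Nxz : x <> z) by (intros ->; apply Hx; right; left; auto).
    assert (Nyz : y <> z) by (intros ->; apply Hy; right; left; auto).
    assert (P : forall p q r, p <> q -> p <> r -> ~ join_btw p q r ->
      (p = inr x1 -> branch0 q = branch0 r) /\ (p = inl x0 -> branch1 q = branch1 r)).
    { intros p q r _ _ N; split; intros E; apply NNPP; intros K; apply N;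
        unfold join_btw; tauto. }
    apply P in Hx, Hy, Hz; auto.
    (* Two of the three points lie in one summand. The centre whose branches are labelled by that
       summand separates all three; the exceptional positions are ruled out because no point lies
       between the other two. *)
    assert (Q : (exists e, e = @inr (bset r0) _ x1 /\ branch0 x <> branch0 y
                  /\ branch0 x <> branch0 z /\ branch0 y <> branch0 z) \/
                (exists e, e = @inl _ (bset r1) x0 /\ branch1 x <> branch1 y
                  /\ branch1 x <> branch1 z /\ branch1 y <> branch1 z)).
    { destruct x as [x|x], y as [y|y], z as [z|z];
      solve [ left; eexists; split; [reflexivity|];
        branches; repeat split; intros E; try injection E as E; subst; try discriminate;
        intuition congruence
      | right; eexists; split; [reflexivity|];
        branches; repeat split; intros E; try injection E as E; subst; try discriminate;
        intuition congruence ]. }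
    unfold join_btw.
    destruct Q as [(e & Ee & Q)|(e & Ee & Q)]; exists e; tauto.
Defined.

(** The branches at a centre correspond to the points of [r0] or of [r1], so [three0] and [three1]
    make both centres ramify. Any other point is between others only trivially, hence has a single
    branch. *)
Lemma join_ramification (p : join_bset) :
  ramification_point p <-> p = inr x1 \/ p = inl x0.
Proof.
  split.
  - intros (y1 & y2 & y3 & n1 & n2 & n3 & h & _); apply NNPP; intros N.
    apply h; repeat split; auto; simpl; unfold join_btw.
    intros [H|[H|[[H _]|[H _]]]]; try congruence; tauto.
  - intros [->| ->].
    + destruct three0 as (u & v & w & h1 & h2 & h3).
      exists (inl u), (inl v), (inl w); repeat split; try discriminate;
        intros (_ & _ & K); apply K; do 2 right; left; simpl; split; congruence.
    + destruct three1 as (u & v & w & h1 & h2 & h3).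
      exists (inr u), (inr v), (inr w); repeat split; try discriminate;
        intros (_ & _ & K); apply K; do 3 right; simpl; split; congruence.
Qed.

Definition join_bset_at (n : join_tree) : BSet :=
  match n with jroot => join_bset | jl s => bset s | jr s => bset s end.

(** Off the pairs with [t] strictly below [s] the values are arbitrary: [tb_f t t], or [inr x1] at
    the root. *)
Definition join_f (t s : join_tree) : join_bset_at t :=
  match t return join_bset_at t with
  | jroot => match s with jr _ => inl x0 | _ => inr x1 end
  | jl t => match s with jl s => tb_f t s | _ => tb_f t t end
  | jr t => match s with jr s => tb_f t s | _ => tb_f t t end
  end.

Definition bind (X Y : Type) (o : option X) (f : X -> option Y) : option Y :=
  match o with Some x => f x | None => None end.

(** [branch0] and [branch1] are the maps from the new root to [r0] and [r1]; the composition law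
    forces the rest. *)
Definition join_g (s t : join_tree) : join_bset_at s -> option (join_bset_at t) :=
  match s, t return join_bset_at s -> option (join_bset_at t) with
  | jroot, jroot => fun p => Some p
  | jroot, jl t => fun p => bind (branch0 p) (tb_g r0 t)
  | jroot, jr t => fun p => bind (branch1 p) (tb_g r1 t)
  | jl s, jl t => tb_g s t
  | jr s, jr t => tb_g s t
  | _, _ => fun _ => None
  end.

Arguments join_g : clear implicits.

Lemma join_tlt_l (s t : D0) : @tlt _ join_tree (jl s) (jl t) <-> tlt s t.
Proof. unfold tlt; simpl; intuition congruence. Qed.
Lemma join_tlt_r (s t : D1) : @tlt _ join_tree (jr s) (jr t) <-> tlt s t.
Proof. unfold tlt; simpl; intuition congruence. Qed.

Lemma join_tlt_cases (s t : join_tree) : tlt s t ->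
  (exists u, s = jroot /\ t = jl u) \/ (exists u, s = jroot /\ t = jr u) \/
  (exists u v, s = jl u /\ t = jl v /\ tlt u v) \/
  (exists u v, s = jr u /\ t = jr v /\ tlt u v).
Proof.
  intros [H N]; destruct s as [|s|s], t as [|t|t]; simpl in *; try tauto.
  - left; eauto.
  - right; left; eauto.
  - do 2 right; left; exists s, t; repeat split; auto; intros ->; auto.
  - do 3 right; exists s, t; repeat split; auto; intros ->; auto.
Qed.

Lemma join_tlt_root_l (t : D0) : @tlt _ join_tree jroot (jl t).
Proof. split; simpl; auto; discriminate. Qed.
Lemma join_tlt_root_r (t : D1) : @tlt _ join_tree jroot (jr t).
Proof. split; simpl; auto; discriminate. Qed.

Lemma join_same_cone_l (s t u : D0) :
  @same_cone _ join_tree (jl s) (jl t) (jl u) <-> same_cone s t u.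
Proof.
  split.
  - intros ([|z|z] & a & b & d); try (destruct a as [[] _]; fail).
    exists z; rewrite <- join_tlt_l; auto.
  - intros (z & a & b & d); exists (jl z); rewrite join_tlt_l; auto.
Qed.
Lemma join_same_cone_r (s t u : D1) :
  @same_cone _ join_tree (jr s) (jr t) (jr u) <-> same_cone s t u.
Proof.
  split.
  - intros ([|z|z] & a & b & d); try (destruct a as [[] _]; fail).
    exists z; rewrite <- join_tlt_r; auto.
  - intros (z & a & b & d); exists (jr z); rewrite join_tlt_r; auto.
Qed.

Lemma join_f_ram (t s : join_tree) : tlt t s -> ramification_point (join_f t s).
Proof.
  intros H; destruct (join_tlt_cases H)
    as [(u & -> & ->)|[(u & -> & ->)|[(u & v & -> & -> & K)|(u & v & -> & -> & K)]]];
    simpl; try (apply join_ramification; auto; fail); apply tb_f_ram, K.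
Qed.

Lemma join_f_surj (t : join_tree) (a : join_bset_at t) : ramification_point a ->
  exists s, tlt t s /\ join_f t s = a.
Proof.
  destruct t as [|t|t]; simpl; intros H.
  - apply join_ramification in H as [-> | ->].
    + exists (jl r0); split; auto using join_tlt_root_l.
    + exists (jr r1); split; auto using join_tlt_root_r.
  - apply tb_f_surj in H as (s & H & E); exists (jl s); rewrite join_tlt_l; auto.
  - apply tb_f_surj in H as (s & H & E); exists (jr s); rewrite join_tlt_r; auto.
Qed.

Lemma join_f_cone (t s1 s2 : join_tree) : tlt t s1 -> tlt t s2 ->
  (join_f t s1 = join_f t s2 <-> same_cone t s1 s2).
Proof.
  intros H1 H2.
  destruct (join_tlt_cases H1)
    as [(u & -> & ->)|[(u & -> & ->)|[(u & v & -> & -> & K)|(u & v & -> & -> & K)]]];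
  destruct (join_tlt_cases H2)
    as [(u' & E & E')|[(u' & E & E')|[(u' & v' & E & E' & K')|(u' & v' & E & E' & K')]]];
    try discriminate; subst; simpl; try (injection E as ->).
  - split; auto; intros _; exists (jl r0); simpl; auto using join_tlt_root_l.
  - split; [discriminate|]. intros ([|z|z] & a & b & d); simpl in *; try tauto.
    destruct (tlt_irrefl a).
  - split; [discriminate|]. intros ([|z|z] & a & b & d); simpl in *; try tauto.
    destruct (tlt_irrefl a).
  - split; auto; intros _; exists (jr r1); simpl; auto using join_tlt_root_r.
  - rewrite join_same_cone_l; apply tb_f_cone; auto.
  - rewrite join_same_cone_r; apply tb_f_cone; auto.
Qed.

Lemma join_g_refl (s : join_tree) (x : join_bset_at s) : join_g s s x = Some x.
Proof. destruct s; simpl; auto using tb_g_refl. Qed.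

(** This and [g_eq_or_eq] admit [s = t], since a map from the new root may end at [r0] or [r1]
    itself. *)
Lemma g_none_or_eq {D : TreeOfBSets C} (s t : D) (x : bset s) :
  tle s t -> (tb_g s t x = None <->
   exists u, tle s u /\ tlt u t /\ tb_g s u x = Some (tb_f u t)).
Proof.
  intros H; destruct (tle_lt_or_eq H) as [->|K]; [|apply tb_g_dom, K].
  rewrite tb_g_refl; split; [discriminate|].
  intros (u & a & b & _); destruct (tlt_not_le b a).
Qed.

Lemma g_eq_or_eq {D : TreeOfBSets C} (s t : D) (x y : bset s) (x' y' : bset t) :
  tle s t -> tb_g s t x = Some x' -> tb_g s t y = Some y' ->
  (x' = y' <-> x = y \/
     exists u (a b : bset u), tle s u /\ tlt u t /\
       tb_g s u x = Some a /\ tb_g s u y = Some b /\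
       same_branch (tb_f u t) a b).
Proof.
  intros H E E'; destruct (tle_lt_or_eq H) as [->|K].
  - rewrite tb_g_refl in E, E'; injection E as ->; injection E' as ->.
    split; auto; intros [|(u & _ & _ & a & b & _)]; auto; destruct (tlt_not_le b a).
  - rewrite (tb_g_eq _ _ _ _ _ _ _ _ K E E'); split; auto.
    intros [->|]; auto; apply (tb_g_eq _ _ _ _ _ _ _ _ K E E'); congruence.
Qed.

Lemma join_g_dom (s t : join_tree) (x : join_bset_at s) : tlt s t ->
  (join_g s t x = None <->
   exists u, tle s u /\ tlt u t /\ join_g s u x = Some (join_f u t)).
Proof.
  intros H; destruct (join_tlt_cases H)
    as [(u & -> & ->)|[(u & -> & ->)|[(u & v & -> & -> & K)|(u & v & -> & -> & K)]]].
  - simpl; split.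
    + destruct (branch0 x) as [y|] eqn:Ey; simpl; intros E.
      * apply g_none_or_eq in E as (w & a & b & E); auto.
        exists (jl w); rewrite join_tlt_l; simpl; rewrite Ey; auto.
      * exists jroot; repeat split; auto; [discriminate|].
        destruct x as [x|x]; branches; simpl; try discriminate; subst; auto.
    + intros ([|w|w] & _ & a & E); simpl in E.
      * injection E as ->; branches; simpl; auto; congruence.
      * apply join_tlt_l in a. destruct (branch0 x) as [y|]; [simpl in *|discriminate].
        apply g_none_or_eq; auto; exists w; auto.
      * destruct a as [[] _].
  - simpl; split.
    + destruct (branch1 x) as [y|] eqn:Ey; simpl; intros E.
      * apply g_none_or_eq in E as (w & a & b & E); auto.
        exists (jr w); rewrite join_tlt_r; simpl; rewrite Ey; auto.
      * exists jroot; repeat split; auto; [discriminate|].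
        destruct x as [x|x]; branches; simpl; try discriminate; subst; auto.
    + intros ([|w|w] & _ & a & E); simpl in E.
      * injection E as ->; branches; simpl; auto; congruence.
      * destruct a as [[] _].
      * apply join_tlt_r in a. destruct (branch1 x) as [y|]; [simpl in *|discriminate].
        apply g_none_or_eq; auto; exists w; auto.
  - simpl in *; rewrite tb_g_dom by auto; split.
    + intros (w & a & b & E); exists (jl w); rewrite join_tlt_l; auto.
    + intros ([|w|w] & a & b & E); simpl in a; try tauto.
      exists w; rewrite <- join_tlt_l; auto.
  - simpl in *; rewrite tb_g_dom by auto; split.
    + intros (w & a & b & E); exists (jr w); rewrite join_tlt_r; auto.
    + intros ([|w|w] & a & b & E); simpl in a; try tauto.
      exists w; rewrite <- join_tlt_r; auto.
Qed.

Lemma g_surj {D : TreeOfBSets C} (s t : D) (y : bset t) : tle s t ->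
  exists x : bset s, tb_g s t x = Some y.
Proof.
  intros H; destruct (tle_lt_or_eq H) as [->|K]; [|apply tb_g_surj, K].
  exists y; apply tb_g_refl.
Qed.

Lemma join_g_surj (s t : join_tree) (y : join_bset_at t) : tlt s t ->
  exists x : join_bset_at s, join_g s t x = Some y.
Proof.
  intros H; destruct (join_tlt_cases H)
    as [(u & -> & ->)|[(u & -> & ->)|[(u & v & -> & -> & K)|(u & v & -> & -> & K)]]];
    simpl in *.
  - destruct (g_surj y (r0_root u)) as [x E]; exists (inl x); exact E.
  - destruct (g_surj y (r1_root u)) as [x E]; exists (inr x); exact E.
  - apply tb_g_surj; auto.
  - apply tb_g_surj; auto.
Qed.

Lemma join_same_branch0 (p q : join_bset) : branch0 p <> None -> branch0 q <> None ->
  (same_branch (inr x1 : join_bset) p q <-> branch0 p = branch0 q).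
Proof.
  intros Hp Hq.
  assert (N : forall p, branch0 p <> None -> p <> inr x1).
  { intros r H ->; apply H; branches; congruence. }
  split.
  - intros (a & b & K); apply NNPP; intros E; apply K; do 2 right; left; auto.
  - intros E; repeat split; auto; simpl.
    intros [K|[K|[[_ K]|[K _]]]]; auto; try discriminate;
      solve [apply (N p); auto | apply (N q); auto].
Qed.
Lemma join_same_branch1 (p q : join_bset) : branch1 p <> None -> branch1 q <> None ->
  (same_branch (inl x0 : join_bset) p q <-> branch1 p = branch1 q).
Proof.
  intros Hp Hq.
  assert (N : forall p, branch1 p <> None -> p <> inl x0).
  { intros r H ->; apply H; branches; congruence. }
  split.
  - intros (a & b & K); apply NNPP; intros E; apply K; do 3 right; auto.
  - intros E; repeat split; auto; simpl.
    intros [K|[K|[[K _]|[_ K]]]]; auto; try discriminate;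
      solve [apply (N p); auto | apply (N q); auto].
Qed.

(** Points of the new root become equal above it either because they carry the same label, with
    witness [jroot], or because their labels are identified inside [D0] or [D1]. *)
Lemma join_g_eq (s t : join_tree) (x y : join_bset_at s) (x' y' : join_bset_at t) :
  tlt s t -> join_g s t x = Some x' -> join_g s t y = Some y' ->
  (x' = y' <->
   exists u (a b : join_bset_at u), tle s u /\ tlt u t /\
     join_g s u x = Some a /\ join_g s u y = Some b /\
     same_branch (join_f u t) a b).
Proof.
  intros H; destruct (join_tlt_cases H)
    as [(u & -> & ->)|[(u & -> & ->)|[(u & v & -> & -> & K)|(u & v & -> & -> & K)]]];
    simpl in *; intros Ex Ey.
  - destruct (branch0 x) as [a|] eqn:Ea; [|discriminate].
    destruct (branch0 y) as [b|] eqn:Eb; [|discriminate]; simpl in *.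
    rewrite (g_eq_or_eq (r0_root u) Ex Ey); split.
    + intros [->|(w & a' & b' & h1 & h2 & h3 & h4 & h5)].
      * exists jroot, x, y; do 4 (split; [first [exact I | apply join_tlt_root_l | reflexivity]|]).
        apply join_same_branch0; congruence.
      * exists (jl w), a', b'; rewrite join_tlt_l; simpl; rewrite Ea, Eb; auto 6.
    + intros ([|w|w] & a' & b' & h1 & h2 & h3 & h4 & h5); simpl in *.
      * injection h3 as <-; injection h4 as <-; left.
        apply join_same_branch0 in h5; congruence.
      * right; exists w, a', b'; rewrite join_tlt_l in h2; rewrite Ea in h3.
        rewrite Eb in h4; auto 6.
      * destruct h2 as [[] _].
  - destruct (branch1 x) as [a|] eqn:Ea; [|discriminate].
    destruct (branch1 y) as [b|] eqn:Eb; [|discriminate]; simpl in *.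
    rewrite (g_eq_or_eq (r1_root u) Ex Ey); split.
    + intros [->|(w & a' & b' & h1 & h2 & h3 & h4 & h5)].
      * exists jroot, x, y; do 4 (split; [first [exact I | apply join_tlt_root_r | reflexivity]|]).
        apply join_same_branch1; congruence.
      * exists (jr w), a', b'; rewrite join_tlt_r; simpl; rewrite Ea, Eb; auto 6.
    + intros ([|w|w] & a' & b' & h1 & h2 & h3 & h4 & h5); simpl in *.
      * injection h3 as <-; injection h4 as <-; left.
        apply join_same_branch1 in h5; congruence.
      * destruct h2 as [[] _].
      * right; exists w, a', b'; rewrite join_tlt_r in h2; rewrite Ea in h3.
        rewrite Eb in h4; auto 6.
  - rewrite (tb_g_eq _ _ _ _ _ _ _ _ K Ex Ey); split.
    + intros (w & a & b & h); exists (jl w), a, b; rewrite join_tlt_l; exact h.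
    + intros ([|w|w] & a & b & h); simpl in h; try tauto.
      exists w, a, b; rewrite join_tlt_l in h; exact h.
  - rewrite (tb_g_eq _ _ _ _ _ _ _ _ K Ex Ey); split.
    + intros (w & a & b & h); exists (jr w), a, b; rewrite join_tlt_r; exact h.
    + intros ([|w|w] & a & b & h); simpl in h; try tauto.
      exists w, a, b; rewrite join_tlt_r in h; exact h.
Qed.

Lemma join_g_comp (s t u : join_tree) (x : join_bset_at s) : tle s t -> tle t u ->
  join_g s u x = match join_g s t x with Some y => join_g t u y | None => None end.
Proof.
  destruct s as [|s|s], t as [|t|t], u as [|u|u]; simpl; try tauto; intros H K.
  - destruct (branch0 x); simpl; auto; apply tb_g_comp; auto.
  - destruct (branch1 x); simpl; auto; apply tb_g_comp; auto.
  - apply tb_g_comp; auto.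
  - apply tb_g_comp; auto.
Qed.

Definition join : TreeOfBSets C :=
  Build_TreeOfBSets C join_tree join_bset_at join_f join_g join_f_ram join_f_surj
    join_f_cone join_g_refl join_g_dom
    join_g_surj join_g_eq join_g_comp.

Lemma join_finite : finite_tree_of_B_sets D0 -> finite_tree_of_B_sets D1 ->
  finite_tree_of_B_sets join.
Proof.
  intros ([l0 L0] & _ & R0 & B0) ([l1 L1] & _ & R1 & B1).
  split; [|split; [|split]].
  - exists (jroot :: map jl l0 ++ map jr l1); intros [|s|s].
    + left; auto.
    + right; apply in_or_app; left; apply in_map, L0.
    + right; apply in_or_app; right; apply in_map, L1.
  - exists jroot; intros s; exact I.
  - intros [|t|t] N.
    + exists (jl r0), (jr r1); split; [|split];
        auto using join_tlt_root_l, join_tlt_root_r.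
      intros ([|z|z] & a & b & d); simpl in *; try tauto.
      destruct (tlt_irrefl a).
    + destruct (R0 t) as (x & y & a & b & d).
      { intros M; apply N; intros ([|s|s] & H); [destruct H as [[] _]| |destruct H as [[] _]].
        apply M; exists s; apply join_tlt_l, H. }
      exists (jl x), (jl y); rewrite join_same_cone_l, !join_tlt_l; auto.
    + destruct (R1 t) as (x & y & a & b & d).
      { intros M; apply N; intros ([|s|s] & H); [destruct H as [[] _]|destruct H as [[] _]|].
        apply M; exists s; apply join_tlt_r, H. }
      exists (jr x), (jr y); rewrite join_same_cone_r, !join_tlt_r; auto.
  - intros [|t|t]; simpl; [|apply B0|apply B1].
    destruct (B0 r0) as [k0 K0], (B1 r1) as [k1 K1].
    exists (map inl k0 ++ map inr k1); intros [x|x]; apply in_or_app;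
      [left|right]; apply in_map; auto.
Qed.

(** * Embedding a join in a given tree of B-sets *)

Section JoinEmbedding.
Context {A : TreeOfBSets C} (q : A).
Variables (j0 : StrongEmb D0 A) (j1 : StrongEmb D1 A).
Variables (y0 : bset r0 -> bset q) (y1 : bset r1 -> bset q).
Hypothesis q_col : col q = c.
Hypothesis q_lt0 : tlt q (j0 r0).
Hypothesis q_lt1 : tlt q (j1 r1).
Hypothesis y0_g : forall x, tb_g q (j0 r0) (y0 x) = Some (se_pt j0 x).
Hypothesis y1_g : forall x, tb_g q (j1 r1) (y1 x) = Some (se_pt j1 x).
Hypothesis y0_f : y0 x0 = tb_f q (j1 r1).
Hypothesis y1_f : y1 x1 = tb_f q (j0 r0).

Let node_map (n : join) : A :=
  match n with jroot => q | jl s => j0 s | jr s => j1 s end.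

Let pt_map (n : join) : bset n -> bset (node_map n) :=
  match n as m return @bset C join m -> @bset C A (node_map m) with
  | jroot => fun p => match p with inl x => y0 x | inr y => y1 y end
  | jl s => fun x => se_pt j0 x
  | jr s => fun x => se_pt j1 x
  end.

Let e0_none : tb_g q (j0 r0) (tb_f q (j0 r0)) = None.
Proof. apply tb_g_cone_pt; auto. Qed.
Let e1_none : tb_g q (j1 r1) (tb_f q (j1 r1)) = None.
Proof. apply tb_g_cone_pt; auto. Qed.

Let centres_distinct : tb_f q (j0 r0) <> tb_f q (j1 r1).
(* The first centre is [y1 x1], so it survives at [j1 r1], where the second one is deleted. *)
Proof. intros E; assert (H := y1_g x1); rewrite y1_f, E, e1_none in H; discriminate. Qed.

(** [y1 y] and the first centre [y1 x1] have distinct images at [j1 r1], so the second centre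
    separates them; hence at the first centre [y1 y] lies in the branch of the second, whose image
    at [j0 r0] is that of [x0]. *)
Let other_branch0 y : y <> x1 -> ~ btw (tb_f q (j0 r0)) (y1 y) (tb_f q (j1 r1))
  /\ tb_g q (j0 r0) (y1 y) = Some (se_pt j0 x0).
Proof.
  intros N.
  assert (S : btw (tb_f q (j1 r1)) (y1 y) (tb_f q (j0 r0))).
  { rewrite <- y1_f; apply (g_distinct_btw q_lt1 (y1_g y) (y1_g x1)).
    intros E; apply (be_inj (se_pt_emb j1 _)) in E; auto. }
  assert (S' : ~ btw (tb_f q (j0 r0)) (y1 y) (tb_f q (j1 r1))).
  { intros K; apply centres_distinct.
    apply (btw_antisym (z := y1 y)); apply btw_B1; auto. }
  split; auto.
  apply (g_follow q_lt0 (y0_g x0)).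
  - rewrite <- y1_f; intros E; assert (L := y1_g y); rewrite E, y1_g in L.
    injection L as L; apply (be_inj (se_pt_emb j1 _)) in L; auto.
  - rewrite y0_f; intros K; apply S', btw_B1, K.
Qed.
Let other_branch1 x : x <> x0 -> ~ btw (tb_f q (j1 r1)) (y0 x) (tb_f q (j0 r0))
  /\ tb_g q (j1 r1) (y0 x) = Some (se_pt j1 x1).
Proof.
  intros N.
  assert (S : btw (tb_f q (j0 r0)) (y0 x) (tb_f q (j1 r1))).
  { rewrite <- y0_f; apply (g_distinct_btw q_lt0 (y0_g x) (y0_g x0)).
    intros E; apply (be_inj (se_pt_emb j0 _)) in E; auto. }
  assert (S' : ~ btw (tb_f q (j1 r1)) (y0 x) (tb_f q (j0 r0))).
  { intros K; apply centres_distinct.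
    apply (btw_antisym (z := y0 x)); apply btw_B1; auto. }
  split; auto.
  apply (g_follow q_lt1 (y1_g x1)).
  - rewrite <- y0_f; intros E; assert (L := y0_g x); rewrite E, y0_g in L.
    injection L as L; apply (be_inj (se_pt_emb j0 _)) in L; auto.
  - rewrite y1_f; intros K; apply S', btw_B1, K.
Qed.

Let g_root0 p : tb_g q (j0 r0) (pt_map (n := jroot) p)
  = option_map (@se_pt _ _ _ j0 r0) (branch0 p).
Proof.
  destruct p as [x|y]; simpl; auto; branches; simpl.
  - subst; rewrite y1_f; auto.
  - apply other_branch0; auto.
Qed.
Let g_root1 p : tb_g q (j1 r1) (pt_map (n := jroot) p)
  = option_map (@se_pt _ _ _ j1 r1) (branch1 p).
Proof.
  destruct p as [x|y]; simpl; auto; branches; simpl.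
  - subst; rewrite y0_f; auto.
  - apply other_branch1; auto.
Qed.

(** Different labels mean different images at [j0 r0], hence separation by [g_distinct_btw]. Points
    labelled [x0] all lie in the branch of the other centre, and every other label occurs once. *)
Let root_btw0 p p' : branch0 p <> None -> branch0 p' <> None ->
  (btw (tb_f q (j0 r0)) (pt_map (n := jroot) p) (pt_map (n := jroot) p')
   <-> branch0 p <> branch0 p').
Proof.
  intros Hp Hp'.
  destruct (branch0 p) as [a|] eqn:Ea; [|tauto].
  destruct (branch0 p') as [b|] eqn:Eb; [|tauto].
  assert (Ga := g_root0 p); assert (Gb := g_root0 p').
  rewrite Ea in Ga; rewrite Eb in Gb; simpl in Ga, Gb.
  split.
  - intros K E; injection E as <-; revert K.
    assert (T : forall p, branch0 p = Some x0 ->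
      ~ btw (tb_f q (j0 r0)) (pt_map (n := jroot) p) (tb_f q (j1 r1))).
    { intros [x|y] E; simpl in *.
      - injection E as ->; rewrite y0_f; intros K; apply btw_same in K; auto.
      - branches; [discriminate|apply other_branch0; auto]. }
    destruct (classic (a = x0)) as [->|N].
    + intros K; destruct (btw_B3 (tb_f q (j1 r1)) K) as [L|L];
      [exact (T p Ea L) | exact (T p' Eb (btw_B1 L))].
    + destruct p as [x|y], p' as [x'|y']; simpl in *; branches; try congruence.
      injection Ea as ->; injection Eb as ->; intros K; apply btw_same in K.
      rewrite <- K in Ga; congruence.
  - intros N; apply (g_distinct_btw q_lt0 Ga Gb).
    intros E; apply (be_inj (se_pt_emb j0 _)) in E; congruence.
Qed.
Let root_btw1 p p' : branch1 p <> None -> branch1 p' <> None ->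
  (btw (tb_f q (j1 r1)) (pt_map (n := jroot) p) (pt_map (n := jroot) p')
   <-> branch1 p <> branch1 p').
Proof.
  intros Hp Hp'.
  destruct (branch1 p) as [a|] eqn:Ea; [|tauto].
  destruct (branch1 p') as [b|] eqn:Eb; [|tauto].
  assert (Ga := g_root1 p); assert (Gb := g_root1 p').
  rewrite Ea in Ga; rewrite Eb in Gb; simpl in Ga, Gb.
  split.
  - intros K E; injection E as <-; revert K.
    assert (T : forall p, branch1 p = Some x1 ->
      ~ btw (tb_f q (j1 r1)) (pt_map (n := jroot) p) (tb_f q (j0 r0))).
    { intros [x|y] E; simpl in *.
      - branches; [discriminate|apply other_branch1; auto].
      - injection E as ->; rewrite y1_f; intros K; apply btw_same in K; auto. }
    destruct (classic (a = x1)) as [->|N].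
    + intros K; destruct (btw_B3 (tb_f q (j0 r0)) K) as [L|L];
      [exact (T p Ea L) | exact (T p' Eb (btw_B1 L))].
    + destruct p as [x|y], p' as [x'|y']; simpl in *; branches; try congruence.
      injection Ea as ->; injection Eb as ->; intros K; apply btw_same in K.
      rewrite <- K in Ga; congruence.
  - intros N; apply (g_distinct_btw q_lt1 Ga Gb).
    intros E; apply (be_inj (se_pt_emb j1 _)) in E; congruence.
Qed.

Let root_inj : Injective (pt_map (n := jroot)).
Proof.
  intros p p' E.
  assert (E0 := g_root0 p); assert (E1 := g_root1 p); rewrite E in E0, E1.
  rewrite g_root0 in E0; rewrite g_root1 in E1.
  destruct p as [x|x], p' as [y|y]; branches; simpl in *; subst; auto;
  try discriminate;
  repeat match goal with H : Some _ = Some _ |- _ => injection H as H end;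
  try apply (be_inj (se_pt_emb j0 _)) in E0;
  try apply (be_inj (se_pt_emb j1 _)) in E1; congruence.
Qed.

Let root_emb : is_B_embedding (pt_map (n := jroot)).
Proof.
  split; [exact root_inj|].
  assert (c0 : pt_map (n := jroot) (inr x1) = tb_f q (j0 r0)) by exact y1_f.
  assert (c1 : pt_map (n := jroot) (inl x0) = tb_f q (j1 r1)) by exact y0_f.
  assert (n0 : forall p, p <> inr x1 -> branch0 p <> None).
  { intros [x|x] N; branches; congruence. }
  assert (n1 : forall p, p <> inl x0 -> branch1 p <> None).
  { intros [x|x] N; branches; congruence. }
  assert (alone : forall p r, p <> r -> p <> inr x1 -> p <> inl x0 ->
    (exists x, p = inl x) -> r <> inr x1 -> branch0 p <> branch0 r).
  { intros p r N N0 N1 [x ->] Nr; destruct r as [z|z]; branches; congruence. }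
  assert (alone' : forall p r, p <> r -> p <> inr x1 -> p <> inl x0 ->
    (exists x, p = inr x) -> r <> inl x0 -> branch1 p <> branch1 r).
  { intros p r N N0 N1 [x ->] Nr; destruct r as [z|z]; branches; congruence. }
  intros p r s.
  change (@btw (@bset C join jroot) p r s) with (join_btw p r s); unfold join_btw.
  destruct (classic (p = r)) as [->|Nr]; [split; auto using btw_refl|].
  destruct (classic (p = s)) as [->|Ns]; [split; auto using btw_refl_r|].
  destruct (classic (p = inr x1)) as [->|N0].
  { rewrite c0; assert (Q := root_btw0 (n0 r (not_eq_sym Nr)) (n0 s (not_eq_sym Ns))).
    split; [intros K; apply Q in K; auto|].
    intros [K|[K|[[_ K]|[K _]]]]; try congruence; apply Q, K. }
  destruct (classic (p = inl x0)) as [->|N1].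
  { rewrite c1; assert (Q := root_btw1 (n1 r (not_eq_sym Nr)) (n1 s (not_eq_sym Ns))).
    split; [intros K; apply Q in K; auto|].
    intros [K|[K|[[K _]|[_ K]]]]; try congruence; apply Q, K. }
  split; [|tauto].
  (* A point [p] that is not a centre lies between no two others. The centre with branches labelled
     by the summand of [p] separates [p] from each other point, so [p] is not between it and another
     point; [btw_B3] reduces to this case. *)
  intros K; exfalso.
  assert (L : forall r, p <> r -> (exists x, p = inl x) ->
    ~ btw (pt_map (n := jroot) p) (pt_map (n := jroot) r) (tb_f q (j0 r0))).
  { intros t N Hp L; destruct (classic (t = inr x1)) as [->|Nt].
    - rewrite c0 in L; apply btw_same in L; rewrite <- c0 in L.
      apply root_inj in L; auto.
    - assert (Q : btw (tb_f q (j0 r0)) (pt_map (n := jroot) p) (pt_map (n := jroot) t)).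
      { apply root_btw0; auto. }
      apply btw_B1 in L; apply btw_B1 in Q.
      assert (W := btw_antisym L (btw_B1 Q)); rewrite <- c0 in W.
      apply root_inj in W; auto. }
  assert (L' : forall r, p <> r -> (exists x, p = inr x) ->
    ~ btw (pt_map (n := jroot) p) (pt_map (n := jroot) r) (tb_f q (j1 r1))).
  { intros t N Hp L0; destruct (classic (t = inl x0)) as [->|Nt].
    - rewrite c1 in L0; apply btw_same in L0; rewrite <- c1 in L0.
      apply root_inj in L0; auto.
    - assert (Q : btw (tb_f q (j1 r1)) (pt_map (n := jroot) p) (pt_map (n := jroot) t)).
      { apply root_btw1; auto. }
      apply btw_B1 in L0; apply btw_B1 in Q.
      assert (W := btw_antisym L0 (btw_B1 Q)); rewrite <- c1 in W.
      apply root_inj in W; auto. }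
  destruct p as [x|x].
  - destruct (btw_B3 (tb_f q (j0 r0)) K) as [H|H].
    + exact (L r Nr (ex_intro _ x eq_refl) H).
    + exact (L s Ns (ex_intro _ x eq_refl) (btw_B1 H)).
  - destruct (btw_B3 (tb_f q (j1 r1)) K) as [H|H].
    + exact (L' r Nr (ex_intro _ x eq_refl) H).
    + exact (L' s Ns (ex_intro _ x eq_refl) (btw_B1 H)).
Qed.

Let node_map_le s t : tle (node_map s) (node_map t) <-> tle s t.
Proof.
  assert (up0 : forall s, tle (j0 r0) (j0 s)).
  { intros u; apply (te_le (se_node_emb j0)), r0_root. }
  assert (up1 : forall s, tle (j1 r1) (j1 s)).
  { intros u; apply (te_le (se_node_emb j1)), r1_root. }
  assert (down0 : forall s, ~ tle (j0 s) q).
  { intros u H; apply (tlt_not_le (tlt_le_trans q_lt0 (up0 u)) H). }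
  assert (down1 : forall s, ~ tle (j1 s) q).
  { intros u H; apply (tlt_not_le (tlt_le_trans q_lt1 (up1 u)) H). }
  (* A common upper bound would put both roots in one cone at [q] and make the centres equal. *)
  assert (apart : forall s t z, tle (j0 s) z -> tle (j1 t) z -> False).
  { intros u v z H K; apply centres_distinct.
    rewrite (tb_f_up q_lt0 (tle_trans (up0 u) H)).
    rewrite (tb_f_up q_lt1 (tle_trans (up1 v) K)); auto. }
  destruct s as [|s|s], t as [|t|t]; simpl.
  - split; auto using tle_refl.
  - split; auto; intros _; exact (tle_trans (tlt_le q_lt0) (up0 t)).
  - split; auto; intros _; exact (tle_trans (tlt_le q_lt1) (up1 t)).
  - split; [|tauto]; apply down0.
  - apply (te_le (se_node_emb j0)).
  - split; [|tauto]; intros H; eapply apart; eauto using tle_refl.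
  - split; [|tauto]; apply down1.
  - split; [|tauto]; intros H; eapply apart; eauto using tle_refl.
  - apply (te_le (se_node_emb j1)).
Qed.

(** The sections [y0] and [y1] pick one point in each branch at the two cone points of [q]; [y0_f]
    and [y1_f] make each cone point a member of the other section, which reproduces the double star
    in [bset q]. *)
Lemma join_embedding : exists k : StrongEmb join A,
  (forall s (x : bset s), on_pt k (mkpt (A := join) (t := jl s) x) = on_pt j0 (mkpt x)) /\
  (forall s (x : bset s), on_pt k (mkpt (A := join) (t := jr s) x) = on_pt j1 (mkpt x)) /\
  (forall x, on_pt k (mkpt (A := join) (t := jroot) (inl x)) = mkpt (y0 x)) /\
  (forall x, on_pt k (mkpt (A := join) (t := jroot) (inr x)) = mkpt (y1 x)).
Proof.
  assert (lt0 : forall s, tlt q (j0 s)).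
  { intros s; apply (tlt_le_trans q_lt0), (te_le (se_node_emb j0)), r0_root. }
  assert (lt1 : forall s, tlt q (j1 s)).
  { intros s; apply (tlt_le_trans q_lt1), (te_le (se_node_emb j1)), r1_root. }
  assert (f0 : forall s, tb_f q (j0 s) = tb_f q (j0 r0)).
  { intros s; symmetry; apply (tb_f_up q_lt0), (te_le (se_node_emb j0)), r0_root. }
  assert (f1 : forall s, tb_f q (j1 s) = tb_f q (j1 r1)).
  { intros s; symmetry; apply (tb_f_up q_lt1), (te_le (se_node_emb j1)), r1_root. }
  assert (te : is_tree_embedding node_map).
  { split.
    - intros [|s|s]; simpl; auto; apply te_col, se_node_emb.
    - exact node_map_le.
    - assert (S : forall s t, is_meet tle (j0 s) (j1 t) q).
      { intros s t; apply not_same_cone_meet; auto.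
        rewrite <- tb_f_cone, f0, f1 by auto; exact centres_distinct. }
      intros [|x|x] [|y|y] m H; try
        (assert (m = jroot) as -> by (destruct H as (a & b & _); destruct m; simpl in a, b; tauto)).
      all: simpl; auto using is_meet_le, is_meet_sym, tle_refl, tlt_le.
      + destruct m as [|m|m]; [| |destruct H as [[] _]].
        * destruct H as (_ & _ & H); destruct (H (jl r0)); apply r0_root.
        * apply (te_meet (se_node_emb j0)); destruct H as (a & b & d).
          repeat split; auto; intros z; exact (d (jl z)).
      + destruct m as [|m|m]; [|destruct H as [[] _]|].
        * destruct H as (_ & _ & H); destruct (H (jr r1)); apply r1_root.
        * apply (te_meet (se_node_emb j1)); destruct H as (a & b & d).
          repeat split; auto; intros z; exact (d (jr z)). }
  assert (be : forall t : join, is_B_embedding (pt_map (n := t))).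
  { intros [|s|s]; [exact root_emb|apply (se_pt_emb j0)|apply (se_pt_emb j1)]. }
  assert (sf : forall t s : join, tlt t s ->
    pt_map (tb_f t s) = tb_f (node_map t) (node_map s)).
  { intros t s H; destruct (join_tlt_cases H)
    as [(u & -> & ->)|[(u & -> & ->)|[(u & v & -> & -> & K)|(u & v & -> & -> & K)]]].
    - simpl; rewrite f0; auto.
    - simpl; rewrite f1; auto.
    - exact (se_f j0 K).
    - exact (se_f j1 K). }
  assert (sg : forall (s t : join) (x : bset s), tle s t ->
    tb_g (node_map s) (node_map t) (pt_map x) = option_map (@pt_map t) (tb_g s t x)).
  { intros [|s|s] [|t|t] x H; try (destruct H; fail).
    - apply tb_g_refl.
    - simpl node_map; rewrite (tb_g_comp _ _ _ (j0 r0) _ _ (tlt_le q_lt0)), g_root0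
        by (apply (te_le (se_node_emb j0)), r0_root).
      simpl; destruct (branch0 x) as [y|]; simpl; auto.
      apply (se_g j0), r0_root.
    - simpl node_map; rewrite (tb_g_comp _ _ _ (j1 r1) _ _ (tlt_le q_lt1)), g_root1
        by (apply (te_le (se_node_emb j1)), r1_root).
      simpl; destruct (branch1 x) as [y|]; simpl; auto.
      apply (se_g j1), r1_root.
    - exact (se_g j0 x H).
    - exact (se_g j1 x H). }
  exists (Build_StrongEmb te be sf sg); repeat split.
Qed.
End JoinEmbedding.
End Join.

(** * The set M and its classes *)

Lemma finite_points (C : Chain) (E : TreeOfBSets C) :
  finite_tree_of_B_sets E -> exists l : list (pt E), forall p, In p l.
Proof.
  intros ([l L] & _ & _ & H).
  set (k := fun t => proj1_sig (constructive_indefinite_description _ (H t))).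
  assert (K : forall t x, In x (k t)).
  { intros t; exact (proj2_sig (constructive_indefinite_description _ (H t))). }
  exists (flat_map (fun t => map (mkpt (t := t)) (k t)) l).
  intros [t x]; apply in_flat_map; exists t; split; auto.
  apply (in_map (mkpt (t := t))), K.
Qed.

(* [cls a p] says that [a]_t exists and is [p], where [t] is the node of [p]. *)
Record coherent (C : Chain) (TC : ColouredTree C) (A : TreeOfBSets C) (M : Type)
    (cls : M -> pt A -> Prop) : Prop := {
  co_fun : forall a p q, cls a p -> cls a q -> nd p = nd q -> p = q;
  co_up : forall a p q, cls a p -> gmap p q -> cls a q;
  co_le : forall a p q, cls a p -> cls a q -> tle (nd p) (nd q) -> gmap p q;
  co_down : forall a p s, cls a p -> tle s (nd p) -> exists q, nd q = s /\ cls a q;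
  co_cover : forall (ps : list (pt A)) (ms : list M),
    exists (E : TreeOfBSets C) (r : E) (i : StrongEmb E A) (alpha : bset r -> M),
      finite_over TC E /\ is_root r /\
      (forall x, cls (alpha x) (on_pt i (mkpt x))) /\
      (forall p, In p ps -> exists q, on_pt i q = p) /\
      (forall a, In a ms -> exists x, alpha x = a);
  co_enum : exists (ps : nat -> list (pt A)) (ms : nat -> list M),
    (forall p, exists n, In p (ps n)) /\ (forall a, exists n, In a (ms n))
}.

(** Only classes are compared. For an automorphism this already yields the matching of initial
    segments of nodes required by [acts], because a class of [a] exists at every node below one
    where it exists. *)
Definition acts_on_classes (C : Chain) (A : TreeOfBSets C) (M : Type)
    (cls : M -> pt A -> Prop) (theta : StrongEmb A A) (a b : M) : Prop :=
  exists p1, cls a p1 /\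
    forall p, cls a p -> tle (nd p) (nd p1) -> cls b (on_pt theta p).

Section LimitSets.
Context {C : Chain} {TC : ColouredTree C} {A : TreeOfBSets C}.
Context {U : UnionOfChain TC A} (M : LimitSet U).

Definition limit_class (a : M) (p : pt A) : Prop :=
  exists i (b : bset (root M i)) (q : pt (stage U i)),
    into M b = a /\ gmap (mkpt b) q /\ on_pt (incl U i) q = p.

Let rho i (b : bset (root M i)) : pt A := on_pt (incl U i) (mkpt b).

(** The stages increase, so finitely many requirements, each met from some stage on, are met
    together at one stage. *)
Definition eventually (P : nat -> Prop) : Prop := exists n, forall k, n <= k -> P k.

Lemma eventually_and (P Q : nat -> Prop) :
  eventually P -> eventually Q -> eventually (fun k => P k /\ Q k).
Proof.
  intros [n H] [m K]; exists (max n m); intros k L; split; [apply H|apply K]; lia.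
Qed.

Lemma eventually_list (X : Type) (P : X -> nat -> Prop) (l : list X) :
  (forall x, eventually (P x)) -> eventually (fun k => forall x, In x l -> P x k).
Proof.
  intros H; induction l as [|y l IH].
  - exists 0; intros k _ x [].
  - destruct (eventually_and (H y) IH) as [n K]; exists n; intros k L x I.
    destruct (K k L) as [Ky Kl], I as [<-|I]; auto.
Qed.

Lemma eventually_ex (P : nat -> Prop) : eventually P -> exists k, P k.
Proof. intros [n H]; exists n; auto. Qed.

Lemma stage_le i k (q : pt (stage U i)) : i <= k ->
  exists q', on_pt (incl U k) q' = on_pt (incl U i) q.
Proof.
  induction 1 as [|k _ [q' IH]]; [exists q; auto|].
  exists (on_pt (step U k) q'); rewrite incl_step; auto.
Qed.

Lemma eventually_pt p : eventually (fun k => exists q, on_pt (incl U k) q = p).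
Proof.
  destruct (@incl_cover _ _ _ U p) as (i & q & <-); exists i; intros k H.
  apply stage_le, H.
Qed.

(** A member of [M] passes to a later stage as one of its preimages, so the later representative
    maps onto the earlier one and has all of its classes. *)
Lemma rho_le i k (b : bset (root M i)) : i <= k ->
  exists b' : bset (root M k), into M b' = into M b /\ gmap (rho b') (rho b).
Proof.
  induction 1 as [|k _ (b' & IH & IH')]; [exists b; auto using gmap_refl|].
  exists (next b'); split; [rewrite into_next; auto|].
  apply gmap_trans with (rho b'); auto; unfold rho.
  rewrite <- (@incl_step _ _ _ U k (mkpt b')); apply (pm_gmap (on_pt_morphism (incl U (S k)))).
  split; [apply (@root_is_root _ _ _ _ M)|]. exact (next_preimage b').
Qed.

Lemma eventually_into a : eventually (fun k => exists b : bset (root M k), into M b = a).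
Proof.
  destruct (into_cover a) as (i & b & <-); exists i; intros k H.
  destruct (rho_le b H) as (b' & E & _); eauto.
Qed.

Lemma eventually_class a p : limit_class a p ->
  eventually (fun k => exists b : bset (root M k), into M b = a /\ gmap (rho b) p).
Proof.
  intros (i & b & q & <- & G & <-); exists i; intros k H.
  destruct (rho_le b H) as (b' & E & K); exists b'; split; auto.
  apply gmap_trans with (rho b); auto.
  apply (pm_gmap (on_pt_morphism (incl U i))), G.
Qed.

Lemma limit_class_of i (b : bset (root M i)) p :
  gmap (rho b) p -> limit_class (into M b) p.
Proof.
  intros H.
  destruct (eventually_ex (eventually_and (eventually_pt p)
    (ex_intro _ i (fun k (L : i <= k) => rho_le b L)))) as (k & [q <-] & b' & E & K).
  exists k, b', q; repeat split; auto.
  - apply (@root_is_root _ _ _ _ M).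
  - apply (gmap_trans K) in H; apply (pm_gmap (on_pt_morphism (incl U k))) in H.
    apply H.
Qed.

(** Each clause about classes involves finitely many of them and so takes place in one stage. There
    a member of [M] has a single representative at the root, and functionality and composition of
    [gmap] decide the clause. *)
Lemma limit_class_coherent : coherent TC limit_class.
Proof.
  split.
  - intros a p q Hp Hq E.
    destruct (eventually_ex (eventually_and (eventually_class Hp) (eventually_class Hq)))
      as (k & (b & Eb & G) & b' & Eb' & G').
    assert (b = b') as <- by (apply (@into_inj _ _ _ _ M); congruence).
    exact (gmap_fun G G' E).
  - intros a p q Hp K; destruct (eventually_ex (eventually_class Hp)) as (k & b & <- & G).
    apply limit_class_of, (gmap_trans G K).
  - intros a p q Hp Hq L.
    destruct (eventually_ex (eventually_and (eventually_class Hp) (eventually_class Hq)))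
      as (k & (b & Eb & G) & b' & Eb' & G').
    assert (b = b') as <- by (apply (@into_inj _ _ _ _ M); congruence).
    exact (gmap_cancel G G' L).
  - intros a p s Hp L.
    destruct (point_inhabited (bset s)) as [x].
    destruct (eventually_ex (eventually_and (eventually_class Hp)
      (eventually_pt (mkpt x)))) as (k & (b & <- & G) & q & Eq).
    destruct (@gmap_mid _ _ (rho b) p s) as (p' & E & G' & _); auto.
    + change s with (nd (mkpt x)); rewrite <- Eq.
      apply (pm_le (on_pt_morphism (incl U k))), (@root_is_root _ _ _ _ M).
    + exists p'; split; auto; apply limit_class_of, G'.
  - intros ps ms.
    destruct (eventually_ex (eventually_and (eventually_list ps eventually_pt)
      (eventually_list ms eventually_into))) as (k & Hp & Hm).
    exists (stage U k), (root M k), (incl U k), (@into _ _ _ _ M k).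
    split; [apply stage_finite|]; split; [apply (@root_is_root _ _ _ _ M)|].
    split; auto. intros x; apply limit_class_of, gmap_refl.
  - set (l := fun k => proj1_sig (constructive_indefinite_description _
      (finite_points (proj1 (stage_finite U k))))).
    assert (L : forall k q, In q (l k)).
    { intros k; exact (proj2_sig (constructive_indefinite_description _
        (finite_points (proj1 (stage_finite U k))))). }
    assert (H : forall k, exists l, forall x : bset (root M k), In x l).
    { intros k; destruct (stage_finite U k) as ((_ & _ & _ & H) & _); apply H. }
    set (l' := fun k => proj1_sig (constructive_indefinite_description _ (H k))).
    assert (L' : forall k q, In q (l' k)).
    { intros k; exact (proj2_sig (constructive_indefinite_description _ (H k))). }
    exists (fun k => map (on_pt (incl U k)) (l k)), (fun k => map (into M (i := k)) (l' k)).
    split.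
    + intros p; destruct (@incl_cover _ _ _ U p) as (k & q & <-); exists k.
      apply in_map, L.
    + intros a; destruct (into_cover a) as (k & b & <-); exists k.
      apply in_map, L'.
Qed.

Lemma class_exists_iff a t : class_exists a t <-> exists x : bset t, limit_class a (mkpt x).
Proof.
  split.
  - intros (i & b & t' & <- & <- & N).
    destruct (tb_g (root M i) t' b) as [y|] eqn:E; [|tauto].
    exists (se_pt (incl U i) y), i, b, (mkpt y); repeat split; auto.
    apply (@root_is_root _ _ _ _ M).
  - intros (x & i & b & q & <- & [L G] & E).
    exists i, b, (nd q); split; auto; split; [exact (f_equal nd E)|].
    simpl in G; unfold nd in *; rewrite G; discriminate.
Qed.

Lemma block_iff t (x : bset t) b : block (M := M) x b <-> limit_class b (mkpt x).
Proof.
  split.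
  - intros (i & b' & t' & y & <- & E & <-); exists i, b', (mkpt y); repeat split; auto.
    apply (@root_is_root _ _ _ _ M).
  - intros (i & b' & [t' y] & <- & [L G] & E); exists i, b', t', y; auto.
Qed.

Lemma class_iff a t b : class a t b <->
  exists x : bset t, limit_class a (mkpt x) /\ limit_class b (mkpt x).
Proof.
  split.
  - intros (i & a' & b' & t' & <- & <- & <- & N & E).
    destruct (tb_g (root M i) t' a') as [y|] eqn:G; [|tauto].
    exists (se_pt (incl U i) y); split; [exists i, a', (mkpt y)|exists i, b', (mkpt y)];
      repeat split; auto; apply (@root_is_root _ _ _ _ M).
  - intros (x & Ha & Hb); destruct (point_inhabited (bset t)) as [z].
    destruct (eventually_ex (eventually_and (eventually_and (eventually_class Ha)
      (eventually_class Hb)) (eventually_pt (mkpt x))))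
      as (k & ((a' & <- & Ga) & b' & <- & Gb) & q & E).
    rewrite <- E in Ga, Gb.
    apply (pm_gmap (on_pt_morphism (incl U k))) in Ga, Gb.
    destruct Ga as [_ Ga], Gb as [_ Gb]; simpl in Ga, Gb.
    exists k, a', b', (nd q); unfold nd in *.
    do 2 (split; [auto|]); split; [exact (f_equal nd E)|split; congruence].
Qed.

Lemma class_block a t (x : bset t) : limit_class a (mkpt x) ->
  Ensembles.Same_set M (class a t) (block x).
Proof.
  intros H; split; intros b.
  - unfold Ensembles.In; rewrite class_iff, block_iff; intros (y & K & L).
    assert (E := co_fun limit_class_coherent H K eq_refl); rewrite E; auto.
  - unfold Ensembles.In; rewrite class_iff, block_iff; eauto.
Qed.

Lemma block_class a t (x : bset t) : class_exists a t ->
  Ensembles.Same_set M (class a t) (block x) -> limit_class a (mkpt x).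
Proof.
  rewrite class_exists_iff; intros [y H] [K _].
  apply block_iff, K, class_iff; eauto.
Qed.

Lemma acts_iff (theta : StrongEmb A A) a b : is_iso theta ->
  (acts theta a b <-> acts_on_classes limit_class theta a b).
Proof.
  intros Hth; split.
  - intros (t1 & t2 & H1 & H2 & H3 & H4).
    destruct (proj1 (class_exists_iff a t1) H1) as [x1 K1].
    exists (mkpt x1); split; auto; intros [t x] Hx L; simpl in L.
    assert (Ea : class_exists a t) by (apply class_exists_iff; eauto).
    apply (block_class (x := se_pt theta x)).
    + apply (H3 (theta t)); exists t; auto.
    + apply H4; auto; apply class_block, Hx.
  - intros ([t1 x1] & H1 & H); exists t1, (theta t1).
    split; [apply class_exists_iff; eauto|].
    split.
    { apply class_exists_iff; exists (se_pt theta x1).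
      apply (H (mkpt x1)); auto using tle_refl. }
    assert (K : forall t, class_exists a t -> tle t t1 -> class_exists b (theta t)).
    { intros t Ha L; apply class_exists_iff in Ha as [x Hx].
      apply class_exists_iff; exists (se_pt theta x); apply (H (mkpt x)); auto. }
    split.
    + intros s; split.
      * intros (t & Ha & L & <-); split; auto; apply (te_le (se_node_emb theta)), L.
      * intros [Hb L]; destruct Hth as [[f [_ Hf]] _].
        exists (f s); rewrite Hf; repeat split; auto.
        -- assert (L' : tle (f s) t1) by (apply (te_le (se_node_emb theta)); rewrite Hf; auto).
           destruct (co_down limit_class_coherent H1 L') as ([t y] & E & Hy).
           apply class_exists_iff; simpl in E; subst; eauto.
        -- apply (te_le (se_node_emb theta)); rewrite Hf; auto.
    + intros t x Ha L S; apply class_block, (H (mkpt x)); auto.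
      apply block_class; auto.
Qed.
End LimitSets.

(** * Finite homogeneity *)

(** The three-point line with middle [tri1]. It realises one nontrivial betweenness, and it has
    enough points to occur in a join. *)
Inductive tri := tri0 | tri1 | tri2.
Definition tri_nat (x : tri) := match x with tri0 => 0 | tri1 => 1 | tri2 => 2 end.

Lemma tri_nat_inj : Injective tri_nat.
Proof. intros [] []; simpl; congruence. Qed.

Lemma tri_finite : Finite tri.
Proof. exists (tri0 :: tri1 :: tri2 :: nil); intros []; simpl; auto. Qed.

Definition tri_bset : BSet := linear_bset tri_nat_inj tri0.

Definition triple_node (C : Chain) (d : C) : TreeOfBSets C :=
  single_node d (tri0 : tri_bset) (@linear_bset_no_ramification _ _ tri_nat_inj tri0).

Lemma triple_node_three (C : Chain) (d : C) (t : triple_node d) :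
  exists u v w : bset t, u <> v /\ u <> w /\ v <> w.
Proof. exists tri0, tri1, tri2; repeat split; discriminate. Qed.

Lemma triple_node_finite (C : Chain) (d : C) : finite_tree_of_B_sets (triple_node d).
Proof. apply single_node_finite; exact tri_finite. Qed.

Definition tri_map (X : Type) (x y z : X) (i : tri) : X :=
  match i with tri0 => x | tri1 => y | tri2 => z end.

Lemma tri_map_embedding (X : BSet) (x y z : X) :
  x <> y -> x <> z -> y <> z -> btw y x z ->
  @is_B_embedding tri_bset X (tri_map x y z).
Proof.
  intros n1 n2 n3 H; split.
  - intros [] []; simpl; congruence.
  - assert (N : forall a b, a <> b -> ~ @btw X a b b) by (intros a b n K; apply n, btw_same, K).
    assert (K1 : ~ btw x y z) by (intros K; apply n1, (btw_antisym K H)).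
    assert (K2 : ~ btw z y x).
    { intros K; apply n3; symmetry; apply (btw_antisym K (btw_B1 H)). }
    intros [] [] []; simpl; split; intros K; try lia; try (exfalso; lia);
      auto using btw_refl, btw_refl_r, btw_B1;
      try (exfalso; eapply N; [|exact K]; congruence);
      try (exfalso; auto using btw_B1; fail).
Qed.

(** * Colours and cones in T_C *)

Section TreeTC.
Context {C : Chain} {TC : ColouredTree C}.
Hypothesis TC_spec : is_T_C TC.

Lemma TC_colour (c : C) : exists t : TC, col t = c.
Proof.
  destruct TC_spec as ([t] & _ & _ & H); destruct (H t) as (S & _ & _ & K).
  destruct (K c) as (x & _ & E); eauto.
Qed.

(** The C-chain through [x] has a point of colour [d]. If it lies below [x] it is comparable with
    [s], and its colour places it above [s]. *)
Lemma TC_same_cone (s x : TC) (d : C) : tlt s x -> clt (col s) d ->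
  exists u, tlt s u /\ same_cone s x u /\ col u = d.
Proof.
  intros Hx Hd; destruct TC_spec as (_ & _ & _ & H).
  destruct (H x) as (S & Sx & T & K); destruct (K d) as (u & Su & E).
  destruct (T x u Sx Su) as [L|L].
  - exists u; split; [exact (tlt_le_trans Hx L)|split; auto using same_cone_up].
  - assert (Hu : tlt s u).
    { destruct (tle_below_total (tlt_le Hx) L) as [Q|Q].
      - destruct (tle_lt_or_eq Q) as [Q'|Q']; auto.
        subst; destruct Hd as [_ N]; destruct N; auto.
      - exfalso; apply (clt_not_cle Hd); rewrite <- E; apply col_le, Q. }
    exists u; split; [|split]; auto; exists u; auto using tle_refl.
Qed.

Lemma TC_above (s : TC) (d : C) : clt (col s) d -> exists u, tlt s u /\ col u = d.
Proof.
  intros Hd; destruct TC_spec as (_ & _ & _ & H).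
  destruct (H s) as (S & Ss & T & K); destruct (K d) as (u & Su & E).
  exists u; split; auto; destruct Hd as [Hd N].
  split; [|congruence]. destruct (T s u Ss Su) as [L|L]; auto.
  destruct N; apply cle_antisym; auto; rewrite <- E; apply col_le, L.
Qed.

Lemma TC_cones (s : TC) (d : C) : clt (col s) d -> exists u : nat -> TC,
  (forall i, tlt s (u i) /\ col (u i) = d) /\
  (forall i j, same_cone s (u i) (u j) -> i = j).
Proof.
  intros Hd; destruct (TC_above Hd) as (x & Hx & _).
  assert (R : ramification_order_aleph0 s).
  { destruct TC_spec as (_ & _ & H & _); apply H; intros N; apply N; eauto. }
  destruct R as (f & F1 & F2 & _).
  assert (K : forall i, exists u, tlt s u /\ same_cone s (f i) u /\ col u = d).
  { intros i; apply TC_same_cone; auto. }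
  exists (fun i => proj1_sig (constructive_indefinite_description _ (K i))).
  assert (Q : forall i, let u := proj1_sig (constructive_indefinite_description _ (K i)) in
    tlt s u /\ same_cone s (f i) u /\ col u = d).
  { intros i; exact (proj2_sig (constructive_indefinite_description _ (K i))). }
  cbv zeta in Q; split.
  - intros i; destruct (Q i) as (a & b & e); auto.
  - intros i j K'; apply F2.
    destruct (Q i) as (_ & Qi & _), (Q j) as (_ & Qj & _).
    eauto using same_cone_trans, same_cone_sym.
Qed.
End TreeTC.

(** * Small configurations in the limit *)

Section Limit.
Context {C : Chain} {TC : ColouredTree C} {A : TreeOfBSets C}.
Hypothesis TC_spec : is_T_C TC.
Hypothesis A_limit : is_limit TC A.

Lemma single_node_homogeneous (X : Type) (f : X -> nat) (f_inj : Injective f) (x0 : X)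
  (s t : A) (phi : X -> bset s) (psi : X -> bset t) :
  Finite X -> col s = col t ->
  @is_B_embedding (linear_bset f_inj x0) _ phi ->
  @is_B_embedding (linear_bset f_inj x0) _ psi ->
  exists theta : StrongEmb A A, is_iso theta /\
    forall x, on_pt theta (mkpt (phi x)) = mkpt (psi x).
Proof.
  intros HX E Hphi Hpsi.
  set (N := @linear_bset_no_ramification _ _ f_inj x0).
  set (D := single_node (col t) (x0 : linear_bset f_inj x0) N).
  set (i := single_node_embedding (x0 : linear_bset f_inj x0) N E Hphi).
  set (j := single_node_embedding (x0 : linear_bset f_inj x0) N eq_refl Hpsi).
  destruct (identity_embedding D) as (h & Hh & Eh).
  assert (FD : finite_tree_of_B_sets D) by exact (single_node_finite _ _ N HX).
  destruct (lim_homogeneous A_limit (D := D) (E := D) i j FD FD Hh) as (theta & T & K).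
  exists theta; split; auto; intros x.
  assert (Q := K (mkpt (A := D) (t := tt) x)); rewrite Eh in Q; exact Q.
Qed.

Lemma homogeneous_nodes (s t : A) : col s = col t ->
  exists theta : StrongEmb A A, is_iso theta /\ theta s = t.
Proof.
  intros E; destruct (point_inhabited (bset s)) as [x], (point_inhabited (bset t)) as [y].
  assert (I : Injective (fun _ : unit => 0)) by (intros [] []; auto).
  assert (B : forall u (z : @bset C A u), @is_B_embedding (linear_bset I tt) _ (fun _ => z)).
  { intros u z; split; [intros [] []; auto|]. intros; simpl; split; auto using btw_refl. }
  assert (F : Finite unit) by (exists (tt :: nil); intros []; simpl; auto).
  destruct (single_node_homogeneous F E (B _ x) (B _ y)) as (theta & H & K).
  exists theta; split; auto; exact (f_equal nd (K tt)).
Qed.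

Lemma homogeneous_pairs (p p' q q' : pt A) :
  nd p = nd p' -> p <> p' -> nd q = nd q' -> q <> q' -> col (nd p) = col (nd q) ->
  exists theta : StrongEmb A A, is_iso theta /\ on_pt theta p = q /\ on_pt theta p' = q'.
Proof.
  destruct p as [s x], p' as [s' x'], q as [t y], q' as [t' y']; simpl.
  intros <- N <- N' E.
  assert (Nx : x <> x') by (intros ->; auto).
  assert (Ny : y <> y') by (intros ->; auto).
  assert (I : Injective Nat.b2n) by (intros [] []; simpl; congruence).
  assert (B : forall u (z z' : @bset C A u), z <> z' ->
    @is_B_embedding (linear_bset I true) _ (fun b : bool => if b then z else z')).
  { intros u z z' n; split; [intros [] []; congruence|].
    intros [] [] []; simpl; split; intros H; auto using btw_refl, btw_refl_r; try lia;
      apply btw_same in H; congruence. }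
  assert (F : Finite bool) by (exists (true :: false :: nil); intros []; simpl; auto).
  destruct (single_node_homogeneous F E (B _ _ _ Nx) (B _ _ _ Ny)) as (theta & H & K).
  exists theta; split; [auto|]; split; [exact (K true)|exact (K false)].
Qed.

Definition double_star (c d : C) (H : clt c d) : TreeOfBSets C :=
  @join C (triple_node d) (triple_node d) tt tt (fun _ => I) (fun _ => I) c tri0 tri0
    H H (triple_node_three tt) (triple_node_three tt).

Lemma double_star_over (c d : C) (H : clt c d) : finite_over TC (double_star H).
Proof.
  split; [apply join_finite; apply triple_node_finite|].
  destruct (TC_colour TC_spec c) as [s Hs]; subst c.
  destruct (TC_cones TC_spec H) as (u & Hu & Hc).
  assert (P : is_meet tle (u 0) (u 1) s).
  { apply not_same_cone_meet; try apply Hu; intros K; apply Hc in K; discriminate. }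
  assert (N : forall i j, i <> j -> ~ tle (u i) (u j)).
  { intros i j n K; apply n, Hc, same_cone_up; auto; apply Hu. }
  assert (D : forall i, ~ tle (u i) s) by (intros i; apply tlt_not_le, Hu).
  assert (L : forall i, tle s (u i)) by (intros i; apply tlt_le, Hu).
  exists (fun n : double_star H => match n with jroot => s | jl _ => u 0 | jr _ => u 1 end).
  split.
  - intros [|[]|[]]; simpl; auto; apply Hu.
  - intros [|[]|[]] [|[]|[]]; simpl; split; intros K; auto using tle_refl; try tauto;
      try (exfalso; eapply D; eauto; fail);
      exfalso; solve [revert K; apply (N 0 1); lia | revert K; apply (N 1 0); lia].
  - intros [|[]|[]] [|[]|[]] m K.
    all: assert (K1 := proj1 K); assert (K2 := proj1 (proj2 K)).
    all: try (assert (m = jroot) as -> by (destruct m; simpl in K1, K2; tauto);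
      simpl; auto using is_meet_le, is_meet_sym, tle_refl; fail).

    + destruct m as [|[]|[]]; [|apply is_meet_le, tle_refl|destruct K1].
      destruct K as (_ & _ & K); destruct (K (@jl C (triple_node d) (triple_node d) tt)); exact I.
    + destruct m as [|[]|[]]; [|destruct K1|apply is_meet_le, tle_refl].
      destruct K as (_ & _ & K); destruct (K (@jr C (triple_node d) (triple_node d) tt)); exact I.
Qed.

Lemma exists_pair (c : C) : exists p p' : pt A, nd p = nd p' /\ p <> p' /\ col (nd p) = c.
Proof.
  assert (F : finite_over TC (triple_node c)).
  { split; [apply triple_node_finite|].
    apply single_node_over, TC_colour, TC_spec. }
  destruct (lim_universal A_limit F) as [e].
  exists (on_pt e (mkpt (A := triple_node c) (t := tt) tri0)),
    (on_pt e (mkpt (A := triple_node c) (t := tt) tri1)).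
  split; auto; split.
  - intros E; apply on_pt_inj in E; apply mkpt_inj in E; discriminate.
  - apply (te_col (se_node_emb e)).
Qed.

(** In an embedded double star the two centres are such a pair, with the triple at the right-hand
    node. Any two pairs of distinct points at nodes of equal colour are conjugate, since two points
    are always collinear, so the triple can be moved over to [p] and [p']. In particular every point
    of [A] is the cone point of some higher node. *)
Lemma exists_triple_in_cone (p p' : pt A) (d : C) :
  nd p = nd p' -> p <> p' -> clt (col (nd p)) d ->
  exists l m r : pt A, tlt (nd p) (nd l) /\ p' = cone_pt (nd p) (nd l) /\
    col (nd l) = d /\ gmap p l /\ l <> m /\ l <> r /\ m <> r /\ between m l r.
Proof.
  intros E N H; remember (col (nd p)) as c eqn:Ec.
  destruct (lim_universal A_limit (double_star_over H)) as [e].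
  set (e0 := @mkpt C (double_star H) jroot (inr tri0)).
  set (e1 := @mkpt C (double_star H) jroot (inl tri0)).
  set (x := @mkpt C (double_star H) (@jr C (triple_node d) (triple_node d) tt)).
  destruct (@homogeneous_pairs (on_pt e e0) (on_pt e e1) p p') as (theta & Hth & <- & <-); auto.
  { intros K; apply on_pt_inj in K; apply mkpt_inj in K; discriminate. }
  { rewrite (pm_col (on_pt_morphism e)), <- Ec; reflexivity. }
  destruct (embedding_comp e theta) as [k K]; rewrite <- !K.
  assert (P := on_pt_morphism k).
  exists (on_pt k (x tri0)), (on_pt k (x tri1)), (on_pt k (x tri2)).
  split; [|split; [|split; [|split; [|split; [|split; [|split]]]]]].
  - apply (pm_tlt _ _ P); split; [exact I|discriminate].
  - apply (pm_cone P); [split; [exact I|discriminate]|reflexivity].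
  - apply (pm_col P).
  - apply (pm_gmap P); split; [exact I|reflexivity].
  - intros Q; apply on_pt_inj, mkpt_inj in Q; discriminate.
  - intros Q; apply on_pt_inj, mkpt_inj in Q; discriminate.
  - intros Q; apply on_pt_inj, mkpt_inj in Q; discriminate.
  - apply (pm_between P), between_mkpt; simpl; lia.
Qed.

(** Some node of colour [c] has a node of the colour of [t] above it; homogeneity on nodes moves the
    upper one to [t]. *)
Lemma exists_node_below (t : A) (c : C) : clt c (col t) ->
  exists s, tlt s t /\ col s = c.
Proof.
  intros H; destruct (exists_pair c) as (p & p' & E & N & Hc).
  destruct (@exists_triple_in_cone p p' (col t)) as (l & _ & _ & L & _ & Hl & _); auto.
  { congruence. }
  destruct (homogeneous_nodes Hl) as (theta & _ & K).
  exists (theta (nd p)); split.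
  - rewrite <- K; apply se_tlt, L.
  - rewrite <- Hc; apply (te_col (se_node_emb theta)).
Qed.

(* Two sections of [tb_g q (j r)] are conjugate over [D]: either extends to an
   embedding of the join of [D] with a three-point node, whose only purpose is
   to make the new root ramify. *)
Lemma sections_conjugate (D : TreeOfBSets C) (r : D) (j : StrongEmb D A) (q : A)
  (y z : bset r -> bset q) :
  finite_tree_of_B_sets D -> is_root r ->
  (exists u v w : bset r, u <> v /\ u <> w /\ v <> w) ->
  tlt q (j r) ->
  (forall x, tb_g q (j r) (y x) = Some (se_pt j x)) ->
  (forall x, tb_g q (j r) (z x) = Some (se_pt j x)) ->
  exists theta : StrongEmb A A, is_iso theta /\
    (forall p, on_pt theta (on_pt j p) = on_pt j p) /\
    (forall x, on_pt theta (mkpt (y x)) = mkpt (z x)).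
Proof.
  intros FD Hr three Hq Hy Hz.
  destruct (point_inhabited (bset r)) as [x0].
  set (d := col (j r)).
  assert (Hd : clt (col q) d) by (destruct Hq; apply col_lt; auto).
  assert (Hc : clt (col q) (col r)) by (rewrite <- (te_col (se_node_emb j)); exact Hd).
  set (J := @join C D (triple_node d) r tt Hr (fun _ => I) (col q) x0 tri0
              Hc Hd three (triple_node_three tt)).
  assert (Emb : forall y : bset r -> bset q,
    (forall x, tb_g q (j r) (y x) = Some (se_pt j x)) ->
    exists k : StrongEmb J A,
      (forall s (x : bset s), on_pt k (mkpt (A := J) (t := jl s) x) = on_pt j (mkpt x)) /\
      (forall x, on_pt k (mkpt (A := J) (t := jroot) (inl x)) = mkpt (y x))).
  { clear y z Hy Hz; intros y Hy.
    (* The extra node is taken in the cone of [y x0], with the cone point of [j r] mapping to its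
       point [tri0]: these are the conditions [y0_f] and [y1_f] of [join_embedding]. *)
    destruct (@exists_triple_in_cone (cone_pt q (j r)) (mkpt (y x0)) d)
      as (l & m & w & H1 & H2 & H3 & H4 & n1 & n2 & n3 & H5); auto.
    { intros E; unfold cone_pt in E; apply mkpt_inj in E.
      assert (K := Hy x0); rewrite <- E, tb_g_cone_pt in K by auto; discriminate. }
    destruct H5 as (t & bm & bl & bw & -> & -> & -> & H5).
    simpl in H1, H3, H4; unfold cone_pt in H2; apply mkpt_inj in H2; simpl in H2.
    destruct H4 as [_ H4]; simpl in H4.
    destruct (tb_g_surj _ _ _ _ bm H1) as [am Em].
    destruct (tb_g_surj _ _ _ _ bw H1) as [aw Ew].
    assert (T : is_B_embedding (tri_map bl bm bw : tri_bset -> _)).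
    { apply tri_map_embedding; auto; congruence. }
    set (j1 := single_node_embedding (tri0 : tri_bset)
      (@linear_bset_no_ramification _ _ tri_nat_inj tri0) H3 T).
    destruct (@join_embedding C D (triple_node d) r tt Hr (fun _ => I) (col q) x0 tri0
              Hc Hd three (triple_node_three tt) A q j j1 y
              (tri_map (tb_f q (j r)) am aw)) as (k & K1 & _ & K2 & _); auto.
    - intros []; simpl; auto.
    - exists k; split; auto. }
  (* [J] does not depend on the section, so both sections give embeddings of the same finite tree
     and its identity can be extended. *)
  destruct (Emb y Hy) as (k1 & K1 & K1'), (Emb z Hz) as (k2 & K2 & K2').
  assert (FJ : finite_tree_of_B_sets J).
  { apply join_finite; auto; apply triple_node_finite. }
  destruct (identity_embedding J) as (h & Hh & Eh).
  destruct (lim_homogeneous A_limit k1 k2 FJ FJ Hh) as (theta & T & K).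
  exists theta; split; auto; split.
  - intros [s x]; fold (mkpt x); rewrite <- K1, K, Eh, K1, K2; auto.
  - intros x; rewrite <- K1', K, Eh, K2'; auto.
Qed.
End Limit.

(** * Homogeneity of A together with M *)

Lemma generic_sequence (X : Type) (le : X -> X -> Prop) (D : nat -> X -> Prop) (x0 : X) :
  (forall n x, exists y, le x y /\ D n y) ->
  exists f : nat -> X, f 0 = x0 /\ forall n, le (f n) (f (S n)) /\ D n (f (S n)).
Proof.
  intros H.
  set (nxt := fun n x => proj1_sig (constructive_indefinite_description _ (H n x))).
  assert (N : forall n x, le x (nxt n x) /\ D n (nxt n x)).
  { intros n x; exact (proj2_sig (constructive_indefinite_description _ (H n x))). }
  exists (fix f n := match n with 0 => x0 | S n => nxt n (f n) end).
  split; auto; intros n; apply N.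
Qed.

Lemma bijective_of_inj_surj (X Y : Type) (f : X -> Y) :
  Injective f -> (forall y, exists x, f x = y) -> Bijective f.
Proof.
  intros I S.
  exists (fun y => proj1_sig (constructive_indefinite_description _ (S y))).
  assert (K : forall y, f (proj1_sig (constructive_indefinite_description _ (S y))) = y).
  { intros y; exact (proj2_sig (constructive_indefinite_description _ (S y))). }
  split; auto.
Qed.

Section Homogeneity.
Context {C : Chain} {TC : ColouredTree C} {A : TreeOfBSets C}.
Hypothesis TC_spec : is_T_C TC.
Hypothesis A_limit : is_limit TC A.
Hypothesis C_no_least : no_least C.
Context {M : Type} {cls : M -> pt A -> Prop}.
Hypothesis cls_coherent : coherent TC cls.

Lemma class_of_pt p : exists a, cls a p.
Proof.
  destruct (co_cover cls_coherent (p :: nil) nil)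
    as (E & r & i & alpha & _ & Hr & Ha & Hp & _).
  destruct (Hp p) as [q <-]; [left; auto|].
  destruct (gmap_surj (Hr (nd q))) as (q0 & E0 & G).
  destruct (pt_at_node E0) as [x ->]; exists (alpha x).
  apply (co_up cls_coherent (Ha x)), (pm_gmap (on_pt_morphism i)), G.
Qed.

(* The partial automorphism [si p |-> sj p] of [A] and the partial map
   [sa x |-> sb x] of [M]; three points at the root are needed to apply
   [sections_conjugate]. *)
Record state := {
  sD : TreeOfBSets C;
  sr : sD;
  si : StrongEmb sD A;
  sj : StrongEmb sD A;
  sa : bset sr -> M;
  sb : bset sr -> M;
  s_finite : finite_over TC sD;
  s_root : is_root sr;
  s_three : exists u v w : bset sr, u <> v /\ u <> w /\ v <> w;
  s_cls_a : forall x, cls (sa x) (on_pt si (mkpt x));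
  s_cls_b : forall x, cls (sb x) (on_pt sj (mkpt x))
}.

Definition flip (s : state) : state :=
  {| si := sj s; sj := si s; sa := @sb s; sb := @sa s; s_finite := s_finite s;
     s_root := @s_root s; s_three := s_three s; s_cls_a := @s_cls_b s;
     s_cls_b := @s_cls_a s |}.

Definition state_le (s s' : state) : Prop :=
  (forall p, exists p', on_pt (si s') p' = on_pt (si s) p /\
                        on_pt (sj s') p' = on_pt (sj s) p) /\
  (forall x, exists x', @sa s' x' = @sa s x /\ @sb s' x' = @sb s x).

Definition covers (ps : list (pt A)) (ms : list M) (s : state) : Prop :=
  (forall p, In p ps -> exists q, on_pt (si s) q = p) /\
  (forall a, In a ms -> exists x, @sa s x = a).

Lemma sa_inj s : Injective (@sa s).
Proof.
  intros x y E; assert (Hx := s_cls_a x); rewrite E in Hx.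
  apply (mkpt_inj (C := C)), (on_pt_inj (e := si s)).
  apply (co_fun cls_coherent Hx (s_cls_a y)); reflexivity.
Qed.

Lemma sb_inj s : Injective (@sb s).
Proof. exact (@sa_inj (flip s)). Qed.

Lemma state_le_refl s : state_le s s.
Proof. split; eauto. Qed.

Lemma state_le_trans s t u : state_le s t -> state_le t u -> state_le s u.
Proof.
  intros [H H'] [K K']; split.
  - intros p; destruct (H p) as (p' & <- & <-); apply K.
  - intros x; destruct (H' x) as (x' & <- & <-); apply K'.
Qed.

Lemma state_le_flip s t : state_le s t -> state_le (flip s) (flip t).
Proof.
  intros [H H']; split.
  - intros p; destruct (H p) as (p' & ? & ?); exists p'; auto.
  - intros x; destruct (H' x) as (x' & ? & ?); exists x'; auto.
Qed.

Lemma covers_le ps ms s t : state_le s t -> covers ps ms s -> covers ps ms t.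
Proof.
  intros [H H'] [K K']; split.
  - intros p Hp; destruct (K p Hp) as [q <-]; destruct (H q) as (q' & ? & _); eauto.
  - intros a Ha; destruct (K' a Ha) as [x <-]; destruct (H' x) as (x' & ? & _); eauto.
Qed.

Lemma below_colour (c : C) : exists d, clt d c.
Proof.
  apply NNPP; intros N; apply C_no_least; exists c; intros d.
  apply NNPP; intros K; apply N; exists d; apply not_cle, K.
Qed.

(** The right-hand embedding extends to a larger stage by [lim_extension], but at the new root it
    may disagree with the classes prescribed by [sb]. The values it gives and the prescribed classes
    are two sections over the old root, so [sections_conjugate] supplies an automorphism that
    corrects it and fixes what was matched before. *)
Lemma forth (s : state) ps ms : exists t, state_le s t /\ covers ps ms t.
Proof.
  destruct s as [D r i j a b FD Hr three Ha Hb].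
  destruct (finite_points (proj1 FD)) as [l L].
  destruct (proj2 (proj2 (proj2 (proj1 FD))) r) as [l' L'].
  (* A node strictly below the old root is put into the new stage, so the two roots differ as
     [sections_conjugate] requires. *)
  destruct (below_colour (col (i r))) as [c Hc].
  destruct (exists_node_below TC_spec A_limit Hc) as (n & Hn & _).
  destruct (point_inhabited (bset n)) as [xn].
  destruct (co_cover cls_coherent (mkpt xn :: map (on_pt i) l ++ ps) (map a l' ++ ms))
    as (E & r' & i' & a' & FE & Hr' & Ha' & Hps & Hms).
  assert (Hi : forall p, exists q, on_pt i' q = on_pt i p).
  { intros p; apply Hps; right; apply in_or_app; left; apply in_map, L. }
  assert (Hw : forall x, exists w, a' w = a x).
  { intros x; apply Hms, in_or_app; left; apply in_map, L'. }
  assert (Hn' : tle (i' r') n).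
  { destruct (Hps (mkpt xn)) as [q Eq]; [left; auto|].
    change n with (nd (mkpt xn)); rewrite <- Eq.
    apply (te_le (se_node_emb i')), Hr'. }
  destruct (embedding_factor Hi) as [e He].
  destruct (lim_extension A_limit e j FD FE) as [j1 Hj1].
  assert (Ge : forall x w, a' w = a x -> gmap (mkpt w) (on_pt e (mkpt x))).
  { intros x w Ew; apply (pm_gmap (on_pt_morphism i')); rewrite He.
    assert (K := Ha' w); rewrite Ew in K.
    apply (co_le cls_coherent K (Ha x)); simpl.
    apply (tle_trans Hn'), tlt_le, Hn. }
  assert (Gj : forall x w, a' w = a x -> gmap (on_pt j1 (mkpt w)) (on_pt j (mkpt x))).
  { intros x w Ew; rewrite <- Hj1; apply (pm_gmap (on_pt_morphism j1)), Ge, Ew. }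
  assert (Lq : tlt (j1 r') (j r)).
  { destruct (point_inhabited (bset r)) as [x].
    assert (K : nd (on_pt j1 (on_pt e (mkpt x))) = j r) by (rewrite Hj1; auto).
    rewrite <- K; apply se_tlt, (se_tlt i').
    change (tlt (i' r') (nd (on_pt i' (on_pt e (mkpt x))))); rewrite He.
    exact (tle_lt_trans Hn' Hn). }
  assert (Hz : forall x, exists z : bset (j1 r'), cls (b x) (mkpt z)).
  { intros x; destruct (co_down cls_coherent (Hb x) (tlt_le Lq)) as (q & Eq & K).
    destruct (pt_at_node Eq) as [z ->]; eauto. }
  set (w := fun x => proj1_sig (constructive_indefinite_description _ (Hw x))).
  assert (Ew : forall x, a' (w x) = a x).
  { intros x; exact (proj2_sig (constructive_indefinite_description _ (Hw x))). }
  set (z := fun x => proj1_sig (constructive_indefinite_description _ (Hz x))).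
  assert (Ez : forall x, cls (b x) (mkpt (z x))).
  { intros x; exact (proj2_sig (constructive_indefinite_description _ (Hz x))). }
  destruct (@sections_conjugate C TC A TC_spec A_limit D r j (j1 r')
    (fun x => se_pt j1 (w x)) z (proj1 FD) Hr three Lq) as (theta & Hth & T1 & T2).
  { intros x; exact (proj2 (Gj x (w x) (Ew x))). }
  { intros x; exact (proj2 (co_le cls_coherent (Ez x) (Hb x) (tlt_le Lq))). }
  destruct (embedding_comp j1 theta) as [j' Hj'].
  assert (inj' : Injective a').
  { intros u v Eu; apply (mkpt_inj (C := C)), (on_pt_inj (e := i')).
    assert (K := Ha' u); rewrite Eu in K.
    apply (co_fun cls_coherent K (Ha' v)); reflexivity. }
  assert (inja : Injective a).
  { intros u v Eu; apply (mkpt_inj (C := C)), (on_pt_inj (e := i)).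
    assert (K := Ha u); rewrite Eu in K.
    apply (co_fun cls_coherent K (Ha v)); reflexivity. }
  (* Members of [M] matched before keep their partners, which now lie in the right class; for a new
     one any member of the class will do. *)
  assert (Hb' : forall v, exists m, cls m (on_pt j' (mkpt v)) /\
    forall x, a' v = a x -> m = b x).
  { intros v; destruct (classic (exists x, a' v = a x)) as [[x Ex]|N].
    - exists (b x); split.
      + assert (v = w x) as -> by (apply inj'; rewrite Ew; auto).
        rewrite Hj'; change (on_pt j1 (mkpt (w x))) with (mkpt (se_pt j1 (w x))).
        rewrite T2; auto.
      + intros y Ey; f_equal; apply inja; congruence.
    - destruct (class_of_pt (on_pt j' (mkpt v))) as [m Hm]; exists m; split; auto.
      intros x Ex; destruct N; eauto. }
  set (b' := fun v => proj1_sig (constructive_indefinite_description _ (Hb' v))).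
  assert (Eb' : forall v, cls (b' v) (on_pt j' (mkpt v)) /\
    forall x, a' v = a x -> b' v = b x).
  { intros v; exact (proj2_sig (constructive_indefinite_description _ (Hb' v))). }
  assert (three' : exists u v w : bset r', u <> v /\ u <> w /\ v <> w).
  { destruct three as (x & y & v & n1 & n2 & n3).
    exists (w x), (w y), (w v); repeat split; intros K; apply (f_equal a') in K;
      rewrite !Ew in K; apply inja in K; auto. }
  exists {| si := i'; sj := j'; sa := a'; sb := b'; s_finite := FE; s_root := Hr';
            s_three := three'; s_cls_a := Ha'; s_cls_b := fun v => proj1 (Eb' v) |}.
  split; split; simpl.
  - intros p; exists (on_pt e p); split; auto.
    rewrite Hj', Hj1; auto.
  - intros x; exists (w x); split; auto; apply Eb'; auto.
  - intros p Hp; apply Hps; right; apply in_or_app; auto.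
  - intros m Hm; apply Hms, in_or_app; auto.
Qed.

Lemma back (s : state) ps ms : exists t, state_le s t /\ covers ps ms (flip t).
Proof.
  destruct (forth (flip s) ps ms) as (t & L & K); exists (flip t); split.
  - apply state_le_flip in L; destruct s; exact L.
  - destruct t; exact K.
Qed.

(** [pi] is carried along with [theta] because an automorphism is not known in advance to act as a
    function on [M]. *)
Definition automorphism_pair (pi : M -> M) (theta : StrongEmb A A) : Prop :=
  Bijective pi /\ is_iso theta /\ forall a, acts_on_classes cls theta a (pi a).

Theorem state_extends (s : state) : exists pi theta,
  automorphism_pair pi theta /\ forall x, pi (@sa s x) = @sb s x.
Proof.
  destruct (co_enum cls_coherent) as (ps & ms & Hps & Hms).
  destruct (@generic_sequence state state_le
    (fun n t => covers (ps n) (ms n) t /\ covers (ps n) (ms n) (flip t)) s)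
    as (f & <- & Hf).
  { intros n t; destruct (forth t (ps n) (ms n)) as (t' & L & K).
    destruct (back t' (ps n) (ms n)) as (t'' & L' & K').
    exists t''; split; [eapply state_le_trans; eauto|split; auto].
    eapply covers_le; eauto. }
  assert (mono : forall n m, n <= m -> state_le (f n) (f m)).
  { induction 1; [apply state_le_refl|eapply state_le_trans; [eauto|apply Hf]]. }
  assert (cov : forall n m, S n <= m -> covers (ps n) (ms n) (f m) /\
                                        covers (ps n) (ms n) (flip (f m))).
  { intros n m H; apply mono in H; destruct (Hf n) as (_ & K & K'); split.
    - eapply covers_le; eauto.
    - eapply covers_le; [apply state_le_flip|]; eauto. }
  assert (in_i : forall p, eventually (fun n => exists q, on_pt (si (f n)) q = p)).
  { intros p; destruct (Hps p) as [n Hn]; exists (S n); intros m L.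
    apply (proj1 (cov n m L)), Hn. }
  assert (in_j : forall p, eventually (fun n => exists q, on_pt (sj (f n)) q = p)).
  { intros p; destruct (Hps p) as [n Hn]; exists (S n); intros m L.
    apply (proj2 (cov n m L)), Hn. }
  assert (in_a : forall c, eventually (fun n => exists x, @sa (f n) x = c)).
  { intros c; destruct (Hms c) as [n Hn]; exists (S n); intros m L.
    apply (proj1 (cov n m L)), Hn. }
  assert (in_b : forall c, eventually (fun n => exists x, @sb (f n) x = c)).
  { intros c; destruct (Hms c) as [n Hn]; exists (S n); intros m L.
    apply (proj2 (cov n m L)), Hn. }
  assert (common : forall n m, exists k, state_le (f n) (f k) /\ state_le (f m) (f k)).
  { intros n m; exists (max n m); split; apply mono; lia. }
  (* Successive states live on different finite trees, so the limit map is defined through the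
     images in [A]; two descriptions of [p] are compared in a common later state. *)
  assert (Hh : forall p, exists p', forall n q, on_pt (si (f n)) q = p ->
    on_pt (sj (f n)) q = p').
  { intros p; destruct (eventually_ex (in_i p)) as (n & q & <-).
    exists (on_pt (sj (f n)) q); intros m q' E.
    destruct (common n m) as (k & [K _] & [K' _]).
    destruct (K q) as (u & U1 & U2), (K' q') as (v & V1 & V2).
    assert (u = v) as -> by (apply (on_pt_inj (e := si (f k))); congruence).
    congruence. }
  set (h := fun p => proj1_sig (constructive_indefinite_description _ (Hh p))).
  assert (Eh : forall n q, h (on_pt (si (f n)) q) = on_pt (sj (f n)) q).
  { intros n q; symmetry.
    exact (proj2_sig (constructive_indefinite_description _ (Hh _)) n q eq_refl). }
  assert (Hpi : forall c, exists c', forall n x, @sa (f n) x = c -> @sb (f n) x = c').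
  { intros c; destruct (eventually_ex (in_a c)) as (n & q & <-).
    exists (@sb (f n) q); intros m q' E.
    destruct (common n m) as (k & [_ K] & [_ K']).
    destruct (K q) as (u & U1 & U2), (K' q') as (v & V1 & V2).
    assert (u = v) as -> by (apply (@sa_inj (f k)); congruence).
    congruence. }
  set (pi := fun c => proj1_sig (constructive_indefinite_description _ (Hpi c))).
  assert (Epi : forall n x, pi (@sa (f n) x) = @sb (f n) x).
  { intros n q; symmetry.
    exact (proj2_sig (constructive_indefinite_description _ (Hpi _)) n q eq_refl). }
  assert (Mh : pt_morphism h).
  { assert (P : forall p q r, exists n p' q' r', p = on_pt (si (f n)) p' /\
      q = on_pt (si (f n)) q' /\ r = on_pt (si (f n)) r').
    { intros p q r.
      destruct (eventually_ex (eventually_and (in_i p) (eventually_and (in_i q) (in_i r))))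
        as (n & [p' <-] & [q' <-] & [r' <-]).
      exists n, p', q', r'; auto. }
    assert (J : forall n, pt_morphism (on_pt (sj (f n)))) by (intros; apply on_pt_morphism).
    assert (I : forall n, pt_morphism (on_pt (si (f n)))) by (intros; apply on_pt_morphism).
    split.
    - intros p q E; destruct (P p q q) as (n & p' & q' & _ & -> & -> & _).
      rewrite !Eh in E; apply (pm_inj (J n)) in E; congruence.
    - intros p; destruct (P p p p) as (n & p' & _ & _ & -> & _).
      rewrite Eh, (pm_col (J n)), (pm_col (I n)); auto.
    - intros p q; destruct (P p q q) as (n & p' & q' & _ & -> & -> & _).
      rewrite !Eh, (pm_le (J n)), (pm_le (I n)); tauto.
    - intros p q r; destruct (P p q r) as (n & p' & q' & r' & -> & -> & ->).
      rewrite !Eh, <- (pm_meet (J n)), <- (pm_meet (I n)); tauto.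
    - intros p q r; destruct (P p q r) as (n & p' & q' & r' & -> & -> & ->).
      rewrite !Eh, (pm_between (J n)), (pm_between (I n)); tauto.
    - intros p q r L; destruct (P p q r) as (n & p' & q' & r' & -> & -> & ->).
      apply (pm_tlt _ _ (I n)) in L.
      rewrite !Eh, (pm_cone (J n)), (pm_cone (I n)) by auto; tauto.
    - intros p q; destruct (P p q q) as (n & p' & q' & _ & -> & -> & _).
      rewrite !Eh, (pm_gmap (J n)), (pm_gmap (I n)); tauto.
    - intros p q L; destruct (P p q q) as (n & p' & q' & _ & -> & -> & _).
      apply (pm_le (I n)) in L.
      rewrite !Eh, (pm_dom (J n)), (pm_dom (I n)) by auto; tauto. }
  destruct (embedding_of_morphism Mh) as [theta Hth].
  exists pi, theta; split; [split; [|split]|].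
  - apply bijective_of_inj_surj.
    + intros c d E.
      destruct (eventually_ex (eventually_and (in_a c) (in_a d)))
        as (n & [x <-] & [y <-]).
      rewrite !Epi in E; apply sb_inj in E; congruence.
    + intros c; destruct (eventually_ex (in_b c)) as (n & x & <-); eauto.
  - apply is_iso_on_pt; intros p; destruct (eventually_ex (in_j p)) as (n & q & <-).
    exists (on_pt (si (f n)) q); rewrite Hth; auto.
  - intros c; destruct (eventually_ex (in_a c)) as (n & x & <-).
    exists (on_pt (si (f n)) (mkpt x)); split; [apply s_cls_a|].
    intros p Hp _.
    destruct (eventually_ex (eventually_and (in_i p) (in_a (@sa (f n) x))))
      as (m & [q <-] & [y Ey]).
    rewrite Hth, Eh, <- Ey, Epi; rewrite <- Ey in Hp.
    apply (co_up cls_coherent (s_cls_b y)), (pm_gmap (on_pt_morphism _)).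
    apply (pm_gmap (on_pt_morphism (si (f m)))).
    apply (co_le cls_coherent (s_cls_a y) Hp).
    apply (pm_le (on_pt_morphism (si (f m)))), s_root.
  - intros x; apply Epi.
Qed.
End Homogeneity.
Arguments automorphism_pair {C A M} cls pi theta.

(** * The ternary relation of M *)

Lemma finite_maximal (X : Type) (lt : X -> X -> Prop) (P : X -> Prop) :
  Finite X -> (forall x, ~ lt x x) -> (forall x y z, lt x y -> lt y z -> lt x z) ->
  (exists x, P x) -> exists x, P x /\ forall y, lt x y -> ~ P y.
Proof.
  intros [l L] I T [x0 H0].
  assert (K : exists x, P x /\ forall y, In y l -> lt x y -> ~ P y).
  { clear L; induction l as [|y l (x & Hx & IH)].
    - exists x0; split; auto; intros y [].
    - destruct (classic (P y /\ lt x y)) as [[Hy Lxy]|N].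
      + exists y; split; auto; intros z [<-|Hz] K; [destruct (I _ K)|].
        apply IH; eauto.
      + exists x; split; auto; intros z [<-|Hz] K Pz; [tauto|].
        exact (IH z Hz K Pz). }
  destruct K as (x & Hx & K); exists x; split; auto.
Qed.

(** Seen from [o], the point [b] is on the side of [o'], while [a] and [p] are not; seen from [o'],
    therefore, [a] and [p] are both on the side of [o]. *)
Lemma same_side (X : BSet) (o o' p a b : X) : o <> o' ->
  btw o p b -> btw o a b -> btw o' a b -> btw o a o' ->
  p <> o' /\ ~ btw o' a p.
Proof.
  intros N Hpb Hab H' Ha.
  assert (Q : forall x, btw o x o' -> ~ btw o' x o).
  { intros x K K'; apply N; apply (btw_antisym (z := x)); auto using btw_B1. }
  assert (Hb : ~ btw o b o').
  { destruct (btw_B3 o H') as [K|K]; [destruct (Q a Ha K)|].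
    intros L; apply (Q b L), btw_B1, K. }
  assert (Hp : btw o p o').
  { destruct (btw_B3 o' Hpb) as [K|K]; auto. destruct Hb; apply btw_B1, K. }
  split.
  - intros ->; apply N, (btw_same Hp).
  - intros K; destruct (btw_B3 o K) as [L|L]; [exact (Q a Ha L)|].
    apply (Q p Hp), btw_B1, L.
Qed.

Definition some_order (X : BSet) (x y z : X) : Prop :=
  btw x y z \/ btw y x z \/ btw z x y.

Section Resolution.
Context {C : Chain} {TC : ColouredTree C} {A : TreeOfBSets C}.
Context {M : Type} {cls : M -> pt A -> Prop}.
Hypothesis cls_coherent : coherent TC cls.

Definition split_at (P : forall t : A, bset t -> bset t -> bset t -> Prop)
    (t : A) (a b c : M) : Prop :=
  exists x y z : bset t, cls a (mkpt x) /\ cls b (mkpt y) /\ cls c (mkpt z) /\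
    x <> y /\ x <> z /\ y <> z /\ P t x y z.

(* The ternary relation of [M]: at [t], the first point lies between the
   others. *)
Definition resolved : A -> M -> M -> M -> Prop := split_at (fun t => @btw (bset t)).

Definition some_resolved : A -> M -> M -> M -> Prop :=
  split_at (fun t => @some_order (bset t)).

Lemma cls_fun_at t (x y : bset t) a : cls a (mkpt x) -> cls a (mkpt y) -> x = y.
Proof.
  intros H K; apply (mkpt_inj (C := C)), (co_fun cls_coherent H K); reflexivity.
Qed.

Lemma cls_g s t (x : bset s) (y : bset t) a :
  tle s t -> cls a (mkpt x) -> cls a (mkpt y) -> tb_g s t x = Some y.
Proof. intros L H K; exact (proj2 (co_le cls_coherent H K L)). Qed.

Lemma cls_down_at s t (y : bset t) a : tle s t -> cls a (mkpt y) ->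
  exists x : bset s, cls a (mkpt x) /\ tb_g s t x = Some y.
Proof.
  intros L H; destruct (co_down cls_coherent (s := s) H L) as (q & E & K).
  destruct (pt_at_node E) as [x ->]; exists x; split; auto.
  exact (cls_g L K H).
Qed.

Lemma cls_up_at s t (x : bset s) (y : bset t) a : tle s t -> cls a (mkpt x) ->
  tb_g s t x = Some y -> cls a (mkpt y).
Proof. intros L H E; apply (co_up cls_coherent H); split; auto. Qed.

(** By [g_distinct_btw], classes that are distinct at [t] come from distinct branches at the cone
    point of [t]: below [t] the triple is a star with that centre. *)
Lemma split_star P s t a b c : tlt s t -> split_at P t a b c ->
  exists x y z : bset s, cls a (mkpt x) /\ cls b (mkpt y) /\ cls c (mkpt z) /\
    x <> tb_f s t /\ y <> tb_f s t /\ z <> tb_f s t /\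
    x <> y /\ x <> z /\ y <> z /\
    btw (tb_f s t) x y /\ btw (tb_f s t) x z /\ btw (tb_f s t) y z.
Proof.
  intros L (x & y & z & Hx & Hy & Hz & n1 & n2 & n3 & _).
  destruct (cls_down_at (tlt_le L) Hx) as (x' & Hx' & Ex).
  destruct (cls_down_at (tlt_le L) Hy) as (y' & Hy' & Ey).
  destruct (cls_down_at (tlt_le L) Hz) as (z' & Hz' & Ez).
  assert (N : forall (w : bset s) (v : bset t), tb_g s t w = Some v -> w <> tb_f s t).
  { intros w v E ->; rewrite tb_g_cone_pt in E by auto; discriminate. }
  exists x', y', z'; do 3 (split; [auto|]); do 3 (split; [eapply N; eauto|]).
  repeat split; try congruence; eapply g_distinct_btw; eauto.
Qed.

Lemma resolved_swap t a b c : resolved t a b c -> resolved t a c b.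
Proof.
  intros (x & y & z & Hx & Hy & Hz & n1 & n2 & n3 & H).
  exists x, z, y; do 6 (split; auto); apply btw_B1, H.
Qed.

Lemma resolved_some_order t a b c : resolved t a b c -> some_resolved t a b c.
Proof.
  intros (x & y & z & Hx & Hy & Hz & n1 & n2 & n3 & H).
  exists x, y, z; do 6 (split; auto); left; auto.
Qed.

Lemma some_order_swap t a b c : some_resolved t a b c -> some_resolved t b a c.
Proof.
  intros (x & y & z & Hx & Hy & Hz & n1 & n2 & n3 & H).
  exists y, x, z; do 6 (split; auto).
  destruct H as [H|[H|H]]; [right; left|left|right; right]; auto using btw_B1.
Qed.

(** Otherwise the triple would be a star at [s], and no arm of a star lies between the other two. *)
Lemma some_order_not_above s t a b c P : tlt s t ->
  some_resolved s a b c -> ~ split_at P t a b c.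
Proof.
  intros L (x & y & z & Hx & Hy & Hz & n1 & n2 & n3 & H) K.
  destruct (split_star L K)
    as (x' & y' & z' & Hx' & Hy' & Hz' & m1 & m2 & m3 & _ & _ & _ & h1 & h2 & h3).
  rewrite <- (cls_fun_at Hx Hx'), <- ?(cls_fun_at Hy Hy'), <- ?(cls_fun_at Hz Hz') in *.
  destruct H as [H|[H|H]].
  - apply m1, (btw_not_star H); auto.
  - apply m2, (btw_not_star H); auto using btw_B1.
  - apply m3, (btw_not_star H); auto using btw_B1.
Qed.

(** Comparable nodes are excluded by [some_order_not_above]. For incomparable ones the triple would
    be a star at their meet with two different centres. *)
Lemma some_order_unique t t' a b c :
  some_resolved t a b c -> some_resolved t' a b c -> t = t'.
Proof.
  intros H H'; destruct (tle_meet t t') as (s & L & L' & Hs).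
  destruct (tle_lt_or_eq L) as [->|K]; destruct (tle_lt_or_eq L') as [E|K']; auto.
  - destruct (some_order_not_above K' H H').
  - subst; destruct (some_order_not_above K H' H).
  - exfalso.
    destruct (split_star K H)
      as (x & y & z & Hx & Hy & Hz & m1 & m2 & m3 & _ & _ & _ & h1 & h2 & h3).
    destruct (split_star K' H')
      as (x' & y' & z' & Hx' & Hy' & Hz' & _ & _ & _ & _ & _ & _ & k1 & k2 & k3).
    rewrite <- (cls_fun_at Hx Hx'), <- ?(cls_fun_at Hy Hy'), <- ?(cls_fun_at Hz Hz') in *.
    apply (@separated_center_unique _ (tb_f s t) (tb_f s t') x y z); auto.
    intros E; apply tb_f_cone in E; auto; destruct E as (u & a' & b' & c').
    apply (tlt_not_le a'), Hs; auto.
Qed.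

Lemma resolved_unique t t' a b c : resolved t a b c -> resolved t' a b c -> t = t'.
Proof. intros H K; eapply some_order_unique; apply resolved_some_order; eauto. Qed.

Lemma resolved_middle t t' a b c : resolved t a b c -> ~ resolved t' b a c.
Proof.
  intros H K.
  assert (t = t') as <-.
  { eapply some_order_unique; [apply resolved_some_order; eauto|].
    apply some_order_swap, resolved_some_order, K. }
  destruct H as (x & y & z & Hx & Hy & Hz & n1 & n2 & n3 & H).
  destruct K as (y' & x' & z' & Hy' & Hx' & Hz' & _ & _ & _ & K).
  rewrite <- (cls_fun_at Hx Hx'), <- (cls_fun_at Hy Hy'), <- (cls_fun_at Hz Hz') in *.
  apply n1, (btw_antisym H K).
Qed.

(* In a finite stage, take the topmost node at which the three points
   are distinct; if they formed a star there, they would stay distinct in the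
   cone of its centre. *)
Lemma some_order_exists a b c : a <> b -> a <> c -> b <> c ->
  exists t, some_resolved t a b c.
Proof.
  intros nab nac nbc.
  destruct (co_cover cls_coherent nil (a :: b :: c :: nil))
    as (E & r & i & alpha & [(FE & _) _] & _ & Ha & _ & Hm).
  set (N := fun t : E => exists x y z : bset t,
    cls a (on_pt i (mkpt x)) /\ cls b (on_pt i (mkpt y)) /\ cls c (on_pt i (mkpt z)) /\
    x <> y /\ x <> z /\ y <> z).
  destruct (@finite_maximal E tlt N FE) as (t & (x & y & z & Hx & Hy & Hz & n1 & n2 & n3) & Mt).
  { exact tlt_irrefl. }
  { intros u v w H K; exact (tlt_le_trans H (tlt_le K)). }
  { destruct (Hm a) as [x <-]; [simpl; auto|].
    destruct (Hm b) as [y <-]; [simpl; auto|].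
    destruct (Hm c) as [z <-]; [simpl; auto|].
    exists r, x, y, z; do 3 (split; auto); repeat split; intros ->; auto. }
  destruct (classic (some_order x y z)) as [H|H].
  { exists (i t), (se_pt i x), (se_pt i y), (se_pt i z); do 3 (split; auto).
    assert (B := se_pt_emb i t).
    do 3 (split; [intros Q; apply (be_inj B) in Q; auto|]).
    unfold some_order; rewrite !(be_btw B); exact H. }
  exfalso; unfold some_order in H.
  destruct (@btw_positive _ x y z) as (u & h1 & h2 & h3); try tauto.
  assert (nx : x <> u) by (intros ->; tauto).
  assert (ny : y <> u) by (intros ->; apply H; auto).
  assert (nz : z <> u) by (intros ->; apply H; auto).
  assert (R : ramification_point u).
  { exists x, y, z; do 3 (split; auto); repeat split; intros (_ & _ & K); tauto. }
  (* The order is reversed to get a minimal node [s] in the cone of [u]: with no node in between,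
     passing to [s] deletes only [u] and identifies only points of one branch at [u]. *)
  destruct (@finite_maximal E (fun s s' => tlt s' s)
    (fun s => tlt t s /\ tb_f t s = u) FE) as (s & [Ls Es] & Ms).
  { exact tlt_irrefl. }
  { intros v v' w K K'; exact (tlt_le_trans K' (tlt_le K)). }
  { exact (tb_f_surj _ _ _ _ R). }
  assert (G : forall w v : bset t, w <> u -> ~ same_branch u w v -> w <> v ->
    forall m, cls m (on_pt i (mkpt w)) -> exists w' : bset s,
      tb_g t s w = Some w' /\ cls m (on_pt i (mkpt w')) /\
      forall v', tb_g t s v = Some v' -> w' <> v').
  { intros w v nw br nwv m Hmw.
    destruct (tb_g t s w) as [w'|] eqn:Ew.
    - exists w'; split; auto; split.
      + apply (co_up cls_coherent Hmw), (pm_gmap (on_pt_morphism i)).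
        split; [exact (tlt_le Ls)|exact Ew].
      + intros v' Ev E'; apply (tb_g_eq _ _ _ _ _ _ _ _ Ls Ew Ev) in E'
          as (k & p & q & Lk & Lk' & Ep & Eq & K).
        destruct (tle_lt_or_eq Lk) as [<-|Lk''].
        * rewrite tb_g_refl in Ep, Eq; injection Ep as <-; injection Eq as <-.
          rewrite Es in K; auto.
        * apply (Ms k Lk'); split; auto.
          rewrite (tb_f_up Lk'' (tlt_le Lk')); auto.
    - exfalso; apply (tb_g_dom _ _ _ _ _ Ls) in Ew as (k & Lk & Lk' & Ek).
      destruct (tle_lt_or_eq Lk) as [<-|Lk''].
      * rewrite tb_g_refl in Ek; injection Ek as ->; auto.
      * apply (Ms k Lk'); split; auto.
        rewrite (tb_f_up Lk'' (tlt_le Lk')); auto. }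
  assert (br : forall w v : bset t, btw u w v -> ~ same_branch u w v).
  { intros w v K (_ & _ & K'); auto. }
  destruct (G x y nx (br _ _ h1) n1 a Hx) as (x' & Ex & Hx' & Dxy).
  destruct (G x z nx (br _ _ h2) n2 a Hx) as (x'' & Ex' & _ & Dxz).
  rewrite Ex in Ex'; injection Ex' as <-.
  destruct (G y z ny (br _ _ h3) n3 b Hy) as (y' & Ey & Hy' & Dyz).
  destruct (G z y nz (br _ _ (btw_B1 h3)) (not_eq_sym n3) c Hz) as (z' & Ez & Hz' & _).
  apply (Mt s Ls); exists x', y', z'; auto 10.
Qed.

Lemma resolved_exists a b c : a <> b -> a <> c -> b <> c ->
  exists t, resolved t a b c \/ resolved t b a c \/ resolved t c a b.
Proof.
  intros n1 n2 n3; destruct (some_order_exists n1 n2 n3)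
    as (t & x & y & z & Hx & Hy & Hz & m1 & m2 & m3 & [H|[H|H]]); exists t.
  - left; exists x, y, z; auto 10.
  - right; left; exists y, x, z; auto 10.
  - right; right; exists z, x, y; auto 10.
Qed.

Lemma resolved_distinct t a b c : resolved t a b c -> a <> b /\ a <> c /\ b <> c.
Proof.
  intros (x & y & z & Hx & Hy & Hz & m1 & m2 & m3 & _).
  repeat split; intros ->; [apply m1|apply m2|apply m3]; eapply cls_fun_at; eauto.
Qed.

Lemma resolved_mono (pi : M -> M) (theta : StrongEmb A A) t a b c :
  automorphism_pair cls pi theta -> resolved t a b c ->
  resolved (theta t) (pi a) (pi b) (pi c).
Proof.
  intros (_ & _ & Hact) (x & y & z & Hx & Hy & Hz & m1 & m2 & m3 & H).
  assert (K : forall m (w : bset t), cls m (mkpt w) -> cls (pi m) (mkpt (se_pt theta w))).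
  { intros m w Hw; destruct (Hact m) as (p1 & Hp1 & K).
    (* The action is controlled only at nodes below that of [p1]; the class at [t] is the image of
       the class at a common lower bound. *)
    destruct (tle_lower_bound t (nd p1)) as (s & L & L').
    destruct (co_down cls_coherent Hw L) as (q & <- & Hq).
    apply (co_up cls_coherent (K q Hq L')).
    apply (pm_gmap (on_pt_morphism theta) q (mkpt w)).
    apply (co_le cls_coherent Hq Hw L). }
  exists (se_pt theta x), (se_pt theta y), (se_pt theta z).
  assert (B := se_pt_emb theta t).
  do 3 (split; [auto|]).
  do 3 (split; [intros Q; apply (be_inj B) in Q; auto|]).
  apply (be_btw B), H.
Qed.

(* With [c <> d] the node of [p a b] is strictly below that of [a b e]: any
   other relative position makes [p] indistinguishable at the latter node from
   [a] or [b], or puts [a] between [p] and [e]. *)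
Lemma resolved_order t1 t2 t3 t p a b e :
  resolved t1 p a b -> resolved t2 p a e -> resolved t3 p b e -> resolved t a b e ->
  col t3 <> col t -> col t1 = col t3 -> tlt t1 t.
Proof.
  intros H1 H2 H3 H N E; destruct (tle_meet t1 t) as (s & L1 & L & Hs).
  destruct (tle_lt_or_eq L1) as [->|K1].
  { destruct (tle_lt_or_eq L) as [->|]; [congruence|auto]. }
  exfalso; destruct (tle_lt_or_eq L) as [->|K].
  (* Here [t] is below [t1]. Seen from [a], the centre of the star is on the side of [b] and of [p];
     as [a] separates [b] from [e], it also separates [p] from [e], contradicting [H2]. *)
  - destruct (split_star K1 H1)
      as (w & x & y & Hw & Hx & Hy & m1 & m2 & m3 & d1 & d2 & d3 & h1 & h2 & h3).
    destruct H as (x' & y' & z & Hx' & Hy' & Hz & n1 & n2 & n3 & B).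
    rewrite <- (cls_fun_at Hx Hx'), <- ?(cls_fun_at Hy Hy') in *.
    assert (B1 : btw x (tb_f t t1) z).
    { destruct (btw_B3 (tb_f t t1) B) as [Q|Q]; auto.
      destruct m2; apply (btw_antisym (btw_B1 Q) h3). }
    assert (B2 : ~ btw x (tb_f t t1) w).
    { intros Q; apply m2, (btw_antisym Q (btw_B1 h1)). }
    apply (resolved_middle (t := t) (t' := t2) (a := a) (b := p) (c := e)); auto.
    exists x, w, z; do 3 (split; auto); repeat split; auto.
    + intros ->; auto.
    + destruct (btw_B3 w B1); tauto.
  - destruct (split_star K1 H1)
      as (w & x & y & Hw & Hx & Hy & m1 & m2 & m3 & d1 & d2 & d3 & h1 & h2 & h3).
    destruct (split_star K H)
      as (x' & y' & z & Hx' & Hy' & Hz & _ & _ & m4 & _ & d5 & d6 & k1 & k2 & k3).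
    rewrite <- (cls_fun_at Hx Hx'), <- ?(cls_fun_at Hy Hy') in *.
    assert (No : tb_f s t1 <> tb_f s t).
    { intros Q; apply tb_f_cone in Q; auto; destruct Q as (u & a' & b' & c').
      apply (tlt_not_le a'), Hs; auto. }
    destruct H as (at' & bt & et & Ha & Hb & He & n1 & n2 & n3 & B).
    (* Of [a] and [b], at least one is separated at the first centre from the second one. By
       [same_side] that point shares a branch at the second centre with [p], and [g_follow] gives
       [p] its class at [t]. With the class of [a], [p] is between [b] and [e] at [t], so [t3 = t];
       with the class of [b], [a] is between [p] and [e]. *)
    destruct (btw_B3 (tb_f s t) h3) as [Q|Q].
    + destruct (same_side No h2 h3 k1 Q) as [S1 S2].
      assert (Hp : cls p (mkpt at')).
      { apply (cls_up_at L Hw), (g_follow K (cls_g L Hx Ha) S1 S2). }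
      assert (R : resolved t p b e) by (exists at', bt, et; auto 10).
      apply N; rewrite (resolved_unique H3 R); auto.
    + destruct (same_side No h1 (btw_B1 h3) (btw_B1 k1) (btw_B1 Q)) as [S1 S2].
      assert (Hp : cls p (mkpt bt)).
      { apply (cls_up_at L Hw), (g_follow K (cls_g L Hy Hb) S1 S2). }
      apply (resolved_middle (t := t) (t' := t2) (a := a) (b := p) (c := e)); auto.
      exists at', bt, et; auto 10.
Qed.

Hypothesis TC_spec : is_T_C TC.
Hypothesis A_limit : is_limit TC A.
Hypothesis C_no_least : no_least C.

Lemma resolved_conjugate t t' a b c a' b' c' :
  resolved t a b c -> resolved t' a' b' c' -> col t = col t' ->
  exists pi theta, automorphism_pair cls pi theta /\ pi a = a' /\ pi b = b' /\ pi c = c'.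
Proof.
  intros (x & y & z & Hx & Hy & Hz & n1 & n2 & n3 & H)
    (x' & y' & z' & Hx' & Hy' & Hz' & n1' & n2' & n3' & H') E.
  assert (T : is_B_embedding (tri_map y x z : tri_bset -> _))
    by (apply tri_map_embedding; auto).
  assert (T' : is_B_embedding (tri_map y' x' z' : tri_bset -> _))
    by (apply tri_map_embedding; auto).
  set (i := single_node_embedding (tri0 : tri_bset)
    (@linear_bset_no_ramification _ _ tri_nat_inj tri0) E T).
  set (j := single_node_embedding (tri0 : tri_bset)
    (@linear_bset_no_ramification _ _ tri_nat_inj tri0) eq_refl T').
  assert (F : finite_over TC (triple_node (col t'))).
  { split; [apply triple_node_finite|]. apply single_node_over, TC_colour, TC_spec. }
  assert (Ri : forall u : tri, cls (tri_map b a c u)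
    (on_pt i (mkpt (A := triple_node (col t')) (t := tt) u))) by (intros []; auto).
  assert (Rj : forall u : tri, cls (tri_map b' a' c' u)
    (on_pt j (mkpt (A := triple_node (col t')) (t := tt) u))) by (intros []; auto).
  destruct (state_extends TC_spec A_limit C_no_least cls_coherent
    {| sD := triple_node (col t'); sr := (tt : triple_node (col t')); si := i; sj := j;
       sa := tri_map b a c; sb := tri_map b' a' c'; s_finite := F;
       s_root := (fun _ => I) : @is_root C (triple_node (col t')) tt;
       s_three := triple_node_three tt; s_cls_a := Ri; s_cls_b := Rj |})
    as (pi & theta & P & Q).
  exists pi, theta; split; auto; split; [exact (Q tri1)|split; [exact (Q tri0)|exact (Q tri2)]].
Qed.

Lemma resolved_colour (d : C) : exists t a b c, resolved t a b c /\ col t = d.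
Proof.
  assert (F : finite_over TC (triple_node d)).
  { split; [apply triple_node_finite|]. apply single_node_over, TC_colour, TC_spec. }
  destruct (lim_universal A_limit F) as [e].
  set (x := fun u : tri => se_pt e (u : bset (tt : triple_node d))).
  destruct (class_of_pt cls_coherent (mkpt (x tri1))) as [a Ha].
  destruct (class_of_pt cls_coherent (mkpt (x tri0))) as [b Hb].
  destruct (class_of_pt cls_coherent (mkpt (x tri2))) as [c Hc].
  exists (e tt), a, b, c; split; [|apply (te_col (se_node_emb e))].
  assert (B := se_pt_emb e (tt : triple_node d)).
  exists (x tri1), (x tri0), (x tri2); do 3 (split; [auto|]).
  do 3 (split; [intros Q; apply (be_inj B) in Q; discriminate|]).
  apply (be_btw B); simpl; lia.
Qed.

Lemma resolved_nested (c d : C) : clt c d -> exists s t p a b e,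
  col s = c /\ col t = d /\
  resolved s p a b /\ resolved s p a e /\ resolved s p b e /\ resolved t a b e.
Proof.
  intros H; destruct (exists_pair TC_spec A_limit c) as (p0 & p1 & E & N & Ec).
  subst c; destruct (exists_triple_in_cone TC_spec A_limit E N H)
    as (l & m & w & K1 & K2 & K3 & _ & n1 & n2 & n3 & K4).
  destruct K4 as (t & bm & bl & bw & -> & -> & -> & B); simpl in K1, K2, K3.
  set (s := nd p0) in *.
  destruct (tb_g_surj _ _ _ _ bm K1) as [xm Em].
  destruct (tb_g_surj _ _ _ _ bl K1) as [xl El].
  destruct (tb_g_surj _ _ _ _ bw K1) as [xw Ew].
  assert (nml : bm <> bl) by congruence.
  assert (nmw : bm <> bw) by congruence.
  assert (nlw : bl <> bw) by congruence.
  destruct (class_of_pt cls_coherent (cone_pt s t)) as [p Hp].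
  destruct (class_of_pt cls_coherent (mkpt xm)) as [a Ha].
  destruct (class_of_pt cls_coherent (mkpt xl)) as [b Hb].
  destruct (class_of_pt cls_coherent (mkpt xw)) as [e He].
  assert (Nf : forall (w : bset s) (v : bset t), tb_g s t w = Some v -> tb_f s t <> w).
  { intros v v' Ev <-; rewrite tb_g_cone_pt in Ev by auto; discriminate. }
  exists s, t, p, a, b, e; do 2 (split; auto).
  repeat split.
  - exists (tb_f s t), xm, xl; repeat split; eauto using g_distinct_btw; congruence.
  - exists (tb_f s t), xm, xw; repeat split; eauto using g_distinct_btw; congruence.
  - exists (tb_f s t), xl, xw; repeat split; eauto using g_distinct_btw; congruence.
  - exists bm, bl, bw; repeat split; auto;
      eapply cls_up_at; try exact (tlt_le K1); eauto.
Qed.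
End Resolution.

(** * Uniqueness of the coloured tree *)

Section MeetColour.
Context {C : Chain} {T : ColouredTree C}.
Implicit Types m x y z : T.

Definition meet x y : T := proj1_sig (constructive_indefinite_description _ (tle_meet x y)).

Lemma meet_is_meet x y : is_meet tle x y (meet x y).
Proof. exact (proj2_sig (constructive_indefinite_description _ (tle_meet x y))). Qed.

Lemma meet_eq x y m : is_meet tle x y m -> meet x y = m.
Proof. apply is_meet_unique, meet_is_meet. Qed.

(** This behaves like an ultrametric and determines the order, see [tle_meet_col]; a finite partial
    isomorphism therefore only has to respect this one function. *)
Definition meet_col x y : C := col (meet x y).

Lemma meet_col_refl x : meet_col x x = col x.
Proof. unfold meet_col; f_equal; apply meet_eq, is_meet_le, tle_refl. Qed.

Lemma meet_col_sym x y : meet_col x y = meet_col y x.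
Proof. unfold meet_col; f_equal; apply meet_eq, is_meet_sym, meet_is_meet. Qed.

Lemma tle_meet_col x y : tle x y <-> meet_col x y = col x.
Proof.
  unfold meet_col; split.
  - intros H; f_equal; apply meet_eq, is_meet_le, H.
  - intros E; destruct (meet_is_meet x y) as (a & b & _).
    rewrite <- (col_below_inj a (tle_refl x) E); auto.
Qed.

Lemma tle_of_meet_col m x y :
  tle m x -> cle (col m) (meet_col x y) -> tle m y.
Proof.
  intros H E; destruct (meet_is_meet x y) as (a & b & _).
  exact (tle_trans (col_below_le H a E) b).
Qed.

Lemma meet_col_of_tle m x y : tle m x -> tle m y -> cle (col m) (meet_col x y).
Proof. intros H K; apply col_le; apply meet_is_meet; auto. Qed.

(** The meet of [x] and [z] lies below [m], so it does not change when [x] is replaced by another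
    point above [m]. *)
Lemma meet_col_not_above m x y z :
  tle m x -> tle m y -> ~ tle m z -> meet_col x z = meet_col y z.
Proof.
  intros Hx Hy N; unfold meet_col; f_equal; symmetry; apply meet_eq.
  destruct (meet_is_meet x z) as (a & b & c).
  assert (L : tle (meet x z) m).
  { destruct (tle_below_total a Hx) as [|K]; auto; destruct N; eapply tle_trans; eauto. }
  split; [eapply tle_trans; eauto|split; auto].
  intros u uy uz; apply c; auto.
  destruct (tle_below_total uy Hy) as [K|K]; [eapply tle_trans; eauto|].
  destruct N; eapply tle_trans; eauto.
Qed.
End MeetColour.

Lemma TC_below (C : Chain) (T : ColouredTree C) (y : T) (c : C) :
  is_T_C T -> cle c (col y) -> exists m : T, tle m y /\ col m = c.
Proof.
  intros (_ & _ & _ & H) L; destruct (H y) as (S & Sy & Tot & K).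
  destruct (K c) as (m & Sm & <-); exists m; split; auto.
  destruct (Tot m y Sm Sy) as [|Q]; auto.
  rewrite (col_below_inj (tle_refl m) Q); auto using tle_refl.
  apply cle_antisym; auto using col_le.
Qed.

Lemma list_max (C : Chain) (X : Type) (f : X -> C) (l : list X) : l <> nil ->
  exists x, In x l /\ forall y, In y l -> cle (f y) (f x).
Proof.
  induction l as [|a l IH]; [congruence|intros _].
  destruct l as [|b l].
  - exists a; split; [left; auto|]. intros y [->|[]]; apply cle_refl.
  - destruct IH as (x & Hx & Mx); [discriminate|].
    destruct (cle_total (f x) (f a)) as [L|L].
    + exists a; split; [left; auto|]. intros y [->|Hy]; [apply cle_refl|].
      eapply cle_trans; eauto.
    + exists x; split; [right; auto|]. intros y [<-|Hy]; auto.
Qed.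

Section Uniqueness.
Context {C C' : Chain} {T : ColouredTree C} {T' : ColouredTree C'}.

Hypothesis T'_spec : is_T_C T'.
Variable sigma : C -> C'.
Hypothesis sigma_le : forall c d, cle (sigma c) (sigma d) <-> cle c d.

Definition matching (l : list (T * T')) : Prop := forall p q, In p l -> In q l ->
  meet_col (snd p) (snd q) = sigma (meet_col (fst p) (fst q)).

(** Choose a matched [x0] whose meet [m] with [x] has the largest colour. A matched point not above
    [m] meets [x] as it meets [x0], and one above [m] meets [x] exactly in [m]. So [y] is sought
    above the node [m'] below [y0] that corresponds to [m], meeting every matched node above [m'] in
    [m'] itself. *)
Lemma matching_extend l x : matching l -> exists y, matching ((x, y) :: l).
Proof.
  intros Hl.
  enough (K : exists y, col y = sigma (col x) /\
    forall p, In p l -> meet_col y (snd p) = sigma (meet_col x (fst p))).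
  { destruct K as (y & Ey & Ky); exists y; intros p q [<-|Hp] [<-|Hq]; simpl; auto.
    - rewrite !meet_col_refl; auto.
    - rewrite meet_col_sym, (meet_col_sym _ x); auto. }
  destruct (classic (l = nil)) as [->|Nl].
  { destruct (TC_colour T'_spec (sigma (col x))) as [y Ey]; exists y; split; auto.
    intros p []. }
  destruct (list_max (fun p : T * T' => meet_col x (fst p)) Nl) as ([x0 y0] & H0 & Max).
  simpl in Max; set (m := meet x x0).
  destruct (meet_is_meet x x0) as (mx & mx0 & _); fold m in mx, mx0.
  assert (Ey0 : col y0 = sigma (col x0)).
  { assert (K := Hl _ _ H0 H0); rewrite !meet_col_refl in K; exact K. }
  destruct (@TC_below _ _ y0 (sigma (col m)) T'_spec) as (m' & Hm' & Em').
  { rewrite Ey0; apply sigma_le, col_le, mx0. }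
  assert (above : forall p, In p l -> (tle m' (snd p) <-> tle m (fst p))).
  { intros p Hp; assert (K := Hl _ _ H0 Hp); simpl in K; split; intros L.
    - apply (tle_of_meet_col mx0), sigma_le; rewrite <- K, <- Em'.
      apply meet_col_of_tle; auto.
    - apply (tle_of_meet_col Hm'); rewrite K, Em'; apply sigma_le, meet_col_of_tle; auto. }
  enough (K : exists y, col y = sigma (col x) /\ tle m' y /\
    forall p, In p l -> tle m' (snd p) -> is_meet tle y (snd p) m').
  { destruct K as (y & Ey & Ly & Ky); exists y; split; auto; intros p Hp.
    destruct (classic (tle m (fst p))) as [L|L].
    - unfold meet_col at 1; rewrite (meet_eq (Ky p Hp (proj2 (above p Hp) L))), Em'.
      f_equal; apply cle_antisym; [|exact (Max p Hp)].
      apply meet_col_of_tle; auto.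
    - rewrite (meet_col_not_above mx mx0 L).
      assert (K := Hl _ _ H0 Hp); simpl in K; rewrite <- K.
      apply (meet_col_not_above Ly Hm'); rewrite above; auto. }
  destruct (tle_lt_or_eq mx) as [E|Lx].
  - exists m'; rewrite Em', E; split; auto; split; auto using tle_refl.
    intros p _ L; apply is_meet_le, L.
  - assert (Hd : clt (col m') (sigma (col x))).
    { rewrite Em'; destruct Lx as [L1 N1]; destruct (col_lt L1 N1) as [L2 N2].
      split; [apply sigma_le, L2|]. intros Q; apply N2, cle_antisym; auto.
      apply sigma_le; rewrite Q; apply cle_refl. }
    destruct (TC_cones T'_spec Hd) as (u & Hu & Uu).
    (* Each matched node lies in at most one of the infinitely many cones [u k], so a late cone
       avoids all of them. *)
    assert (F : eventually (fun k => forall p, In p l -> ~ same_cone m' (u k) (snd p))).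
    { apply (eventually_list (P := fun p k => ~ same_cone m' (u k) (snd p))); intros p.
      destruct (classic (exists i, same_cone m' (u i) (snd p))) as [[i Hi]|N].
      - exists (S i); intros k Lk K.
        assert (i = k); [|lia]. eauto using same_cone_trans, same_cone_sym.
      - exists 0; eauto. }
    destruct (eventually_ex F) as [k Hk]; exists (u k).
    destruct (Hu k) as [L1 L2]; split; auto; split; [apply tlt_le, L1|].
    intros p Hp L; destruct (tle_lt_or_eq L) as [E|L'].
    + rewrite <- E; apply is_meet_sym, is_meet_le, tlt_le, L1.
    + apply not_same_cone_meet; auto.
Qed.
End Uniqueness.

Lemma matching_swap (C C' : Chain) (T : ColouredTree C) (T' : ColouredTree C')
  (sigma : C -> C') (tau : C' -> C) (l : list (T * T')) :
  (forall c, tau (sigma c) = c) -> matching sigma l ->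
  matching tau (map (fun p => (snd p, fst p)) l).
Proof.
  intros H K p q Hp Hq; apply in_map_iff in Hp as (p' & <- & Hp).
  apply in_map_iff in Hq as (q' & <- & Hq); simpl; rewrite K, H; auto.
Qed.

Lemma TC_unique (C C' : Chain) (T : ColouredTree C) (T' : ColouredTree C') :
  is_T_C T -> is_T_C T' -> chain_isomorphic C C' -> coloured_tree_isomorphic T T'.
Proof.
  intros HT HT' (sigma & Bs & Ls); exists sigma.
  destruct Bs as (tau & ts & st).
  assert (Lt : forall c d, cle (tau c) (tau d) <-> cle c d).
  { intros c d; rewrite <- Ls, !st; tauto. }
  destruct HT as (HT0 & [f Hf] & HT1), HT' as (HT0' & [f' Hf'] & HT1').
  assert (HT : is_T_C T) by (split; [|split]; auto; exists f; auto).
  assert (HT' : is_T_C T') by (split; [|split]; auto; exists f'; auto).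
  set (X := {l : list (T * T') | matching sigma l}).
  set (le := fun k l : X => forall p, In p (proj1_sig k) -> In p (proj1_sig l)).
  assert (fwd : forall (l : X) x, exists l' : X, le l l' /\ exists y, In (x, y) (proj1_sig l')).
  { intros [l Hl] x; destruct (matching_extend HT' Ls x Hl) as [y Hy].
    exists (exist _ _ Hy); split; [intros p Hp; right; auto|exists y; left; auto]. }
  assert (bwd : forall (l : X) y, exists l' : X, le l l' /\ exists x, In (x, y) (proj1_sig l')).
  { intros [l Hl] y.
    destruct (matching_extend HT Lt y (matching_swap (tau := tau) ts Hl)) as [x Hx].
    assert (K := matching_swap (tau := sigma) st Hx); simpl in K.
    rewrite map_map in K; simpl in K.
    assert (E : map (fun p : T * T' => (fst p, snd p)) l = l).
    { rewrite <- (map_id l) at 2; apply map_ext; intros []; auto. }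
    rewrite E in K.
    exists (exist _ _ K); split; [intros p Hp; right; auto|exists x; left; auto]. }
  assert (matching_nil : matching (T := T) (T' := T') sigma nil) by (intros p q []).
  destruct (@generic_sequence X le (fun n l =>
    (forall x, f x = n -> exists y, In (x, y) (proj1_sig l)) /\
    (forall y, f' y = n -> exists x, In (x, y) (proj1_sig l)))
    (exist _ nil matching_nil))
    as (g & _ & Hg).
  { intros n l.
    assert (K : exists l', le l l' /\ forall x, f x = n -> exists y, In (x, y) (proj1_sig l')).
    { destruct (classic (exists x, f x = n)) as [[x Hx]|N].
      - destruct (fwd l x) as (l' & L & K); exists l'; split; auto.
        intros z Hz; rewrite <- (Hf z x) in K by congruence; auto.
      - exists l; split; [intros p; auto|]. intros x Hx; destruct N; eauto. }
    destruct K as (l' & L & K).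
    assert (K' : exists l'', le l' l'' /\ forall y, f' y = n -> exists x, In (x, y) (proj1_sig l'')).
    { destruct (classic (exists y, f' y = n)) as [[y Hy]|N].
      - destruct (bwd l' y) as (l'' & L' & K'); exists l''; split; auto.
        intros z Hz; rewrite <- (Hf' z y) in K' by congruence; auto.
      - exists l'; split; [intros p; auto|]. intros x Hx; destruct N; eauto. }
    destruct K' as (l'' & L' & K'); exists l''; split; [intros p Hp; apply L', L, Hp|].
    split; auto. intros x Hx; destruct (K x Hx) as [y Hy]; exists y; apply L', Hy. }
  assert (mono : forall n m, n <= m -> le (g n) (g m)).
  { induction 1 as [|m _ IH]; [intros p; auto|]. intros p Hp; apply Hg, IH, Hp. }
  set (R := fun x y => exists n, In (x, y) (proj1_sig (g n))).
  assert (HR : forall x y x' y', R x y -> R x' y' -> meet_col y y' = sigma (meet_col x x')).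
  { intros x y x' y' [n Hn] [m Hm].
    apply (mono n (max n m)) in Hn; [|lia]. apply (mono m (max n m)) in Hm; [|lia].
    exact (proj2_sig (g (max n m)) _ _ Hn Hm). }
  assert (Rc : forall x y, R x y -> col y = sigma (col x)).
  { intros x y H; assert (K := HR _ _ _ _ H H); rewrite !meet_col_refl in K; auto. }
  assert (sinj : forall c d, sigma c = sigma d -> c = d).
  { intros c d E; rewrite <- (ts c), <- (ts d), E; auto. }
  assert (Rle : forall x y x' y', R x y -> R x' y' -> (tle y y' <-> tle x x')).
  { intros x y x' y' H H'; rewrite !tle_meet_col, (HR _ _ _ _ H H'), (Rc _ _ H).
    split; [apply sinj|congruence]. }
  assert (Rt : forall x, exists y, R x y).
  { intros x; destruct (proj2 (Hg (f x))) as [K _]; destruct (K x eq_refl) as [y Hy].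
    exists y, (S (f x)); auto. }
  set (h := fun x => proj1_sig (constructive_indefinite_description _ (Rt x))).
  assert (Rh : forall x, R x (h x)).
  { intros x; exact (proj2_sig (constructive_indefinite_description _ (Rt x))). }
  exists h; split; [exists tau; auto|]. split; auto. split; [|split].
  - apply bijective_of_inj_surj.
    + intros x y E; assert (K : tle (h x) (h y) /\ tle (h y) (h x))
        by (rewrite E; auto using tle_refl).
      rewrite !(Rle _ _ _ _ (Rh _) (Rh _)) in K; apply tle_antisym; tauto.
    + intros y; destruct (proj2 (Hg (f' y))) as [_ K]; destruct (K y eq_refl) as [x Hx].
      assert (Rxy : R x y) by (exists (S (f' y)); auto).
      exists x; apply tle_antisym; apply (Rle x _ x _); auto using tle_refl.
  - intros s t; apply Rle; auto.
  - intros t; apply Rc; auto.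
Qed.

(** * Recovering the colours *)

Definition induced (C : Chain) (A : TreeOfBSets C) (M : Type)
    (cls : M -> pt A -> Prop) (pi : M -> M) : Prop :=
  exists theta, automorphism_pair cls pi theta.

Section Transfer.
Context {C1 C2 : Chain} {TC1 : ColouredTree C1} {TC2 : ColouredTree C2}.
Context {A1 : TreeOfBSets C1} {A2 : TreeOfBSets C2} {M1 M2 : Type}.
Context {cls1 : M1 -> pt A1 -> Prop} {cls2 : M2 -> pt A2 -> Prop}.
Hypothesis TC1_spec : is_T_C TC1.
Hypothesis TC2_spec : is_T_C TC2.
Hypothesis A1_limit : is_limit TC1 A1.
Hypothesis A2_limit : is_limit TC2 A2.
Hypothesis C1_no_least : no_least C1.
Hypothesis C2_no_least : no_least C2.
Hypothesis cls1_coherent : coherent TC1 cls1.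
Hypothesis cls2_coherent : coherent TC2 cls2.
Variable h : M1 -> M2.
Hypothesis h_bij : Bijective h.
Hypothesis h_forth : forall p1, induced cls1 p1 ->
  exists p2, induced cls2 p2 /\ forall a, p2 (h a) = h (p1 a).
Hypothesis h_back : forall p2, induced cls2 p2 ->
  exists p1, induced cls1 p1 /\ forall a, p2 (h a) = h (p1 a).

Let h_inj : Injective h.
Proof.
  destruct h_bij as (g & gh & _); intros a b E.
  rewrite <- (gh a), <- (gh b), E; auto.
Qed.

(* In a triple exactly the middle point can be fixed while the other two are
   interchanged. *)
Lemma resolved_transfer t a b c : resolved (cls := cls1) t a b c ->
  exists u, resolved (cls := cls2) u (h a) (h b) (h c).
Proof.
  intros H.
  destruct (resolved_conjugate cls1_coherent TC1_spec A1_limit C1_no_least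
    H (resolved_swap H) eq_refl) as (pi & theta & P & Ea & Eb & Ec).
  destruct (h_forth (ex_intro _ _ P)) as (pi2 & [theta2 P2] & K).
  assert (Ka : pi2 (h a) = h a) by (rewrite K, Ea; auto).
  assert (Kb : pi2 (h b) = h c) by (rewrite K, Eb; auto).
  assert (Kc : pi2 (h c) = h b) by (rewrite K, Ec; auto).
  destruct (resolved_distinct cls1_coherent H) as (n1 & n2 & n3).
  destruct (resolved_exists cls2_coherent (a := h a) (b := h b) (c := h c))
    as (u & [R|[R|R]]); auto.
  - eauto.
  - assert (R' := resolved_mono cls2_coherent P2 R); rewrite Ka, Kb, Kc in R'.
    destruct (resolved_middle cls2_coherent (resolved_swap R) (resolved_swap R')).
  - assert (R' := resolved_mono cls2_coherent P2 R); rewrite Ka, Kb, Kc in R'.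
    destruct (resolved_middle cls2_coherent (resolved_swap R) (resolved_swap R')).
Qed.

(** Triples of equal colour are conjugate and conjugacy passes along [h]; since automorphisms keep
    colours, [resolved_unique] then equates the colours on the other side. *)
Lemma colour_transfer t t' u u' a b c a' b' c' :
  resolved (cls := cls1) t a b c -> resolved (cls := cls1) t' a' b' c' ->
  resolved (cls := cls2) u (h a) (h b) (h c) -> resolved (cls := cls2) u' (h a') (h b') (h c') ->
  col t = col t' <-> col u = col u'.
Proof.
  intros H H' K K'; split; intros E.
  - destruct (resolved_conjugate cls1_coherent TC1_spec A1_limit C1_no_least
      H H' E) as (pi & theta & P & <- & <- & <-).
    destruct (h_forth (ex_intro _ _ P)) as (pi2 & [theta2 P2] & Q).
    assert (R := resolved_mono cls2_coherent P2 K); rewrite !Q in R.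
    rewrite <- (resolved_unique cls2_coherent R K').
    symmetry; apply (te_col (se_node_emb theta2)).
  - destruct (resolved_conjugate cls2_coherent TC2_spec A2_limit C2_no_least
      K K' E) as (pi & theta & P & Qa & Qb & Qc).
    destruct (h_back (ex_intro _ _ P)) as (pi1 & [theta1 P1] & Q).
    rewrite Q in Qa, Qb, Qc; apply h_inj in Qa, Qb, Qc.
    assert (R := resolved_mono cls1_coherent P1 H); rewrite Qa, Qb, Qc in R.
    rewrite <- (resolved_unique cls1_coherent R H').
    symmetry; apply (te_col (se_node_emb theta1)).
Qed.

Lemma colours_isomorphic : chain_isomorphic C1 C2.
Proof.
  assert (S : forall c, exists d, forall t a b e u, resolved (cls := cls1) t a b e ->
    col t = c -> resolved (cls := cls2) u (h a) (h b) (h e) -> col u = d).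
  { intros c.
    destruct (resolved_colour cls1_coherent TC1_spec A1_limit c) as (t & a & b & e & R & Et).
    destruct (resolved_transfer R) as [u Ru]; exists (col u).
    intros t' a' b' e' u' R' Et' Ru'; apply (colour_transfer R' R Ru' Ru); congruence. }
  set (sigma := fun c => proj1_sig (constructive_indefinite_description _ (S c))).
  assert (Hs : forall t a b e u, resolved (cls := cls1) t a b e ->
    resolved (cls := cls2) u (h a) (h b) (h e) -> col u = sigma (col t)).
  { intros t a b e u R R'.
    exact (proj2_sig (constructive_indefinite_description _ (S (col t))) t a b e u R eq_refl R'). }
  assert (inj : Injective sigma).
  { intros c d E.
    destruct (resolved_colour cls1_coherent TC1_spec A1_limit c) as (t & a & b & e & R & <-).
    destruct (resolved_colour cls1_coherent TC1_spec A1_limit d) as (t' & a' & b' & e' & R' & <-).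
    destruct (resolved_transfer R) as [u Ru], (resolved_transfer R') as [u' Ru'].
    apply (colour_transfer R R' Ru Ru').
    rewrite (Hs _ _ _ _ _ R Ru), (Hs _ _ _ _ _ R' Ru'); auto. }
  assert (mono : forall c d, clt c d -> clt (sigma c) (sigma d)).
  { intros c d L.
    destruct (resolved_nested cls1_coherent TC1_spec A1_limit L)
      as (s & t & p & a & b & e & <- & <- & R1 & R2 & R3 & R).
    destruct (resolved_transfer R1) as [u1 K1], (resolved_transfer R2) as [u2 K2],
      (resolved_transfer R3) as [u3 K3], (resolved_transfer R) as [u K].
    rewrite <- (Hs _ _ _ _ _ R1 K1), <- (Hs _ _ _ _ _ R K).
    destruct (resolved_order cls2_coherent K1 K2 K3 K) as [L1 L2].
    - rewrite (Hs _ _ _ _ _ R3 K3), (Hs _ _ _ _ _ R K).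
      intros E; apply inj in E; destruct L; auto.
    - rewrite (Hs _ _ _ _ _ R3 K3), (Hs _ _ _ _ _ R1 K1); auto.
    - apply col_lt; auto. }
  exists sigma; split.
  - apply bijective_of_inj_surj; auto; intros d.
    destruct (resolved_colour cls2_coherent TC2_spec A2_limit d) as (u & x & y & z & R & <-).
    destruct h_bij as (g & _ & hg).
    rewrite <- (hg x), <- (hg y), <- (hg z) in R.
    destruct (resolved_distinct cls2_coherent R) as (n1 & n2 & n3).
    (* The triple of colour [d] is pulled back along [h]. Its middle point must be [g x]: any other
       would transfer to a second middle point in [M2]. *)
    destruct (resolved_exists cls1_coherent (a := g x) (b := g y) (c := g z))
      as (t & K); try congruence.
    exists (col t); destruct K as [K|[K|K]].
    + symmetry; exact (Hs _ _ _ _ _ K R).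
    + destruct (resolved_transfer K) as [u' Ru'].
      destruct (resolved_middle cls2_coherent R Ru').
    + destruct (resolved_transfer K) as [u' Ru'].
      destruct (resolved_middle cls2_coherent (resolved_swap R) Ru').
  - intros c d; split; intros H.
    + apply NNPP; intros N; apply not_cle, mono, clt_not_cle in N; auto.
    + destruct (classic (c = d)) as [->|N]; [apply cle_refl|].
      apply (mono c d); split; auto.
Qed.
End Transfer.

Lemma Aut_perm_induced (C : Chain) (TC : ColouredTree C) (A : TreeOfBSets C)
  (U : UnionOfChain TC A) (M : LimitSet U) (pi : M -> M) :
  @Aut_perm C TC A U M pi <-> induced (@limit_class C TC A U M) pi.
Proof.
  split.
  - intros (B & theta & I & H); exists theta; split; [|split]; auto.
    intros a; apply acts_iff; auto.
  - intros (theta & B & I & H); split; auto; exists theta; split; auto.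
    intros a; apply acts_iff; auto.
Qed.

Theorem theorem6p2 (C1 C2 : Chain)
    (C1_countable : countable C1) (C2_countable : countable C2)
    (C1_no_least : no_least C1) (C2_no_least : no_least C2)
    (TC1 : ColouredTree C1) (TC2 : ColouredTree C2)
    (TC1_spec : is_T_C TC1) (TC2_spec : is_T_C TC2)
    (A1 : TreeOfBSets C1) (A2 : TreeOfBSets C2)
    (A1_limit : is_limit TC1 A1) (A2_limit : is_limit TC2 A2)
    (U1 : UnionOfChain TC1 A1) (U2 : UnionOfChain TC2 A2)
    (M1 : LimitSet U1) (M2 : LimitSet U2) :
  perm_groups_isomorphic (@Aut_perm C1 TC1 A1 U1 M1)
                         (@Aut_perm C2 TC2 A2 U2 M2) ->
  coloured_tree_isomorphic TC1 TC2 /\ chain_isomorphic C1 C2.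
Proof.
  intros (h & Bh & forth & back).
  assert (K : chain_isomorphic C1 C2).
  { apply (colours_isomorphic TC1_spec TC2_spec A1_limit A2_limit C1_no_least C2_no_least
      (limit_class_coherent M1) (limit_class_coherent M2) Bh).
    - intros p1 H1; destruct (forth p1) as (p2 & H2 & E); [apply Aut_perm_induced, H1|].
      exists p2; split; auto; apply Aut_perm_induced, H2.
    - intros p2 H2; destruct (back p2) as (p1 & H1 & E); [apply Aut_perm_induced, H2|].
      exists p1; split; auto; apply Aut_perm_induced, H1. }
  split; auto; apply TC_unique; auto.
Qed.
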